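(* The following decision problem is in $\textsc{2ExpTime}$: given an arena $\mathcal{A} = (V, V_0, V_1, E, v_I)$ and a weight function $w \colon E \to \mathbb{Z}$ (weights encoded in binary), decide whether there exists a threshold $t \in \mathbb{N}$ such that Player~$0$ wins the game $(\mathcal{A}, \mathsf{AvgEnergy_L}(w, t))$.
   Context: An arena $\mathcal{A} = (V, V_0, V_1, E, v_I)$ consists of a finite directed graph $(V,E)$ in which every vertex has at least one outgoing edge, a partition $V = V_0 \uplus V_1$ (vertices of Player~$0$ and Player~$1$), and an initial vertex $v_I$. A play is an infinite path $v_0 v_1 v_2 \cdots$ with $v_0 = v_I$. A strategy for Player~$i$ is a map $\sigma \colon V^* V_i \to V$ with $(v, \sigma(xv)) \in E$ for all $xv \in V^*V_i$; a play is consistent with $\sigma$ if $v_{n+1} = \sigma(v_0\cdots v_n)$ whenever $v_n \in V_i$. Given a set $\mathrm{Win} \subseteq V^\omega$ (the objective), Player~$0$ wins the game $(\mathcal{A}, \mathrm{Win})$ if she has a strategy all of whose consistent plays lie in $\mathrm{Win}$. For a weight function $w \colon E \to \mathbb{Z}$, the energy level of a finite path is $\mathrm{EL}(v_0 \cdots v_n) = \sum_{i=0}^{n-1} w(v_i, v_{i+1})$ (initial energy $0$). Objectives: $\mathsf{Energy_L}(w) = \{ v_0 v_1 \cdots \mid \forall n.\ 0 \le \mathrm{EL}(v_0\cdots v_n)\}$; $\mathsf{AE}(w,t) = \{ v_0 v_1 \cdots \mid \limsup_{n\to\infty} \frac{1}{n}\sum_{i=0}^{n-1} \mathrm{EL}(v_0\cdots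 v_i) \le t\}$; $\mathsf{AvgEnergy_L}(w,t) = \mathsf{Energy_L}(w) \cap \mathsf{AE}(w,t)$. *)

(* Defs.v *)
From HB Require Import structures.
From mathcomp Require Import all_boot all_order all_algebra.
From mathcomp Require Import all_classical all_reals.
From mathcomp Require Import ereal topology normedtype sequences.
From mathcomp Require Import Rstruct.

Set Implicit Arguments.
Unset Strict Implicit.
Unset Printing Implicit Defensive.

Import Order.TTheory GRing.Theory Num.Theory.
Local Open Scope ring_scope.

(* An arena over a carrier type V: vertex set inV, edge relation E,
   the Player-1 vertices own1 (Player-0 vertices are the others in inV),
   and the initial vertex vI. *)
Record arena (V : Type) := Arena {
  ar_inV : pred V;
  ar_E : rel V;
  ar_own1 : pred V;
  ar_vI : V }.

Definition prefix (V : Type) (pi : nat -> V) (n : nat) : seq V :=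
  [seq pi i | i <- iota 0 n].

Definition is_play (V : Type) (A : arena V) (pi : nat -> V) : Prop :=
  pi 0%N = ar_vI A /\
  forall n, ar_inV A (pi n) /\ ar_E A (pi n) (pi n.+1).

(* a strategy for player p (p = false : Player 0, p = true : Player 1)
   is a map sigma : V^* V_p -> V, written curried as sigma x v for xv *)
Definition is_strategy (V : Type) (A : arena V) (p : bool)
    (sigma : seq V -> V -> V) : Prop :=
  forall (x : seq V) (v : V),
    all (ar_inV A) x -> ar_inV A v -> ar_own1 A v = p ->
    ar_E A v (sigma x v).

Definition consistent (V : Type) (A : arena V) (p : bool)
    (sigma : seq V -> V -> V) (pi : nat -> V) : Prop :=
  forall n, ar_own1 A (pi n) = p -> pi n.+1 = sigma (prefix pi n) (pi n).

Definition player0_wins (V : Type) (A : arena V) (Win : (nat -> V) -> Prop)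
    : Prop :=
  exists sigma, is_strategy A false sigma /\
    forall pi, is_play A pi -> consistent A false sigma pi -> Win pi.

Definition EL (V : Type) (w : V -> V -> int) (pi : nat -> V) (n : nat) : int :=
  \sum_(i < n) w (pi i) (pi i.+1).

Definition Energy_L (V : Type) (w : V -> V -> int) (pi : nat -> V) : Prop :=
  forall n, 0 <= EL w pi n.

Definition avg_EL (V : Type) (w : V -> V -> int) (pi : nat -> V) (n : nat) : Rdefinitions.R :=
  ((\sum_(i < n) EL w pi i)%:~R) / (n%:R).

Definition AE (V : Type) (w : V -> V -> int) (t : nat) (pi : nat -> V) : Prop :=
  (limn_esup (fun n => (avg_EL w pi n)%:E) <= (t%:R : Rdefinitions.R)%:E)%E.

Definition AvgEnergy_L (V : Type) (w : V -> V -> int) (t : nat)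
    (pi : nat -> V) : Prop :=
  Energy_L w pi /\ AE w t pi.

(* vertices are 0 .. nV-1; owner1 lists which vertices belong to Player 1;
   edges is the list of weighted edges (u, v, w(u,v)); init = v_I *)
Record instance := Instance {
  nV : nat;
  owner1 : seq bool;
  edges : seq (nat * nat * int);
  init : nat }.

Definition wf_instance (I : instance) : Prop :=
  [/\ size (owner1 I) = nV I,
      init I < nV I,
      all (fun e : nat * nat * int => (e.1.1 < nV I) && (e.1.2 < nV I)) (edges I),
      uniq [seq e.1 | e <- edges I]
    & forall u, u < nV I -> has (fun e : nat * nat * int => e.1.1 == u) (edges I)]%N.

Definition arena_of (I : instance) : arena nat :=
  Arena (fun v => (v < nV I)%N)
        (fun u v => has (fun e : nat * nat * int => (e.1.1 == u) && (e.1.2 == v))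
                        (edges I))
        (fun v => nth false (owner1 I) v)
        (init I).

Definition weight_of (I : instance) (u v : nat) : int :=
  head 0 [seq e.2 | e <- edges I & (e.1.1 == u) && (e.1.2 == v)].

Definition yes_instance (I : instance) : Prop :=
  wf_instance I /\
  exists t : nat, player0_wins (arena_of I) (AvgEnergy_L (weight_of I) t).

Definition nat_bits (m : nat) : seq bool :=
  if m == 0%N then [::] else [seq odd (m %/ 2 ^ i) | i <- iota 0 (trunc_log 2 m).+1].

(* self-delimiting binary code: each bit doubled, then the marker 0 1 *)
Definition enc_nat (m : nat) : seq bool :=
  flatten [seq [:: b; b] | b <- nat_bits m] ++ [:: false; true].

Definition enc_int (z : int) : seq bool :=
  match z with
  | Posz m => true :: enc_nat m
  | Negz m => false :: enc_nat m   (* Negz m = - (m + 1) *)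
  end.

Definition enc_edge (e : nat * nat * int) : seq bool :=
  enc_nat e.1.1 ++ enc_nat e.1.2 ++ enc_int e.2.

Definition encode (I : instance) : seq bool :=
  enc_nat (nV I) ++ owner1 I ++ enc_nat (size (edges I)) ++
  flatten [seq enc_edge e | e <- edges I] ++ enc_nat (init I).

Definition AvgEnergy_threshold_problem (x : seq bool) : Prop :=
  exists I, encode I = x /\ yes_instance I.

(* states 'I_(nq.+1) (initial state 0), tape symbols 'I_(ns.+3) with
   0 = blank, 1 = bit false, 2 = bit true.  delta = None means halt;
   the move flag is true for right, false for left. *)
Record TM := MkTM {
  tm_nq : nat;
  tm_ns : nat;
  tm_delta : 'I_tm_nq.+1 -> 'I_tm_ns.+3 ->
             option ('I_tm_nq.+1 * 'I_tm_ns.+3 * bool);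
  tm_acc : 'I_tm_nq.+1 -> bool }.

Section TMsem.
Variable M : TM.
Local Notation Q := 'I_(tm_nq M).+1.
Local Notation S := 'I_(tm_ns M).+3.

(* configuration: state, left part (nearest cell first), scanned symbol,
   right part (nearest cell first); all other cells are blank *)
Definition config : Type := (Q * seq S * S * seq S)%type.

Definition blank : S := ord0.
Definition sym_of_bit (b : bool) : S := inord (1 + b).

Definition init_config (x : seq bool) : config :=
  let t := [seq sym_of_bit b | b <- x] in
  (ord0, [::], head blank t, behead t).

Definition step (c : config) : option config :=
  let: (q, l, s, r) := c in
  match tm_delta q s with
  | None => None
  | Some (q', s', true) => Some (q', s' :: l, head blank r, behead r)
  | Some (q', s', false) => Some (q', behead l, head blank l, s' :: r)
  end.

Definition halted (c : config) : bool := step c == None.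

Fixpoint exec (k : nat) (c : config) : config :=
  match k with
  | 0 => c
  | k'.+1 => match step c with None => c | Some c' => exec k' c' end
  end.

End TMsem.

Definition decides_in_time (M : TM) (L : seq bool -> Prop) (T : nat -> nat)
    : Prop :=
  forall x : seq bool, exists k : nat,
    (k <= T (size x))%N /\
    let c := @exec M k (@init_config M x) in
    @halted M c /\ (@tm_acc M c.1.1.1 = true <-> L x).

Definition in_2EXPTIME (L : seq bool -> Prop) : Prop :=
  exists (M : TM) (c k : nat),
    decides_in_time M L (fun n => 2 ^ (2 ^ (c * n ^ k + c)))%N.

(* Submission.v *)
From HB Require Import structures.
From mathcomp Require Import all_boot all_order all_algebra.
From mathcomp Require Import all_classical all_reals.
From mathcomp Require Import ereal topology normedtype sequences.
From mathcomp Require Import Rstruct zify lra.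
Require Import Defs.

Set Implicit Arguments.
Unset Strict Implicit.
Unset Printing Implicit Defensive.

Import Order.TTheory GRing.Theory Num.Theory.

(** Player 0 wins for some threshold iff some bounded set of configurations
(vertex, energy) contains (v_I, 0) and is closed for her.  Indeed, along a play
with average energy at most t the energy drops to t or below infinitely often; by
König's lemma the energy is bounded between two such visits, so replaying one
fixed history per configuration with energy at most t stays in a bounded set.
If all weights have absolute value at most W and two windows of 2W consecutive
energy levels of a closed set carry the same vertices, the levels between them can
be cut out, so doubly exponentially many levels suffice.  The safety game on these
levels is solved as a greatest fixed point stored on the tape, by a machine with
registers that point into the tape.  Local closedness and acceptance, including
the parsing of the input, are arithmetic formulas whose quantifiers are bounded by
S = 2^(2^(4(n+1))) for inputs of length n, and such formulas are evaluated in time polynomial in S. *)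

(** * Numbering states and symbols of an automaton with finite types *)

(** Under a winning strategy the energy peaks need not have a common bound over all plays; there is
    only a bound for each history, on its extensions up to the next low visit. Fixing one history
    for each of the finitely many low configurations turns these bounds into a single one. It still
    depends on [t] and on the strategy; cutting levels makes it depend on the number of vertices and
    the largest weight alone, so the threshold disappears from the decision procedure. Conversely, a
    region bounded by C keeps all levels, hence their averages, at most C. With at most n vertices
    and weights of absolute value at most W = 2^n, at most 2^(n * 2W) + 2W + 1 levels remain. The
    number S is large enough for the resulting configurations, for the positions and numbers in the
    input, and for a set of pairs of positions coded by one number, which is how a formula speaks of
    the list of edges. Everything is thus measured by S alone, and the machine can afford to count
    in unary: arithmetic on numbers below S costs time polynomial in S. *)

Definition upd (T : Type) (f : nat -> T) (i : nat) (v : T) : nat -> T :=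
  fun j => if j == i then v else f j.

Lemma updE T (f : nat -> T) i v : upd f i v i = v.
Proof. by rewrite /upd eqxx. Qed.

Lemma updN T (f : nat -> T) i v j : j != i -> upd f i v j = f j.
Proof. by rewrite /upd => /negbTE ->. Qed.

Lemma upd_id T (f : nat -> T) i : upd f i (f i) = f.
Proof. by apply: funext => j; rewrite /upd; case: eqP => [->|]. Qed.

Section Coding.
Variables (Q S : finType) (bl : S) (bit : bool -> S).
Variables (delta : option Q -> S -> option (Q * S * bool)) (acc : Q -> bool).

(* Only the initial state and the three input symbols have prescribed numbers:
   they get fresh codes, and the automaton never writes them again. *)
Definition dec_sym (s : 'I_(#|S|.+3)) : S :=
  nth bl [:: bl, bit false, bit true & enum S] s.
Definition enc_sym (s : S) : 'I_(#|S|.+3) := inord (3 + index s (enum S)).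
Definition dec_state (q : 'I_(#|Q|.+1)) : option Q :=
  nth None (None :: [seq Some q | q <- enum Q]) q.
Definition enc_state (q : Q) : 'I_(#|Q|.+1) := inord (1 + index q (enum Q)).

Lemma enc_symK s : dec_sym (enc_sym s) = s.
Proof.
have lt_s: index s (enum S) < #|S| by rewrite cardE index_mem mem_enum.
by rewrite /dec_sym /enc_sym inordK ?ltnS //= nth_index // mem_enum.
Qed.

Lemma enc_stateK q : dec_state (enc_state q) = Some q.
Proof.
have lt_q: index q (enum Q) < #|Q| by rewrite cardE index_mem mem_enum.
rewrite /dec_state /enc_state inordK //= (nth_map q) ?nth_index ?mem_enum //.
by rewrite -cardE.
Qed.

Definition coded_TM : TM :=
  @MkTM #|Q| #|S|
    (fun q s => if delta (dec_state q) (dec_sym s) is Some (q', s', d)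
                then Some (enc_state q', enc_sym s', d) else None)
    (fun q => if dec_state q is Some q' then acc q' else false).

(* [h] is the head position in a tape [T] extending only to the right. *)
Definition represents (c : config coded_TM) (q : option Q) (h : nat) (T : nat -> S) :=
  let: (q0, l, s, r) := c in
  [/\ dec_state q0 = q, forall j, j < h -> dec_sym (nth (blank coded_TM) l (h.-1 - j)) = T j,
      dec_sym s = T h & forall j, dec_sym (nth (blank coded_TM) r j) = T (h + j).+1].

(** Runs on a one-way tape: no constructor moves left from cell 0. *)
Inductive reach : nat -> option Q -> nat -> (nat -> S) ->
    option Q -> nat -> (nat -> S) -> Prop :=
| reach0 q h T : reach 0 q h T q h T
| reachR n q h T q1 s q2 h2 T2 : delta q (T h) = Some (q1, s, true) ->
    reach n (Some q1) h.+1 (upd T h s) q2 h2 T2 -> reach n.+1 q h T q2 h2 T2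
| reachL n q h T q1 s q2 h2 T2 : delta q (T h.+1) = Some (q1, s, false) ->
    reach n (Some q1) h (upd T h.+1 s) q2 h2 T2 -> reach n.+1 q h.+1 T q2 h2 T2.

Lemma reach_trans n1 n2 q h T q1 h1 T1 q2 h2 T2 :
  reach n1 q h T q1 h1 T1 -> reach n2 q1 h1 T1 q2 h2 T2 ->
  reach (n1 + n2) q h T q2 h2 T2.
Proof.
elim=> {n1 q h T q1 h1 T1} [//|n q h T q1 s q3 h3 T3 E _ IH|n q h T q1 s q3 h3 T3 E _ IH] /IH R.
  exact: reachR R.
exact: reachL R.
Qed.

Lemma exec_reach n q h T q' h' T' c :
  represents c q h T -> reach n q h T q' h' T' -> represents (exec n c) q' h' T'.
Proof.
move=> rep R; elim: R c rep => {n q h T q' h' T'} [//|n q h T q1 s q2 h2 T2 E _ IH|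
  n q h T q1 s q2 h2 T2 E _ IH] [[[q0 l] s0] r] [Eq El Es Er] /=.
- rewrite Eq Es E; apply: IH; split.
  + exact: enc_stateK.
  + move=> j; rewrite ltnS leq_eqVlt => /orP[/eqP->|lt_j] /=.
      by rewrite subnn /= enc_symK updE.
    rewrite updN ?ltn_eqF // -(El _ lt_j).
    by have -> : h - j = (h.-1 - j).+1 by lia.
  + rewrite updN ?gtn_eqF //; have := Er 0; rewrite addn0 => <-.
    by case: r {Er}.
  + move=> j; rewrite updN ?gtn_eqF //; last by lia.
    have := Er j.+1; rewrite addnS addSn => <-.
    by case: r {Er} => [|? ?] //=; rewrite ?nth_nil.
- rewrite Eq Es E; apply: IH; split.
  + exact: enc_stateK.
  + move=> j lt_j; rewrite updN ?ltn_eqF ?ltnS 1?ltnW // -El; last by lia.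
    have -> : h.+1.-1 - j = (h.-1 - j).+1 by lia.
    by case: l {El} => [|? ?] //=; rewrite ?nth_nil.
  + rewrite updN ?ltn_eqF // -El //= subnn.
    by case: l {El}.
  + move=> [|j] /=; first by rewrite addn0 enc_symK updE.
    rewrite updN ?gtn_eqF //; last by lia.
    by rewrite addnS -Er.
Qed.

(** The head starts on cell 1, where the input begins; the blank cell 0 is reserved for the left
    marker. *)
Definition input_tape (x : seq bool) (h : nat) : S :=
  if h is p.+1 then if onth x p is Some b then bit b else bl else bl.

Lemma represents_init x : represents (init_config coded_TM x) None 1 (input_tape x).
Proof.
have bitK b : dec_sym (sym_of_bit coded_TM b) = bit b.
  by rewrite /dec_sym /sym_of_bit; case: b => /=; rewrite inordK.
have blK : dec_sym (blank coded_TM) = bl by [].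
split=> //.
- by move=> [|j] //= _.
- by case: x => [|b x] /=; rewrite ?blK ?bitK.
- move=> j; rewrite add1n /= nth_behead.
  elim: x j => [|b x IH] j /=; first by rewrite ?nth_nil.
  case: x IH => [|c x] IH; first by rewrite /= ?nth_nil; case: j.
  case: j => [|j]; first by rewrite /= bitK.
  exact: (IH j).
Qed.

Lemma halted_reach x n q h T : reach n None 1 (input_tape x) (Some q) h T ->
  delta (Some q) (T h) = None ->
  let c := exec n (init_config coded_TM x) in
  halted c /\ tm_acc c.1.1.1 = acc q.
Proof.
move=> R E /=; have := exec_reach (represents_init x) R.
case: (exec n _) => [[[q0 l] s] r] [Eq _ Es _].
by rewrite /halted /= Eq Es E.
Qed.

End Coding.

(** * Structured programs over pointers into the tape *)

Inductive test :=
  | TEq of nat & nat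
  | TX of nat & option bool
  | TZ of nat.

(** The primitives are what one sweep of the tape can do with the mark of a register: move it one
    cell right, bring it back to the start, or write at its place. All arithmetic is built from
    these by loops. *)
Inductive cmd :=
  | Zero of nat
  | Inc of nat
  | SetZ of nat & bool
  | Seq of cmd & cmd
  | If of test & cmd & cmd
  | Until of test & cmd.

Record st := St { reg : nat -> nat; mem : nat -> bool }.

Definition setr s i v := St (upd (reg s) i v) (mem s).
Definition setm s p b := St (reg s) (upd (mem s) p b).

Definition teval (x : seq bool) (t : test) (s : st) : bool :=
  match t with
  | TEq i j => reg s i == reg s j
  | TX i o => onth x (reg s i) == o
  | TZ i => mem s (reg s i)
  end.

Inductive run (x : seq bool) : cmd -> st -> nat -> st -> Prop :=
| RZero i s : run x (Zero i) s 1 (setr s i 0)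
| RInc i s : run x (Inc i) s 1 (setr s i (reg s i).+1)
| RSetZ i b s : run x (SetZ i b) s 1 (setm s (reg s i) b)
| RSeq c1 c2 s n1 s1 n2 s2 :
    run x c1 s n1 s1 -> run x c2 s1 n2 s2 -> run x (Seq c1 c2) s (n1 + n2) s2
| RIfT t c1 c2 s n s' : teval x t s -> run x c1 s n s' -> run x (If t c1 c2) s n.+1 s'
| RIfF t c1 c2 s n s' : ~~ teval x t s -> run x c2 s n s' -> run x (If t c1 c2) s n.+1 s'
| RUntilT t c s : teval x t s -> run x (Until t c) s 1 s
| RUntilF t c s n1 s1 n2 s2 : ~~ teval x t s ->
    run x c s n1 s1 -> run x (Until t c) s1 n2 s2 -> run x (Until t c) s (n1 + n2).+1 s2.

(** A unit of time raises a register by at most one, so the running time also bounds the length of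
    the sweeps in the simulation. *)
Lemma run_le x c s n s' : run x c s n s' -> forall i, reg s' i <= reg s i + n.
Proof.
elim=> {c s n s'} /=.
- by move=> i s j; rewrite /upd; case: ifP => // _; lia.
- by move=> i s j; rewrite /upd; case: eqP => [->|_]; lia.
- by move=> *; lia.
- by move=> c1 c2 s n1 s1 n2 s2 _ H1 _ H2 i; have := H1 i; have := H2 i; lia.
- by move=> t c1 c2 s n s' _ _ H i; have := H i; lia.
- by move=> t c1 c2 s n s' _ _ H i; have := H i; lia.
- by move=> *; lia.
- by move=> t c s n1 s1 n2 s2 _ _ H1 _ H2 i; have := H1 i; have := H2 i; lia.
Qed.

Inductive node :=
  | NInc of nat & nat
  | NZero of nat & nat
  | NSet of nat & bool & nat
  | NTest of test & nat & nat
  | NHalt of bool.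

Fixpoint csize (c : cmd) : nat :=
  match c with
  | Zero _ | Inc _ | SetZ _ _ => 1
  | Seq c1 c2 => csize c1 + csize c2
  | If _ c1 c2 => (csize c1 + csize c2).+1
  | Until _ c => (csize c).+1
  end.

(* Code placed at address [a] that leaves towards address [b]. *)
Fixpoint code (c : cmd) (a b : nat) : seq node :=
  match c with
  | Zero i => [:: NZero i b]
  | Inc i => [:: NInc i b]
  | SetZ i z => [:: NSet i z b]
  | Seq c1 c2 => code c1 a (a + csize c1) ++ code c2 (a + csize c1) b
  | If t c1 c2 => NTest t a.+1 (a.+1 + csize c1)
                  :: code c1 a.+1 b ++ code c2 (a.+1 + csize c1) b
  | Until t c => NTest t b a.+1 :: code c a.+1 a
  end.

Lemma size_code c a b : size (code c a b) = csize c.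
Proof. by elim: c a b => //= [c1 H1 c2 H2|t c1 H1 c2 H2|t c H] a b; rewrite ?size_cat ?H1 ?H2 ?H. Qed.

Definition test_reg t := match t with TEq i _ => i | TX i _ => i | TZ i => i end.
Definition test_ok K t :=
  match t with TEq i j => (i <= K) && (j <= K) | TX i _ => i <= K | TZ i => i <= K end.
Fixpoint regs_ok K c :=
  match c with
  | Zero i | Inc i | SetZ i _ => i <= K
  | Seq c1 c2 => regs_ok K c1 && regs_ok K c2
  | If t c1 c2 => [&& test_ok K t, regs_ok K c1 & regs_ok K c2]
  | Until t c => test_ok K t && regs_ok K c
  end.

Lemma regs_okS K K' c : K <= K' -> regs_ok K c -> regs_ok K' c.
Proof.
move=> le_K; have leK i : i <= K -> i <= K' by lia.
have tS t : test_ok K t -> test_ok K' t.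
  by case: t => [i j /andP[/leK ? /leK ?]|i o|i] /=; [apply/andP| |]; auto.
elim: c => /= [i /leK|i /leK|i b /leK|c1 H1 c2 H2 /andP[/H1-> /H2->]|t c1 H1 c2 H2 /and3P[/tS-> /H1-> /H2->]|
  t c H /andP[/tS-> /H->]] //.
Qed.

Lemma regs_ok_ex c : exists K, regs_ok K c.
Proof.
elim: c => [i|i|i b|c1 [K1 H1] c2 [K2 H2]|t c1 [K1 H1] c2 [K2 H2]|t c [K H]];
  try by exists i; rewrite /= leqnn.
- by exists (maxn K1 K2); rewrite /= (regs_okS (leq_maxl _ _) H1) (regs_okS (leq_maxr _ _) H2).
- pose tr := match t with TEq i j => maxn i j | TX i _ => i | TZ i => i end.
  exists (maxn tr (maxn K1 K2)); apply/and3P; split.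
  + by rewrite /tr; case: t {tr} => [i j|i o|i] /=; lia.
  + by apply: regs_okS H1; lia.
  + by apply: regs_okS H2; lia.
- pose tr := match t with TEq i j => maxn i j | TX i _ => i | TZ i => i end.
  exists (maxn tr K); apply/andP; split.
  + by rewrite /tr; case: t {tr} => [i j|i o|i] /=; lia.
  + by apply: regs_okS H; lia.
Qed.

(** * Simulation of programs by a one-tape machine *)

Section Machine.
Variables (K : nat) (prog : seq node).

Definition marks := {ffun 'I_K.+1 -> bool}.
(* A cell holds an input symbol, a work bit and the set of registers whose
   value is its position; [None] is the marker to the left of cell 0. *)
Definition sym := option (option bool * bool * marks)%type.
Definition label := 'I_(size prog).+1.
(* [None]: about to write the left marker.  Phases: 0 search the register to
   the right, 1 put its mark, 2 rewind and put the mark at cell 0, 3 rewind. *)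
Definition state := option (label * 'I_4)%type.

Definition node_reg n :=
  match n with NInc i _ | NZero i _ | NSet i _ _ => i | NTest t _ _ => test_reg t
  | NHalt _ => 0 end.
Definition node_next n :=
  match n with NInc _ l | NZero _ l | NSet _ _ l => l | NTest _ l _ => l
  | NHalt _ => 0 end.
Definition cell_test (t : test) (c : option bool * bool * marks) : bool :=
  match t with TEq i j => c.2 (inord j) | TX i o => c.1.1 == o | TZ i => c.1.2 end.
Definition lab (l : nat) (p : nat) : state := Some (inord l, inord p).
Definition set_mark (m : marks) i b : marks := [ffun j => if j == inord i then b else m j].

(** The first two steps set up the tape: all registers are 0 at the start, so all marks go to the
    first input cell, and the marker is written to its left. *)
Definition delta (q : option state) (s : sym) : option (state * sym * bool) :=
  match q with
  | None => if s is Some (a, z, _) then Some (None, Some (a, z, [ffun=> true]), false) else None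
  | Some None => Some (lab 0 0, None, true)
  | Some (Some (l, p)) =>
    let n := nth (NHalt false) prog l in
    let i := node_reg n in
    match val p, s with
    | 0, Some (a, z, m) =>
      if n is NHalt _ then None else
      if ~~ m (inord i) then Some (Some (l, p), s, true) else
      match n with
      | NInc _ _ => Some (lab l 1, Some (a, z, set_mark m i false), true)
      | NZero _ _ => Some (lab l 2, Some (a, z, set_mark m i false), false)
      | NSet _ b l' => Some (lab l' 3, Some (a, b, m), false)
      | NTest t l1 l2 => Some (lab (if cell_test t (a, z, m) then l1 else l2) 3, s, false)
      | NHalt _ => None
      end
    | 1, Some (a, z, m) => Some (lab (node_next n) 3, Some (a, z, set_mark m i true), false)
    | 2, None => Some (lab l 1, None, true)
    | 2, Some _ => Some (lab l 2, s, false)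
    | 3, None => Some (lab l 0, None, true)
    | 3, Some _ => Some (lab l 3, s, false)
    | _, _ => None
    end
  end.

Variable x : seq bool.

(** The marks are a parameter because a register has no mark between the removal of the old one and
    the writing of the new one. *)
Definition tape_mid (s : st) (m : nat -> marks) (h : nat) : sym :=
  if h is p.+1 then Some (onth x p, mem s p, m p) else None.
Definition tape (s : st) : nat -> sym :=
  tape_mid s (fun p => [ffun i : 'I_K.+1 => reg s i == p]).

Local Notation reach := (reach delta).

Lemma rewind l s m h : l <= size prog ->
  reach h.+1 (Some (lab l 3)) h (tape_mid s m) (Some (lab l 0)) 1 (tape_mid s m).
Proof.
move=> le_l; elim: h => [|h IH].
  apply: (@reachR _ _ _ 0 _ 0 _ (lab l 0) None); last by rewrite -[None]/(tape_mid s m 0) upd_id; exact: reach0.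
  by rewrite /= !inordK.
apply: (@reachL _ _ _ h.+1 _ h _ (lab l 3) (tape_mid s m h.+1)); last by rewrite upd_id.
by rewrite /= !inordK.
Qed.

Lemma rewind2 l s m h : l <= size prog ->
  reach h.+1 (Some (lab l 2)) h (tape_mid s m) (Some (lab l 1)) 1 (tape_mid s m).
Proof.
move=> le_l; elim: h => [|h IH].
  apply: (@reachR _ _ _ 0 _ 0 _ (lab l 1) None); last by rewrite -[None]/(tape_mid s m 0) upd_id; exact: reach0.
  by rewrite /= !inordK.
apply: (@reachL _ _ _ h.+1 _ h _ (lab l 2) (tape_mid s m h.+1)); last by rewrite upd_id.
by rewrite /= !inordK.
Qed.

Lemma scan l s : l <= size prog -> (forall b, nth (NHalt false) prog l <> NHalt b) ->
  let i := node_reg (nth (NHalt false) prog l) in i <= K ->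
  reach (reg s i) (Some (lab l 0)) 1 (tape s) (Some (lab l 0)) (reg s i).+1 (tape s).
Proof.
move=> le_l nh i le_i.
suff H k h : h + k = reg s i -> reach k (Some (lab l 0)) h.+1 (tape s) (Some (lab l 0)) (reg s i).+1 (tape s).
  exact: (H _ 0).
elim: k h => [|k IH] h E; first by rewrite -E addn0; exact: reach0.
apply: (@reachR _ _ _ k _ h.+1 _ (lab l 0) (tape s h.+1)); last by rewrite upd_id; apply: IH; lia.
rewrite /= !inordK //= -/i ffunE inordK //.
have -> : (reg s i == h) = false by lia.
by move: nh; case: (nth _ _ _) => // b /(_ b).
Qed.

Lemma step_inc l s i l' : l <= size prog -> l' <= size prog -> i <= K ->
  nth (NHalt false) prog l = NInc i l' ->
  exists2 n, n <= 2 * reg s i + 4 &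
    reach n (Some (lab l 0)) 1 (tape s) (Some (lab l' 0)) 1 (tape (setr s i (reg s i).+1)).
Proof.
move=> le_l le_l' le_i E.
have := @scan l s le_l; rewrite E /= => /(_ (fun=> ltac:(done)) le_i) R.
(* Search, removal of the mark, new mark one cell further, rewind. *)
exists (reg s i + (1 + (1 + (reg s i).+2))); first by lia.
apply: reach_trans R _.
apply: (@reachR _ _ _ _ _ (reg s i).+1 _ (lab l 1)
   (Some (onth x (reg s i), mem s (reg s i), set_mark [ffun j : 'I_K.+1 => reg s j == reg s i] i false))).
  by rewrite /= !inordK //= E /= ffunE inordK // eqxx.
set T := upd _ _ _.
apply: (@reachL _ _ _ _ _ (reg s i).+1 _ (lab l' 3)
   (Some (onth x (reg s i).+1, mem s (reg s i).+1, set_mark [ffun j : 'I_K.+1 => reg s j == (reg s i).+1] i true))).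
  by rewrite /T updN ?gtn_eqF //= !inordK //= E.
rewrite (_ : upd T (reg s i).+2 _ = tape (setr s i (reg s i).+1)); first exact: rewind.
apply: funext => -[|h]; first by [].
have ord_eq (j : 'I_K.+1) : (j == inord i) = (val j == i) by rewrite -val_eqE /= inordK.
rewrite /T {1 2}/upd; case: (eqVneq h.+1 _) => [[->]|ne].
  by congr Some; congr pair; apply/ffunP=> j; rewrite !ffunE ord_eq /setr /upd /=; case: (val j =P i) => // _; rewrite eqxx.
case: (eqVneq h.+1 _) => [[->]|ne'].
  congr Some; congr pair; apply/ffunP=> j; rewrite !ffunE ord_eq /setr /upd /=; case: (val j =P i) => // _.
  by rewrite gtn_eqF.
congr Some; congr pair; apply/ffunP=> j; rewrite !ffunE /setr /upd /=; case: (val j =P i) => // ->.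
by move: ne ne'; rewrite !eqSS ![h == _]eq_sym => /negbTE-> /negbTE->.
Qed.

Lemma step_zero l s i l' : l <= size prog -> l' <= size prog -> i <= K ->
  nth (NHalt false) prog l = NZero i l' ->
  exists2 n, n <= 2 * reg s i + 4 &
    reach n (Some (lab l 0)) 1 (tape s) (Some (lab l' 0)) 1 (tape (setr s i 0)).
Proof.
move=> le_l le_l' le_i E.
have := @scan l s le_l; rewrite E /= => /(_ (fun=> ltac:(done)) le_i) R.
(* Search, removal of the mark, rewind over the marker to the first cell, new mark there, and a last
   rewind from the marker. *)
exists (reg s i + (1 + ((reg s i).+1 + (1 + 1)))); first by lia.
apply: reach_trans R _.
apply: (@reachL _ _ _ _ _ (reg s i) _ (lab l 2)
   (Some (onth x (reg s i), mem s (reg s i), set_mark [ffun j : 'I_K.+1 => reg s j == reg s i] i false))).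
  by rewrite /= !inordK //= E /= ffunE inordK // eqxx.
have ord_eq (j : 'I_K.+1) : (j == inord i) = (val j == i) by rewrite -val_eqE /= inordK.
pose m p : marks := [ffun j : 'I_K.+1 => (val j != i) && (reg s j == p)].
have -> : upd (tape s) (reg s i).+1 (Some (onth x (reg s i), mem s (reg s i),
    set_mark [ffun j : 'I_K.+1 => reg s j == reg s i] i false)) = tape_mid s m.
  apply: funext => -[|h]; first by [].
  rewrite /upd; case: (eqVneq h.+1 _) => [[->]|ne].
    by congr Some; congr pair; apply/ffunP=> j; rewrite !ffunE ord_eq; case: (val j =P i).
  congr Some; congr pair; apply/ffunP=> j; rewrite !ffunE; case: (val j =P i) => //= ->.
  by move: ne; rewrite eqSS eq_sym => /negbTE.
apply: reach_trans (rewind2 s m (reg s i) le_l) _.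
apply: (@reachL _ _ _ _ _ 0 _ (lab l' 3) (Some (onth x 0, mem s 0, set_mark (m 0) i true))).
  by rewrite /= !inordK //= E.
rewrite (_ : upd (tape_mid s m) 1 _ = tape (setr s i 0)); first exact: rewind.
apply: funext => -[|h]; first by [].
rewrite {1}/upd; case: (eqVneq h.+1 _) => [[->]|ne].
  by congr Some; congr pair; apply/ffunP=> j; rewrite !ffunE ord_eq /setr /upd /=; case: (val j =P i) => //= _.
congr Some; congr pair; apply/ffunP=> j; rewrite !ffunE /setr /upd /=; case: (val j =P i) => //= _.
by case: h ne.
Qed.

Lemma step_set l s i b l' : l <= size prog -> l' <= size prog -> i <= K ->
  nth (NHalt false) prog l = NSet i b l' ->
  exists2 n, n <= 2 * reg s i + 4 &
    reach n (Some (lab l 0)) 1 (tape s) (Some (lab l' 0)) 1 (tape (setm s (reg s i) b)).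
Proof.
move=> le_l le_l' le_i E.
have := @scan l s le_l; rewrite E /= => /(_ (fun=> ltac:(done)) le_i) R.
exists (reg s i + (1 + (reg s i).+1)); first by lia.
apply: reach_trans R _.
apply: (@reachL _ _ _ _ _ (reg s i) _ (lab l' 3)
   (Some (onth x (reg s i), b, [ffun j : 'I_K.+1 => reg s j == reg s i]))).
  by rewrite /= !inordK //= E /= ffunE inordK // eqxx.
rewrite (_ : upd (tape s) (reg s i).+1 _ = tape (setm s (reg s i) b)); first exact: rewind.
apply: funext => -[|h]; first by [].
by rewrite /tape /= /upd eqSS; case: eqP => [->|].
Qed.

Lemma step_test l s t l1 l2 : l <= size prog -> l1 <= size prog -> l2 <= size prog -> test_ok K t ->
  nth (NHalt false) prog l = NTest t l1 l2 ->
  exists2 n, n <= 2 * reg s (test_reg t) + 4 &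
    reach n (Some (lab l 0)) 1 (tape s) (Some (lab (if teval x t s then l1 else l2) 0)) 1 (tape s).
Proof.
move=> le_l le_l1 le_l2 ok_t E.
have le_i : test_reg t <= K by case: t ok_t {E} => //= i j /andP[].
have := @scan l s le_l; rewrite E /= => /(_ (fun=> ltac:(done)) le_i) R.
set i := test_reg t in le_i R *.
exists (reg s i + (1 + (reg s i).+1)); first by lia.
apply: reach_trans R _.
apply: (@reachL _ _ _ _ _ (reg s i) _ (lab (if teval x t s then l1 else l2) 3)
   (tape s (reg s i).+1)); last by rewrite upd_id; apply: rewind; case: ifP.
rewrite /= !inordK //= E /= -/i ffunE inordK // eqxx /=.
suff -> : cell_test t (onth x (reg s i), mem s (reg s i), [ffun j : 'I_K.+1 => reg s j == reg s i]) = teval x t s by [].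
rewrite /i; case: t ok_t {E le_i i} => //= i j /andP[_ le_j].
by rewrite ffunE inordK // eq_sym.
Qed.

Definition at_addr (a : nat) (c : seq node) := exists u v, prog = u ++ c ++ v /\ size u = a.

Lemma at_addr_cat a c1 c2 : at_addr a (c1 ++ c2) -> at_addr a c1 /\ at_addr (a + size c1) c2.
Proof.
case=> u [v [E1 E2]]; split; first by exists u, (c2 ++ v); rewrite E1 -!catA.
by exists (u ++ c1), v; split; [rewrite E1 !catA | rewrite size_cat E2].
Qed.

Lemma at_addr_nth a n c : at_addr a (n :: c) ->
  [/\ nth (NHalt false) prog a = n, a <= size prog & at_addr a.+1 c].
Proof.
case=> u [v [E1 E2]]; split; first by rewrite E1 nth_cat E2 ltnn subnn.
  by rewrite E1 size_cat E2; lia.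
by exists (rcons u n), v; split; rewrite ?size_rcons ?E2 // cat_rcons.
Qed.

(** The last hypothesis keeps all registers at most [M] throughout the run, so each unit of program
    time costs at most one sweep to a mark and back. *)
Lemma sim_run M c s n s' a b : run x c s n s' -> regs_ok K c -> at_addr a (code c a b) ->
  b <= size prog -> (forall i, reg s i + n <= M) ->
  exists2 k, k <= n * (2 * M + 4) &
    reach k (Some (lab a 0)) 1 (tape s) (Some (lab b 0)) 1 (tape s').
Proof.
move=> R; elim: R a b => {c s n s'}.
- move=> i s a b /= ok /at_addr_nth[E le_a _] le_b HM.
  have [k le_k Rk] := step_zero s le_a le_b ok E.
  by exists k => //; have := HM i; lia.
- move=> i s a b /= ok /at_addr_nth[E le_a _] le_b HM.
  have [k le_k Rk] := step_inc s le_a le_b ok E.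
  by exists k => //; have := HM i; lia.
- move=> i z s a b /= ok /at_addr_nth[E le_a _] le_b HM.
  have [k le_k Rk] := step_set s le_a le_b ok E.
  by exists k => //; have := HM i; lia.
- move=> c1 c2 s n1 s1 n2 s2 R1 H1 R2 H2 a b /= /andP[ok1 ok2] /at_addr_cat[A1].
  rewrite size_code => A2 le_b HM.
  have le_m : a + csize c1 <= size prog.
    by case: A2 => u [v [-> <-]]; rewrite size_cat; lia.
  have [i|k1 le1 Rk1] := H1 _ _ ok1 A1 le_m; first by have := HM i; lia.
  have [i|k2 le2 Rk2] := H2 _ _ ok2 A2 le_b; first by have := HM i; have := run_le R1 i; lia.
  by exists (k1 + k2); [rewrite mulnDl leq_add | exact: reach_trans Rk1 Rk2].
- move=> t c1 c2 s n s' Ht R1 H1 a b /= /and3P[okt ok1 ok2] /at_addr_nth[E le_a].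
  case/at_addr_cat; rewrite size_code => A1 A2 le_b HM.
  have le_a1 : a.+1 <= size prog by case: A1 => u [v [-> <-]]; rewrite size_cat; lia.
  have le_a2 : a.+1 + csize c1 <= size prog by case: A2 => u [v [-> <-]]; rewrite size_cat; lia.
  have [k1 le1] := step_test s le_a le_a1 le_a2 okt E; rewrite Ht => Rk1.
  have [i|k2 le2 Rk2] := H1 _ _ ok1 A1 le_b; first by have := HM i; lia.
  exists (k1 + k2); last exact: reach_trans Rk1 Rk2.
  by have := HM (test_reg t); lia.
- move=> t c1 c2 s n s' Ht R1 H1 a b /= /and3P[okt ok1 ok2] /at_addr_nth[E le_a].
  case/at_addr_cat; rewrite size_code => A1 A2 le_b HM.
  have le_a1 : a.+1 <= size prog by case: A1 => u [v [-> <-]]; rewrite size_cat; lia.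
  have le_a2 : a.+1 + csize c1 <= size prog by case: A2 => u [v [-> <-]]; rewrite size_cat; lia.
  have [k1 le1] := step_test s le_a le_a1 le_a2 okt E; rewrite (negbTE Ht) => Rk1.
  have [i|k2 le2 Rk2] := H1 _ _ ok2 A2 le_b; first by have := HM i; lia.
  exists (k1 + k2); last exact: reach_trans Rk1 Rk2.
  by have := HM (test_reg t); lia.
- move=> t c s Ht a b /= /andP[okt okc] /at_addr_nth[E le_a A] le_b HM.
  have le_a1 : a.+1 <= size prog by case: A => u [v [-> <-]]; rewrite size_cat; lia.
  have [k1 le1] := step_test s le_a le_b le_a1 okt E; rewrite Ht => Rk1.
  by exists k1 => //; have := HM (test_reg t); lia.
- move=> t c s n1 s1 n2 s2 Ht R1 H1 R2 H2 a b /= ok At le_b HM.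
  have /andP[okt okc] := ok; have [E le_a A] := at_addr_nth At.
  have le_a1 : a.+1 <= size prog by case: A => u [v [-> <-]]; rewrite size_cat; lia.
  have [k1 le1] := step_test s le_a le_b le_a1 okt E; rewrite (negbTE Ht) => Rk1.
  have [i|k2 le2 Rk2] := H1 _ _ okc A le_a; first by have := HM i; lia.
  have [i|k3 le3 Rk3] := H2 _ _ ok At le_b; first by have := HM i; have := run_le R1 i; lia.
  exists (k1 + (k2 + k3)); last exact: reach_trans Rk1 (reach_trans Rk2 Rk3).
  by have := HM (test_reg t); lia.
Qed.

End Machine.

(** A program leaves its answer in registers; a final comparison of two of them transfers it to the
    halting state. The additive 2 pays for setting up the tape. *)
Lemma TM_of_cmd (c : cmd) (i j : nat) : exists M : TM, forall (x : seq bool) n s',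
  run x c (St (fun=> 0) (fun=> false)) n s' ->
  exists k, k <= n.+1 * (2 * n + 4) + 2 /\
    let C := exec k (init_config M x) in halted C /\ tm_acc C.1.1.1 = (reg s' i == reg s' j).
Proof.
have [K /andP[okt okc]] : exists K, test_ok K (TEq i j) && regs_ok K c.
  (* The loop only serves to collect the registers of [c] and of the final test under one bound. *)
  have [K ok] := regs_ok_ex (Until (TEq i j) c); by exists K.
pose sz := csize c.
pose prog := code c 0 sz ++ [:: NTest (TEq i j) sz.+1 sz.+2; NHalt true; NHalt false].
have size_prog : size prog = sz + 3 by rewrite size_cat size_code.
pose acc (q : state prog) :=
  if q is Some (l, _) then if nth (NHalt false) prog l is NHalt b then b else false else false.
pose bl : sym K := Some (None, false, [ffun=> false]).
pose bit b : sym K := Some (Some b, false, [ffun=> false]).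
exists (@coded_TM (state prog) (sym K) bl bit (@delta K prog) acc) => x n s' R.
set s : st := (St (fun=> 0) (fun=> false)) in R.
have R0 : reach (@delta K prog) 2 None 1 (input_tape bl bit x) (Some (lab prog 0 0)) 1 (tape K x s).
  apply: (@reachL _ _ _ _ _ 0 _ None (Some (onth x 0, false, [ffun=> true]))).
    by rewrite /=; case: (x) => [|b0 x0].
  apply: (@reachR _ _ _ _ _ 0 _ (lab prog 0 0) None) => //.
  rewrite (_ : upd _ 0 None = tape K x s); first exact: reach0.
  have cellE p : Some (onth x p, false, [ffun=> p == 0]) = tape K x s p.+1.
    apply: (congr1 (fun m : marks K => Some (onth x p, false, m))).
    by apply/ffunP => ?; rewrite !ffunE eq_sym.
  apply: funext => -[|[|h]]; [by []|by rewrite -cellE|rewrite -cellE].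
  transitivity (if onth x h.+1 is Some b then bit b else bl); first by [].
  by case: (onth x h.+1).
have At : at_addr prog 0 (code c 0 sz) by exists [::], [:: NTest (TEq i j) sz.+1 sz.+2; NHalt true; NHalt false].
have le_sz : sz <= size prog by rewrite size_prog; lia.
have [k le_k Rk] := @sim_run K prog x n c s n s' 0 sz R okc At le_sz (fun=> leqnn n).
have At2 : at_addr prog sz [:: NTest (TEq i j) sz.+1 sz.+2; NHalt true; NHalt false].
  by exists (code c 0 sz), [::]; rewrite cats0 size_code.
have [E1 _ At3] := at_addr_nth At2; have [E2 _ At4] := at_addr_nth At3; have [E3 _ _] := at_addr_nth At4.
have [||k2 le_k2 Rk2] := step_test x s' le_sz _ _ okt E1; [by lia|by lia|].
exists (2 + (k + k2)); split.
  by have := run_le R i; rewrite /= add0n /= in le_k2 *; lia.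
have := halted_reach acc (reach_trans R0 (reach_trans Rk Rk2)).
rewrite [teval _ _ _]/= => H; case: H; last move=> H1 H2.
  by case: ifP => _; rewrite /lab /= !inordK ?size_prog ?E2 ?E3 //=; lia.
split; first exact: H1.
by rewrite H2; case: ifP => _; rewrite /acc /lab /= inordK ?size_prog ?E2 ?E3 //; lia.
Qed.

(** * Compiling bounded arithmetic formulas *)

Section Triples.
Variable x : seq bool.

(** A Hoare triple for total correctness with a time bound, at a fixed start state. *)
Definition ht (B : nat) (c : cmd) (s : st) (P : st -> Prop) :=
  exists n s', [/\ run x c s n s', n <= B & P s'].

Lemma ht_weaken B B' c s (P P' : st -> Prop) :
  ht B c s P -> B <= B' -> (forall s', P s' -> P' s') -> ht B' c s P'.
Proof. by case=> n [s' [R le HP]] leB H; exists n, s'; split; [|lia|apply: H]. Qed.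

Lemma ht_zero B s i (P : st -> Prop) : P (setr s i 0) -> 0 < B -> ht B (Zero i) s P.
Proof. by move=> H HB; exists 1, (setr s i 0); split=> //; apply: RZero. Qed.

Lemma ht_inc B s i (P : st -> Prop) : P (setr s i (reg s i).+1) -> 0 < B -> ht B (Inc i) s P.
Proof. by move=> H HB; exists 1, (setr s i (reg s i).+1); split=> //; apply: RInc. Qed.

Lemma ht_setz B s i b (P : st -> Prop) : P (setm s (reg s i) b) -> 0 < B -> ht B (SetZ i b) s P.
Proof. by move=> H HB; exists 1, (setm s (reg s i) b); split=> //; apply: RSetZ. Qed.

Lemma ht_seq B1 B2 B c1 c2 s (P Q : st -> Prop) :
  ht B1 c1 s Q -> (forall s', Q s' -> ht B2 c2 s' P) -> B1 + B2 <= B -> ht B (Seq c1 c2) s P.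
Proof.
move=> [n1 [s1 [R1 le1 Q1]]] /(_ _ Q1) [n2 [s2 [R2 le2 P2]]] leB.
by exists (n1 + n2), s2; split=> //; [apply: RSeq R1 R2 | lia].
Qed.

Lemma ht_if B t c1 c2 s (P : st -> Prop) :
  (teval x t s -> ht B c1 s P) -> (~~ teval x t s -> ht B c2 s P) -> ht B.+1 (If t c1 c2) s P.
Proof.
case E: (teval x t s) => H1 H2.
  by have [n [s' [R le HP]]] := H1 isT; exists n.+1, s'; split=> //; apply: RIfT.
by have [n [s' [R le HP]]] := H2 isT; exists n.+1, s'; split=> //; apply: RIfF => //; rewrite E.
Qed.

Lemma ht_until (Inv : nat -> st -> Prop) N B t c s (P : st -> Prop) :
  Inv 0 s ->
  (forall k s1, k < N -> Inv k s1 -> ~~ teval x t s1 /\ ht B c s1 (Inv k.+1)) ->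
  (forall s1, Inv N s1 -> teval x t s1 /\ P s1) ->
  ht (N * B.+1).+1 (Until t c) s P.
Proof.
move=> I0 Istep Iend.
suff H m k s1 : k + m = N -> Inv k s1 -> ht (m * B.+1).+1 (Until t c) s1 P by apply: (H N 0 s).
elim: m k s1 => [|m IH] k s1 E Ik.
  have [Ht HP] : teval x t s1 /\ P s1 by apply: Iend; rewrite -E addn0.
  by exists 1, s1; split=> //; apply: RUntilT.
have [|Ht [n1 [s2 [R1 le1 I1]]]] := Istep k s1 _ Ik; first by lia.
have [|n2 [s3 [R2 le2 HP]]] := IH k.+1 s2 _ I1; first by lia.
by exists (n1 + n2).+1, s3; split=> //; [apply: RUntilF R1 R2 | rewrite mulSn; lia].
Qed.

End Triples.

Lemma setrr s i a b : setr (setr s i a) i b = setr s i b.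
Proof. by congr St; apply: funext => j; rewrite /setr /upd /=; case: eqP. Qed.

Ltac regs := rewrite /= /upd; repeat match goal with |- context [if ?b then _ else _] => case: (boolP b) => ? end;
  try lia.

Definition Copy d i := Seq (Zero d) (Until (TEq d i) (Inc d)).

Lemma ht_copy x B d i s (P : st -> Prop) : d != i -> P (setr s d (reg s i)) ->
  2 * reg s i + 2 <= B -> ht x B (Copy d i) s P.
Proof.
move=> ne HP leB.
apply: (@ht_seq x 1 (reg s i * 2).+1 B _ _ _ _ (fun s' => s' = setr s d 0)); last by lia.
  exact: ht_zero.
move=> _ ->; apply: (@ht_until x (fun k s' => s' = setr s d k)) => //.
  move=> k _ lt_k ->; split; first by regs.
  by apply: ht_inc => //; rewrite setrr /= /upd eqxx.
by move=> _ ->; split=> //; regs.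
Qed.

Inductive term :=
  | TV of nat
  | T0
  | TS of term
  | TAdd of term & term
  | TMul of term & term.

(** Quantifiers bind by functions, which avoids substitution and lets one formula be instantiated
    with numbers or with register names. *)
Inductive form :=
  | FEq of term & term
  | FLt of term & term
  | FBit of term & term
  | FX of bool & term
  | FZ of term
  | FNot of form
  | FAnd of form & form
  | FEx of (nat -> form).

(* A formula is used in two ways: for its meaning [TV a] stands for the number
   [a]; for its compilation [TV i] stands for the content of register [i]. *)
Fixpoint tval (t : term) : nat :=
  match t with
  | TV a => a
  | T0 => 0
  | TS t => (tval t).+1
  | TAdd t1 t2 => tval t1 + tval t2
  | TMul t1 t2 => tval t1 * tval t2
  end.

Definition bitn (i m : nat) : bool := odd (m %/ 2 ^ i).

Section Sat.
Variables (S : nat) (x : seq bool) (z : nat -> bool).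
Fixpoint sat (f : form) : Prop :=
  match f with
  | FEq t1 t2 => tval t1 = tval t2
  | FLt t1 t2 => tval t1 < tval t2
  | FBit t1 t2 => bitn (tval t1) (tval t2)
  | FX b t => onth x (tval t) = Some b
  | FZ t => z (tval t)
  | FNot f => ~ sat f
  | FAnd f g => sat f /\ sat g
  | FEx g => exists2 a, a < S & sat (g a)
  end.
End Sat.

Inductive trel (G : seq (nat * nat)) : term -> term -> Prop :=
| TRV i a : List.In (i, a) G -> trel G (TV i) (TV a)
| TR0 : trel G T0 T0
| TRS t u : trel G t u -> trel G (TS t) (TS u)
| TRAdd t1 u1 t2 u2 : trel G t1 u1 -> trel G t2 u2 -> trel G (TAdd t1 t2) (TAdd u1 u2)
| TRMul t1 u1 t2 u2 : trel G t1 u1 -> trel G t2 u2 -> trel G (TMul t1 t2) (TMul u1 u2).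

(** A parametricity relation. A function from numbers to formulas may inspect its argument; being
    related to itself means that a formula treats its variables uniformly, so that the register
    reading and the number reading have the same shape. [G] lists the registers in scope with their
    contents. *)
Inductive frel : seq (nat * nat) -> form -> form -> Prop :=
| FREq G t1 u1 t2 u2 : trel G t1 u1 -> trel G t2 u2 -> frel G (FEq t1 t2) (FEq u1 u2)
| FRLt G t1 u1 t2 u2 : trel G t1 u1 -> trel G t2 u2 -> frel G (FLt t1 t2) (FLt u1 u2)
| FRBit G t1 u1 t2 u2 : trel G t1 u1 -> trel G t2 u2 -> frel G (FBit t1 t2) (FBit u1 u2)
| FRX G b t u : trel G t u -> frel G (FX b t) (FX b u)
| FRZ G t u : trel G t u -> frel G (FZ t) (FZ u)
| FRNot G f g : frel G f g -> frel G (FNot f) (FNot g)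
| FRAnd G f1 g1 f2 g2 : frel G f1 g1 -> frel G f2 g2 -> frel G (FAnd f1 f2) (FAnd g1 g2)
| FREx G f g : (forall i a, frel ((i, a) :: G) (f i) (g a)) -> frel G (FEx f) (FEx g).

(** The result goes to register [d], and only registers from [d] on are overwritten; variables live
    below [d]. *)
Fixpoint tcomp (t : term) (d : nat) : cmd :=
  match t with
  | TV i => Copy d i
  | T0 => Zero d
  | TS t => Seq (tcomp t d) (Inc d)
  | TAdd t1 t2 =>
    Seq (tcomp t1 d) (Seq (tcomp t2 d.+1) (Seq (Zero d.+2)
      (Until (TEq d.+2 d.+1) (Seq (Inc d) (Inc d.+2)))))
  | TMul t1 t2 =>
    Seq (tcomp t1 d.+1) (Seq (tcomp t2 d.+2) (Seq (Zero d) (Seq (Zero d.+3)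
      (Until (TEq d.+3 d.+1)
        (Seq (Seq (Zero d.+4) (Until (TEq d.+4 d.+2) (Seq (Inc d) (Inc d.+4))))
             (Inc d.+3))))))
  end.

(* bounds on the value of a term and on the time to compute it, when all
   variables are at most [M] *)
Fixpoint tvb (t : term) (M : nat) : nat :=
  match t with
  | TV _ => M
  | T0 => 0
  | TS t => tvb t M + 1
  | TAdd t1 t2 => tvb t1 M + tvb t2 M
  | TMul t1 t2 => tvb t1 M * tvb t2 M
  end.

Fixpoint tb (t : term) (M : nat) : nat :=
  match t with
  | TV _ => 2 * M + 2
  | T0 => 1
  | TS t => tb t M + 1
  | TAdd t1 t2 => tb t1 M + tb t2 M + 3 * tvb t2 M + 2
  | TMul t1 t2 => tb t1 M + tb t2 M + tvb t1 M * (3 * tvb t2 M + 4) + 3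
  end.

Definition keeps d (s s' : st) := (forall i, i < d -> reg s' i = reg s i) /\ mem s' = mem s.

Lemma keepsT d d1 d2 s1 s2 s3 :
  keeps d1 s1 s2 -> keeps d2 s2 s3 -> d <= d1 -> d <= d2 -> keeps d s1 s3.
Proof.
move=> [H1 E1] [H2 E2] le_d1 le_d2; split; last by rewrite E2.
by move=> i lt_i; rewrite H2 ?H1 //; lia.
Qed.

Lemma keeps_refl d s : keeps d s s. Proof. by []. Qed.

Lemma keeps_setr d s1 s2 i v : keeps d s1 s2 -> d <= i -> keeps d s1 (setr s2 i v).
Proof.
move=> [H E] le_d; split=> // j lt_j; rewrite /= updN ?H //; lia.
Qed.

Ltac keeps := repeat (apply: keeps_setr; last by lia); first [exact: keeps_refl | eassumption |
  by match goal with K1 : keeps _ ?s ?s1, K2 : keeps _ ?s1 ?s2 |- keeps _ ?s ?s2 =>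
    apply: (keepsT K1 K2); lia end].
Ltac frame :=
  repeat match goal with
  | |- _ /\ _ => split
  | |- and3 _ _ _ => split
  | |- and4 _ _ _ _ => split
  | |- and5 _ _ _ _ _ => split
  end;
  match goal with |- keeps _ _ _ => keeps | |- _ => regs end.

Definition env_ok (G : seq (nat * nat)) d M (s : st) :=
  forall i a, List.In (i, a) G -> [/\ i < d, reg s i = a & a <= M].

Lemma env_ok_keeps G d d' M s s' : keeps d s s' -> d <= d' -> env_ok G d M s -> env_ok G d' M s'.
Proof.
move=> [H _] le_d E i a /E[lt_i Ei le_a]; split=> //; first by lia.
by rewrite H.
Qed.

Lemma env_okW G d d' M s : env_ok G d M s -> d <= d' -> env_ok G d' M s.
Proof. by move=> E le_d; apply: env_ok_keeps E. Qed.

Lemma trel_bound G t u d M s : trel G t u -> env_ok G d M s -> tval u <= tvb t M.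
Proof.
move=> R E; elim: R => {t u} //=.
- by move=> i a /E[].
- by move=> t u _; lia.
- by move=> t1 u1 t2 u2 _ H1 _ H2; lia.
- by move=> t1 u1 t2 u2 _ H1 _ H2; apply: leq_mul.
Qed.

Lemma tcomp_ok x G t u d M s : trel G t u -> env_ok G d M s ->
  ht x (tb t M) (tcomp t d) s (fun s' => keeps d s s' /\ reg s' d = tval u).
Proof.
move=> R; elim: R d s => {t u}.
- move=> i a /[swap] d /[swap] s /[swap] E /E[lt_i Ei le_a].
  by apply: ht_copy => /=; [lia|frame|lia].
- by move=> d s _; apply: ht_zero => //; frame.
- move=> t u Rt IH d s E /=.
  by apply: ht_seq (IH d s E) _ (leqnn _) => s' [K Es]; apply: ht_inc => //; frame.
- move=> t1 u1 t2 u2 R1 IH1 R2 IH2 d s E /=.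
  have := trel_bound R2 E => B2.
  apply: (@ht_seq x (tb t1 M) (tb t2 M + 3 * tvb t2 M + 2)); [exact: IH1| |by lia].
  move=> s1 [K1 E1].
  apply: (@ht_seq x (tb t2 M) (3 * tvb t2 M + 2)); [by apply: IH2; exact: (env_ok_keeps K1)| |by lia].
  move=> s2 [K2 E2].
  have {K2}K2' : keeps d s s2 /\ reg s2 d = tval u1 by split; [keeps|case: K2 => ->].
  apply: (@ht_seq x 1 (tval u2 * 3).+1 _ _ _ _ _ (fun s' => s' = setr s2 d.+2 0)); [exact: ht_zero| |by lia].
  move=> _ ->.
  apply: (@ht_until x (fun k s' => [/\ keeps d s s', reg s' d.+1 = tval u2,
      reg s' d.+2 = k & reg s' d = tval u1 + k])); first by case: K2' => ? ?; frame.
  + move=> k s3 lt_k [K3 F1 F2 F3]; split; first by regs.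
    apply: (@ht_seq x 1 1 2 _ _ _ _ (fun s' => s' = setr s3 d (reg s3 d).+1)) => //.
      exact: ht_inc.
    by move=> _ ->; apply: ht_inc => //; frame.
  + by move=> s3 [K3 F1 F2 F3]; rewrite /= F1 F2 eqxx F3.
- move=> t1 u1 t2 u2 R1 IH1 R2 IH2 d s E /=.
  have B1 := trel_bound R1 E; have B2 := trel_bound R2 E.
  have leB : tval u1 * (3 * tval u2 + 3).+1 <= tvb t1 M * (3 * tvb t2 M + 4).
    by apply: leq_mul => //; lia.
  move: (_ * (_ + 4)) leB => B leB.
  apply: (@ht_seq x (tb t1 M) (tb t2 M + B + 3)); [by apply: IH1; exact: (env_okW E)| |by lia].
  move=> s1 [K1 E1].
  apply: (@ht_seq x (tb t2 M) (B + 3)); [by apply: IH2; apply: (env_ok_keeps K1) (env_okW E _)| |by lia].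
  move=> s2 [K2 E2].
  have {K2}[K2 E3] : keeps d s s2 /\ reg s2 d.+1 = tval u1 by split; [keeps|case: K2 => ->].
  apply: (@ht_seq x 1 (B + 2) _ _ _ _ _ (fun s' => s' = setr s2 d 0)); [exact: ht_zero| |by lia].
  move=> _ ->.
  apply: (@ht_seq x 1 (B + 1) _ _ _ _ _ (fun s' => s' = setr (setr s2 d 0) d.+3 0)); [exact: ht_zero| |by lia].
  move=> _ ->.
  apply: (@ht_weaken x (tval u1 * (3 * tval u2 + 3).+1).+1 _ _ _ _ _ _ _ (fun _ H => H)); last by lia.
  apply: (@ht_until x (fun k s' => [/\ keeps d s s', reg s' d.+1 = tval u1, reg s' d.+2 = tval u2,
      reg s' d.+3 = k & reg s' d = k * tval u2])); first by frame.
  + move=> k s3 lt_k [K3 F1 F2 F3 F4]; split; first by regs.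
    apply: (@ht_seq x (3 * tval u2 + 2) 1 _ _ _ _ _ (fun s' => [/\ keeps d s s', reg s' d.+1 = tval u1, reg s' d.+2 = tval u2,
      reg s' d.+3 = k & reg s' d = k.+1 * tval u2])); [| |by lia].
    * apply: (@ht_seq x 1 (tval u2 * 3).+1 _ _ _ _ _ (fun s' => s' = setr s3 d.+4 0)); [exact: ht_zero| |by lia].
      move=> _ ->.
      apply: (@ht_until x (fun l s' => [/\ keeps d s s', reg s' d.+1 = tval u1, reg s' d.+2 = tval u2,
        reg s' d.+3 = k & reg s' d.+4 = l /\ reg s' d = k * tval u2 + l])); first by frame.
      - move=> l s4 lt_l [K4 H1 H2 H3 [H4 H5]]; split; first by regs.
        apply: (@ht_seq x 1 1 2 _ _ _ _ (fun s' => s' = setr s4 d (reg s4 d).+1)) => //.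
          exact: ht_inc.
        by move=> _ ->; apply: ht_inc => //; frame.
      - move=> s4 [K4 H1 H2 H3 [H4 H5]]; rewrite /= H2 H4 eqxx; split=> //; split=> //.
        by rewrite H5 mulSn addnC.
    * by move=> s4 [K4 H1 H2 H3 H4]; apply: ht_inc => //; frame.
  + by move=> s3 [K3 F1 F2 F3 F4]; rewrite /= F1 F3 eqxx F4.
Qed.

Definition Set1 d := Seq (Zero d) (Inc d).

Lemma ht_set1 x B d s (P : st -> Prop) : P (setr s d 1) -> 2 <= B -> ht x B (Set1 d) s P.
Proof.
move=> HP leB; apply: (@ht_seq x 1 1 _ _ _ _ _ (fun s' => s' = setr s d 0)) => //.
  exact: ht_zero.
by move=> _ ->; apply: ht_inc => //; rewrite setrr /= updE.
Qed.

(** Halving by counting: [d.+4] climbs by twos to the number in [d.+2] while [d.+4.+1] counts the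
    full steps. An odd number is reached in the middle of a step, which sets the parity in [d]. *)
Definition Half d :=
  Seq (Zero d.+4) (Seq (Zero d.+4.+1) (Seq (Zero d)
    (Seq (Until (TEq d.+4 d.+2) (Seq (Inc d.+4)
            (If (TEq d.+4 d.+2) (Set1 d) (Seq (Inc d.+4) (Inc d.+4.+1)))))
         (Copy d.+2 d.+4.+1)))).

Lemma half_ok x d s :
  ht x (8 * reg s d.+2 + 10) (Half d) s (fun s' =>
    [/\ keeps d s s', reg s' d = odd (reg s d.+2), reg s' d.+1 = reg s d.+1,
        reg s' d.+2 = (reg s d.+2)./2 & reg s' d.+3 = reg s d.+3]).
Proof.
set m := reg s d.+2; set B := 8 * m + 7.
apply: (@ht_seq x 1 (B + 2) _ _ _ _ _ (fun s' => s' = setr s d.+4 0)); [exact: ht_zero| |by lia].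
move=> _ ->.
apply: (@ht_seq x 1 (B + 1) _ _ _ _ _ (fun s' => s' = setr (setr s d.+4 0) d.+4.+1 0)); [exact: ht_zero| |by lia].
move=> _ ->.
apply: (@ht_seq x 1 B _ _ _ _ _ (fun s' => s' = setr (setr (setr s d.+4 0) d.+4.+1 0) d 0)); [exact: ht_zero| |by lia].
move=> _ ->.
pose Inv k s' := [/\ keeps d s s', reg s' d.+2 = m, reg s' d.+1 = reg s d.+1 /\ reg s' d.+3 = reg s d.+3,
   reg s' d.+4 = minn (2 * k) m & reg s' d.+4.+1 = minn k m./2 /\ reg s' d = (m < 2 * k)].
apply: (@ht_seq x (uphalf m * 5).+1 (2 * m./2 + 2) _ _ _ _ _ (Inv (uphalf m))); last by lia.
  apply: (@ht_until x Inv).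
  + rewrite /Inv; frame.
  + move=> k s1 lt_k [K1 E1 [E2 E3] E4 [E5 E6]]; split; first by rewrite /= E1 E4; lia.
    apply: (@ht_seq x 1 3 _ _ _ _ _ (fun s' => s' = setr s1 d.+4 (reg s1 d.+4).+1)) => //; first exact: ht_inc.
    move=> _ ->; apply: ht_if; rewrite [teval _ _ _]/= /upd => Ht.
      apply: ht_set1 => //.
      have : m = (2 * k).+1 by move: Ht; regs.
      by rewrite /Inv => Em; frame.
    have Hm : (2 * k).+1 < m by move: Ht; regs.
    apply: (@ht_seq x 1 1 2 _ _ _ _ (fun s' => s' = setr s1 d.+4 (reg s1 d.+4).+2)) => //.
      by apply: ht_inc => //; rewrite setrr /= updE.
    by move=> _ ->; apply: ht_inc => //; rewrite /Inv; frame.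
  + move=> s1 [K1 E1 [E2 E3] E4 [E5 E6]]; split; first by rewrite /= E1 E4; lia.
    by split=> //; split=> //; rewrite ?E4 ?E5 ?E6; lia.
move=> s1 [K1 E1 [E2 E3] E4 [E5 E6]].
apply: ht_copy; [by lia| |by rewrite E5; lia].
by frame.
Qed.

(** Register 0 holds the bound of the quantifiers and register 1 the constant 0, against which truth
    values 0 and 1 are tested. A quantifier keeps its truth value in [d] and its variable in [d.+1],
    and always runs through all values, so the number of rounds is fixed. A [Zero] of a scratch
    register stands for doing nothing. *)
Fixpoint comp (f : form) (d : nat) : cmd :=
  match f with
  | FEq t1 t2 => Seq (tcomp t1 d) (Seq (tcomp t2 d.+1) (If (TEq d d.+1) (Set1 d) (Zero d)))
  | FLt t1 t2 =>
    Seq (tcomp t1 d.+1) (Seq (tcomp t2 d.+2) (Seq (Zero d.+3) (Seq (Zero d)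
      (Until (TEq d.+3 d.+2) (Seq (If (TEq d.+3 d.+1) (Set1 d) (Zero d.+4)) (Inc d.+3))))))
  | FBit t1 t2 =>
    Seq (tcomp t1 d.+1) (Seq (tcomp t2 d.+2) (Seq (Zero d.+3)
      (Seq (Until (TEq d.+3 d.+1) (Seq (Half d) (Inc d.+3))) (Half d))))
  | FX b t => Seq (tcomp t d) (If (TX d (Some b)) (Set1 d) (Zero d))
  | FZ t => Seq (tcomp t d) (If (TZ d) (Set1 d) (Zero d))
  | FNot f => Seq (comp f d) (If (TEq d 1) (Set1 d) (Zero d))
  | FAnd f g => Seq (comp f d) (If (TEq d 1) (Zero d) (comp g d))
  | FEx g =>
    Seq (Zero d) (Seq (Zero d.+1) (Until (TEq d.+1 0)
      (Seq (comp (g d.+1) d.+2) (Seq (If (TEq d.+2 1) (Zero d.+2) (Set1 d)) (Inc d.+1)))))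
  end.

Fixpoint fb (f : form) (d M : nat) : nat :=
  match f with
  | FEq t1 t2 => tb t1 M + tb t2 M + 3
  | FLt t1 t2 => tb t1 M + tb t2 M + 5 * tvb t2 M + 3
  | FBit t1 t2 => tb t1 M + tb t2 M + (tvb t1 M).+1 * (8 * tvb t2 M + 12) + 2
  | FX _ t | FZ t => tb t M + 3
  | FNot f => fb f d M + 3
  | FAnd f g => fb f d M + fb g d M + 2
  | FEx g => M * (fb (g d.+1) d.+2 M + 5) + 3
  end.

Lemma comp_ok x S M G f g d s : frel G f g -> env_ok G d M s ->
  1 < d -> reg s 0 = S -> reg s 1 = 0 -> 0 < S <= M ->
  ht x (fb f d M) (comp f d) s
    (fun s' => keeps d s s' /\ reg s' d = asbool (sat S x (mem s) g)).
Proof.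
move=> R; elim: R d s => {G f g}.
- move=> G t1 u1 t2 u2 R1 R2 d s E lt_d _ _ _ /=.
  apply: (@ht_seq x (tb t1 M) (tb t2 M + 3)); [exact: tcomp_ok R1 E| |by lia].
  move=> s1 [K1 E1].
  apply: (@ht_seq x (tb t2 M) 3); [exact: tcomp_ok R2 (env_ok_keeps K1 _ E)| |by lia].
  move=> s2 [K2 E2].
  have {K2}[K2 E3] : keeps d s s2 /\ reg s2 d = tval u1 by split; [keeps|case: K2 => ->].
  apply: ht_if => /=; rewrite E3 E2 => Ht.
    by apply: ht_set1 => //; rewrite (asboolT (eqP Ht)); frame.
  by apply: ht_zero => //; rewrite asboolF; [frame | move=> H; rewrite H eqxx in Ht].
- move=> G t1 u1 t2 u2 R1 R2 d s E lt_d _ _ _ /=.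
  have B2 := trel_bound R2 E.
  move: (tvb t2 M) B2 => V B2.
  apply: (@ht_seq x (tb t1 M) (tb t2 M + 5 * V + 3)); [by apply: tcomp_ok R1 (env_okW E _)| |by lia].
  move=> s1 [K1 E1].
  apply: (@ht_seq x (tb t2 M) (5 * V + 3)); [by apply: tcomp_ok R2 (env_ok_keeps K1 _ (env_okW E _))| |by lia].
  move=> s2 [K2 E2].
  have {K2}[K2 E3] : keeps d s s2 /\ reg s2 d.+1 = tval u1 by split; [keeps|case: K2 => ->].
  apply: (@ht_seq x 1 (5 * V + 2) _ _ _ _ _ (fun s' => s' = setr s2 d.+3 0)); [exact: ht_zero| |by lia].
  move=> _ ->.
  apply: (@ht_seq x 1 (5 * V + 1) _ _ _ _ _ (fun s' => s' = setr (setr s2 d.+3 0) d 0)); [exact: ht_zero| |by lia].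
  move=> _ ->.
  apply: (@ht_weaken x (tval u2 * 5).+1 _ _ _ _ _ _ _ (fun _ H => H)); last by lia.
  apply: (@ht_until x (fun k s' => [/\ keeps d s s', reg s' d.+1 = tval u1, reg s' d.+2 = tval u2,
      reg s' d.+3 = k & reg s' d = (tval u1 < k)])); first by frame.
  + move=> k s3 lt_k [K3 F1 F2 F3 F4]; split; first by regs.
    apply: (@ht_seq x 3 1 4 _ _ _ _ (fun s' => [/\ keeps d s s', reg s' d.+1 = tval u1, reg s' d.+2 = tval u2,
      reg s' d.+3 = k & reg s' d = (tval u1 < k.+1)])) => //.
      apply: ht_if => /=; rewrite F1 F3 => Ht; first by apply: ht_set1 => //; frame.
      by apply: ht_zero => //; frame.
    by move=> s4 [K4 H1 H2 H3 H4]; apply: ht_inc => //; frame.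
  + move=> s3 [K3 F1 F2 F3 F4]; rewrite /= F2 F3 eqxx F4; split=> //; split=> //.
    by congr nat_of_bool; apply/idP/asboolP.
- move=> G t1 u1 t2 u2 R1 R2 d s E lt_d _ _ _ /=.
  have B1 := trel_bound R1 E; have B2 := trel_bound R2 E.
  set H := 8 * tval u2 + 10.
  have leB : tval u1 * H.+2 + H.+2 <= (tvb t1 M).+1 * (8 * tvb t2 M + 12).
    by rewrite -mulSnr; apply: leq_mul => //; rewrite /H; lia.
  move: (_ * (_ + 12)) leB => B leB.
  apply: (@ht_seq x (tb t1 M) (tb t2 M + B + 2)); [by apply: tcomp_ok R1 (env_okW E _)| |by lia].
  move=> s1 [K1 E1].
  apply: (@ht_seq x (tb t2 M) (B + 2)); [by apply: tcomp_ok R2 (env_ok_keeps K1 _ (env_okW E _))| |by lia].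
  move=> s2 [K2 E2].
  have {K2}[K2 E3] : keeps d s s2 /\ reg s2 d.+1 = tval u1 by split; [keeps|case: K2 => ->].
  apply: (@ht_seq x 1 (B + 1) _ _ _ _ _ (fun s' => s' = setr s2 d.+3 0)); [exact: ht_zero| |by lia].
  move=> _ ->.
  have halfH k s' : reg s' d.+2 = tval u2 %/ 2 ^ k -> 8 * reg s' d.+2 + 10 <= H.
    by move=> ->; have := leq_div (tval u2) (2 ^ k); rewrite /H; lia.
  apply: (@ht_seq x (tval u1 * H.+2).+1 H _ _ _ _ _ (fun s' => keeps d s s' /\
      reg s' d.+2 = tval u2 %/ 2 ^ tval u1)); last by lia.
    apply: (@ht_until x (fun k s' => [/\ keeps d s s', reg s' d.+1 = tval u1,
      reg s' d.+2 = tval u2 %/ 2 ^ k & reg s' d.+3 = k])).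
    + by rewrite expn0 divn1; frame.
    + move=> k s3 lt_k [K3 F1 F2 F3]; split; first by regs.
      apply: (@ht_seq x H 1 _ _ _ _ _ _ (ht_weaken (half_ok x d s3) (halfH _ _ F2) (fun _ H => H))); last by lia.
      move=> s4 [K4 H1 H2 H3 H4]; apply: ht_inc => //.
      by rewrite expnSr divnMA -F2 divn2; frame.
    + by move=> s3 [K3 F1 F2 F3]; rewrite /= F1 F3 eqxx.
  move=> s3 [K3 F2].
  apply: ht_weaken (half_ok x d s3) (halfH _ _ F2) _ => s4 [K4 H1 _ _ _]; split; first by keeps.
  by rewrite H1 F2 asboolb.
- move=> G b t u R d s E lt_d _ _ _ /=.
  apply: (@ht_seq x (tb t M) 3); [exact: tcomp_ok R E| |by lia].
  move=> s1 [K1 E1].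
  apply: ht_if => /=; rewrite E1 => Ht.
    by apply: ht_set1 => //; rewrite (asboolT (eqP Ht)); frame.
  by apply: ht_zero => //; rewrite asboolF; [frame | move=> H; rewrite H eqxx in Ht].
- move=> G t u R d s E lt_d _ _ _ /=.
  apply: (@ht_seq x (tb t M) 3); [exact: tcomp_ok R E| |by lia].
  move=> s1 [K1 E1]; have Em : mem s1 = mem s by case: K1.
  apply: ht_if => /=; rewrite E1 Em asboolb => Ht.
    by apply: ht_set1 => //; rewrite Ht; frame.
  by apply: ht_zero => //; rewrite (negbTE Ht); frame.
- move=> G f g _ IH d s E lt_d E0 E1 leS /=.
  apply: (@ht_seq x (fb f d M) 3); [exact: IH| |by lia].
  move=> s1 [K1 F1]; have [K1' _] := K1.
  apply: ht_if => /=; rewrite F1 K1' // E1 asbool_neg eqb0 => Ht.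
    by apply: ht_set1 => //; rewrite Ht; frame.
  by apply: ht_zero => //; rewrite (negbTE Ht); frame.
- move=> G f1 g1 f2 g2 _ IH1 _ IH2 d s E lt_d E0 E1 leS /=.
  apply: (@ht_seq x (fb f1 d M) (fb f2 d M + 2)); [exact: IH1| |by lia].
  move=> s1 [K1 F1]; have [K1' Em] := K1.
  rewrite addn2; apply: ht_if => /=; rewrite F1 K1' // E1 asbool_and eqb0 => Ht.
    by apply: ht_zero => //; rewrite (negbTE Ht); frame.
  apply: (ht_weaken (IH2 d s1 _ lt_d _ _ leS)) => //; rewrite ?K1' //; first exact: env_ok_keeps K1 _ E.
    by lia.
  by move=> s2 [K2 F2]; rewrite F2 Em -[X in X && _]negbK Ht; split=> //; keeps.
- move=> G f g _ IH d s E lt_d E0 E1 /andP[S_gt0 leS] /=.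
  set B := fb _ _ M.
  apply: (@ht_seq x 1 (M * (B + 5) + 2) _ _ _ _ _ (fun s' => s' = setr s d 0)); [exact: ht_zero| |by lia].
  move=> _ ->.
  apply: (@ht_seq x 1 (M * (B + 5) + 1) _ _ _ _ _ (fun s' => s' = setr (setr s d 0) d.+1 0)); [exact: ht_zero| |by lia].
  move=> _ ->.
  apply: (@ht_weaken x (S * (B + 4).+1).+1 _ _ _ _ _ _ _ (fun _ H => H)); last first.
    by rewrite addn1 ltnS -addnS; apply: leq_mul.
  apply: (@ht_until x (fun k s' => [/\ keeps d s s', reg s' d.+1 = k &
      reg s' d = asbool (exists2 a, a < k & sat S x (mem s) (g a))])).
  + by rewrite asboolF; [frame | case].
  + move=> k s1 lt_k [K1 F1 F2]; have [K1' Em] := K1; split; first by rewrite /= F1 K1' //; lia.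
    have ES : (exists2 a, a < k.+1 & sat S x (mem s) (g a)) <->
        (exists2 a, a < k & sat S x (mem s) (g a)) \/ sat S x (mem s) (g k).
      split=> [[a]|[[a lt_a Ha]|Hk]]; [|by exists a => //; lia|by exists k].
      by rewrite ltnS leq_eqVlt => /orP[/eqP-> Ha|lt_a Ha]; [right|left; exists a].
    have E1' : env_ok ((d.+1, k) :: G) d.+2 M s1.
      move=> i a /= [[<- <-]|/E[lt_i Ei le_a]]; first by split=> //; lia.
      by split; [lia|rewrite K1' ?Ei|].
    have r0 : reg s1 0 = S by rewrite K1' ?E0 //; lia.
    have r1 : reg s1 1 = 0 by rewrite K1' ?E1.
    have H := IH d.+1 k d.+2 s1 E1' isT r0 r1; rewrite S_gt0 leS in H; have {}H := H isT.
    apply: (@ht_seq x B 4 _ _ _ _ _ _ H); last by lia.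
    move=> s2 [K2 F3]; have [K2' _] := K2.
    have G1 : keeps d s s2 by keeps.
    have G2 : reg s2 d.+1 = k by rewrite K2'.
    have G3 : reg s2 d = asbool (exists2 a, a < k & sat S x (mem s) (g a)) by rewrite K2' //; lia.
    have G4 : reg s2 1 = 0 by rewrite (proj1 G1).
    apply: (@ht_seq x 3 1 4 _ _ _ _ (fun s' => [/\ keeps d s s', reg s' d.+1 = k &
      reg s' d = asbool (exists2 a, a < k.+1 & sat S x (mem s) (g a))])) => //; last first.
      by move=> s3 [K3 H1 H2]; apply: ht_inc => //; frame.
    apply: ht_if => /=; rewrite F3 G4 eqb0 Em => Ht.
      apply: ht_zero => //; have -> : asbool (exists2 a, a < k.+1 & sat S x (mem s) (g a)) =
          asbool (exists2 a, a < k & sat S x (mem s) (g a)).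
        by apply: asbool_equiv_eq; rewrite ES; move/asboolP: Ht; tauto.
      by frame.
    apply: ht_set1 => //; rewrite asboolT; first by frame.
    by apply/ES; right; apply/asboolP; rewrite -[asbool _]negbK.
  + move=> s1 [K1 F1 F2]; have [K1' Em] := K1.
    by rewrite /= F1 K1' ?E0 ?eqxx //; lia.
Qed.

(** * Greatest fixed points of definable operators *)

(** A single power suffices since coefficients are absorbed by the exponent when M is at least 2. *)
Definition poly_bounded (f : nat -> nat) := exists K, forall M, 1 < M -> f M <= M ^ K.

Lemma poly_bounded_const c : poly_bounded (fun=> c).
Proof.
exists c => M M_gt1; apply: leq_trans (_ : 2 ^ c <= _); first by rewrite ltnW // ltn_expl.
by case: c => // c; rewrite leq_exp2r.
Qed.

Lemma poly_bounded_id : poly_bounded id.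
Proof. by exists 1 => M _; rewrite expn1. Qed.

Lemma poly_bounded_mul f g : poly_bounded f -> poly_bounded g -> poly_bounded (fun M => f M * g M).
Proof.
by move=> [K1 H1] [K2 H2]; exists (K1 + K2) => M M1; rewrite expnD leq_mul ?H1 ?H2.
Qed.

Lemma poly_bounded_add f g : poly_bounded f -> poly_bounded g -> poly_bounded (fun M => f M + g M).
Proof.
move=> [K1 H1] [K2 H2]; exists (K1 + K2).+1 => M M1; have M0 := ltnW M1.
rewrite expnS; apply: leq_trans (_ : 2 * M ^ (K1 + K2) <= _); last by rewrite leq_mul.
rewrite mul2n -addnn; apply: leq_add.
  by apply: leq_trans (H1 _ M1) _; rewrite leq_pexp2l // leq_addr.
by apply: leq_trans (H2 _ M1) _; rewrite leq_pexp2l // leq_addl.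
Qed.

Lemma poly_bounded_succ f : poly_bounded f -> poly_bounded (fun M => (f M).+1).
Proof.
move=> Hf; have [K H] := poly_bounded_add Hf (poly_bounded_const 1).
by exists K => M /H; rewrite addn1.
Qed.

Ltac pbounded := repeat first
  [ assumption | exact: poly_bounded_const | exact: poly_bounded_id | apply: poly_bounded_add
  | apply: poly_bounded_mul | apply: poly_bounded_succ ].

Lemma poly_bounded_tvb t : poly_bounded (tvb t).
Proof. by elim: t => [i||t H|t1 H1 t2 H2|t1 H1 t2 H2] /=; pbounded. Qed.

Lemma poly_bounded_tb t : poly_bounded (tb t).
Proof.
by elim: t => [i||t H|t1 H1 t2 H2|t1 H1 t2 H2] /=; try have := poly_bounded_tvb t1;
  try have := poly_bounded_tvb t2; move=> *; pbounded.
Qed.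

Lemma poly_bounded_fb f d : poly_bounded (fb f d).
Proof.
by elim: f d => [t1 t2|t1 t2|t1 t2|b t|t|f H|f H1 g H2|f H] d /=;
  try (have := poly_bounded_tvb t1; have := poly_bounded_tb t1);
  try (have := poly_bounded_tvb t2; have := poly_bounded_tb t2);
  try have := poly_bounded_tb t; move=> *; pbounded; auto.
Qed.

Definition Pow a b :=
  Seq (Set1 a) (Seq (Zero 5) (Until (TEq 5 b)
    (Seq (Seq (tcomp (TAdd (TV a) (TV a)) 6) (Copy a 6)) (Inc 5)))).

Lemma pow_ok x a b s M : a != b -> a < 5 -> b < 5 -> 2 ^ reg s b <= M ->
  ht x (M * (9 * M + 10) + 4) (Pow a b) s (fun s' =>
    [/\ forall i, i < 5 -> reg s' i = if i == a then 2 ^ reg s b else reg s i & mem s' = mem s]).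
Proof.
move=> ne lt_a lt_b le_M; have neb : (b == a) = false by rewrite eq_sym (negbTE ne).
 have lt_bM : reg s b < M by apply: leq_trans le_M; rewrite ltn_expl.
apply: (@ht_seq x 2 (M * (9 * M + 10) + 2) _ _ _ _ _ (fun s' => s' = setr s a 1)); [exact: ht_set1| |by lia].
move=> _ ->.
apply: (@ht_seq x 1 (M * (9 * M + 10) + 1) _ _ _ _ _ (fun s' => s' = setr (setr s a 1) 5 0)); [exact: ht_zero| |by lia].
move=> _ ->.
apply: (@ht_weaken x (reg s b * (9 * M + 9).+1).+1 _ _ _ _ _ _ _ (fun _ H => H)); last first.
  by rewrite addn1 ltnS; apply: leq_mul; lia.
apply: (@ht_until x (fun k s' => [/\ forall i, i < 5 -> reg s' i = if i == a then 2 ^ k else reg s i,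
  reg s' 5 = k & mem s' = mem s])).
- by split=> // i lt_i; rewrite expn0; regs.
- move=> k s1 lt_k [H1 H2 H3]; split; first by rewrite /= H2 H1 // neb; lia.
  apply: (@ht_seq x (9 * M + 8) 1 _ _ _ _ _ (fun s' => [/\ forall i, i < 5 -> reg s' i = if i == a then 2 ^ k.+1 else reg s i,
      reg s' 5 = k & mem s' = mem s])); last by lia.
    have le_k : 2 ^ k.+1 <= M by apply: leq_trans le_M; rewrite leq_pexp2l.
    have Ra : reg s1 a = 2 ^ k by rewrite H1 // eqxx.
    have E : env_ok [:: (a, 2 ^ k)] 6 (2 ^ k) s1.
      by move=> i v [[<- <-]|[]]; split=> //; lia.
    have R : trel [:: (a, 2 ^ k)] (TAdd (TV a) (TV a)) (TAdd (TV (2 ^ k)) (TV (2 ^ k))).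
      by do !constructor.
    apply: (ht_seq (tcomp_ok x R E) (B2 := 2 * M + 2)) => [s2 [[K1 K2] K3]|].
      apply: ht_copy; [by lia| |by rewrite K3 /=; move: le_k; rewrite expnS; move: (2 ^ k) => p; lia].
      split; [|by rewrite /= updN ?K1 ?H2 //; lia|by rewrite -H3 -K2].
      move=> i lt_i; rewrite /= /upd K3 K1 ?H1 //=; last by lia.
      by case: eqP => // _; rewrite addnn -mul2n -expnS.
    by rewrite /=; move: le_k; rewrite expnS; move: (2 ^ k) => p; lia.
  move=> s2 [G1 G2 G3]; apply: ht_inc => //; split=> //; last by rewrite /= /upd eqxx G2.
  by move=> i lt_i; rewrite /= updN ?G1 //; lia.
- move=> s1 [H1 H2 H3]; split; first by rewrite /= H2 H1 // neb.
  by split=> // i lt_i; rewrite H1.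
Qed.

Fixpoint tconst c := if c is c'.+1 then TS (tconst c') else T0.

Lemma trel_const G c : trel G (tconst c) (tconst c).
Proof. by elim: c => [|c IH] /=; constructor. Qed.

Lemma tval_const c : tval (tconst c) = c.
Proof. by elim: c => //= c ->. Qed.

(** * The program that removes bad cells until the array is stable *)

Section Main.
Variables (c0 : nat) (bad : nat -> form) (acc : form).
Hypothesis c0_gt0 : 0 < c0.
Hypothesis bad_rel : forall i a, frel [:: (i, a)] (bad i) (bad a).
Hypothesis acc_rel : frel [::] acc acc.
Variable x : seq bool.

Local Notation E := (c0 * (size x).+1).
Local Notation S := (2 ^ (2 ^ E)).

Lemma S_gt1 : 1 < S.
Proof. by rewrite -{1}(expn0 2) ltn_exp2l // expn_gt0. Qed.

Lemma E_ltS : E < S.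
Proof. by apply: (@ltn_trans (2 ^ E)); exact: ltn_expl. Qed.

Definition ComputeS :=
  Seq (Zero 1) (Seq (Zero 2) (Seq (Until (TX 2 None) (Inc 2))
    (Seq (tcomp (TMul (tconst c0) (TS (TV 2))) 3) (Seq (Pow 4 3) (Pow 0 4))))).

Definition computeS_time M :=
  2 * M + tb (TMul (tconst c0) (TS (TV 2))) M + 2 * (M * (9 * M + 10) + 4) + 3.

Lemma computeS_ok :
  ht x (computeS_time S) ComputeS (St (fun=> 0) (fun=> false)) (fun s' =>
    [/\ reg s' 0 = S, reg s' 1 = 0 & mem s' = fun=> false]).
Proof.
have S1 := S_gt1; have ES := E_ltS.
have le_size : size x < S by apply: leq_ltn_trans ES; nia.
rewrite /computeS_time; set T := tb _ _; set U := S * _ + 4.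
set s0 := St _ _.
apply: (@ht_seq x 1 (2 * S + T + 2 * U + 2) _ _ _ _ _ (fun s' => s' = setr s0 1 0)); [exact: ht_zero| |by lia].
move=> _ ->.
apply: (@ht_seq x 1 (2 * S + T + 2 * U + 1) _ _ _ _ _ (fun s' => s' = setr (setr s0 1 0) 2 0)); [exact: ht_zero| |by lia].
move=> _ ->.
apply: (@ht_seq x (size x * 2).+1 (T + 2 * U) _ _ _ _ _ (fun s' => [/\ reg s' 1 = 0, reg s' 2 = size x & mem s' = fun=> false])); last by lia.
  apply: (@ht_until x (fun k s' => [/\ reg s' 1 = 0, reg s' 2 = k & mem s' = fun=> false])) => //.
  - move=> k s1 lt_k [H1 H2 H3]; split; last by apply: ht_inc => //; split=> //; rewrite /= /upd /= ?H2.
    by rewrite /= H2; case E: (onth x k) => //; have := onthNE x k; rewrite E leqNgt lt_k.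
  - move=> s1 [H1 H2 H3]; split=> //; rewrite /= H2.
    by case E: (onth x (size x)) => //; have := onthNE x (size x); rewrite E leqnn.
move=> s1 [H1 H2 H3].
have R : trel [:: (2, size x)] (TMul (tconst c0) (TS (TV 2))) (TMul (tconst c0) (TS (TV (size x)))).
  by constructor; [exact: trel_const|constructor; constructor; left].
have Ev : env_ok [:: (2, size x)] 3 S s1.
  by move=> i v [[<- <-]|[]]; split=> //; lia.
apply: (ht_seq (tcomp_ok x R Ev) (B2 := 2 * U)) => [s2 [[K1 K2] K3]|]; last exact: leqnn.
rewrite /= tval_const in K3.
have K0 : reg s2 1 = 0 by rewrite K1.
have le3 : 2 ^ reg s2 3 <= S by rewrite K3 ltnW // ltn_expl.
apply: (@ht_seq x U U _ _ _ _ _ _ (@pow_ok x 4 3 s2 S isT isT isT le3)); last by lia.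
move=> s3 [G1 G2]; have G4 : reg s3 4 = 2 ^ E by rewrite G1 // K3.
apply: (ht_weaken (@pow_ok x 0 4 s3 S isT isT isT _)) => //; first by rewrite G4.
by move=> s4 [F1 F2]; rewrite !F1 //= G4 F2 G2 K2 H3 G1.
Qed.

(** Bad cells are cleared at once, so later tests in the same pass see the smaller array. This
    preserves soundness, because every intermediate array still contains all closed families. *)
Definition Pass := Seq (Zero 2) (Until (TEq 2 0)
  (Seq (Seq (comp (bad 2) 4) (If (TEq 4 1) (Zero 5) (SetZ 2 false))) (Inc 2))).

(** A post-fixed point; the quantification over all arrays that contain [P] builds the monotonicity
    of the operator into the notion. *)
Definition closed_family (P : nat -> bool) := (forall a, P a -> a < S) /\
  forall Z : nat -> bool, (forall a, P a -> Z a) -> (forall a, Z a -> a < S) ->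
    forall a, P a -> ~ sat S x Z (bad a).

Definition stable (Z : nat -> bool) := forall a, Z a -> ~ sat S x Z (bad a).

Definition greatest_stable (Z : nat -> bool) :=
  [/\ forall a, Z a -> a < S, stable Z & forall P, closed_family P -> forall a, P a -> Z a].

Definition sound_mem (s : st) := [/\ reg s 0 = S, reg s 1 = 0, forall a, mem s a -> a < S &
  forall P, closed_family P -> forall a, P a -> mem s a].

Definition card_mem (Z : nat -> bool) := count Z (iota 0 S).

Lemma card_upd (Z : nat -> bool) a : a < S -> Z a -> card_mem (upd Z a false) < card_mem Z.
Proof.
move=> lt_a Za; rewrite /card_mem.
have E : count Z (iota 0 S) = count (upd Z a false) (iota 0 S) + count (pred1 a) (iota 0 S).
  rewrite -count_predUI [X in _ = _ + X](_ : _ = 0) ?addn0; last first.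
    by apply/eqP; rewrite eqn0Ngt -has_count; apply/hasPn => b _ /=; rewrite /upd; case: eqP => //; rewrite andbF.
  by apply: eq_count => b /=; rewrite /upd; case: eqP => [->|]; rewrite ?orbF.
by rewrite E count_uniq_mem ?iota_uniq // mem_iota add0n lt_a addn1.
Qed.

(** The clause [~ stable (mem s)] records that a stable array is never changed, so the passes made
    after stabilization do no harm. *)
Lemma pass_ok s : sound_mem s ->
  ht x (S * (fb (bad 2) 4 S + 4) + 2) Pass s (fun s' => [/\ sound_mem s', reg s' 3 = reg s 3 &
    (mem s' = mem s /\ stable (mem s)) \/ (card_mem (mem s') < card_mem (mem s) /\ ~ stable (mem s))]).
Proof.
move=> [I0 I1 I2 I3]; set F := fb _ _ _; have S1 := S_gt1.
apply: (@ht_seq x 1 (S * (F + 4) + 1) _ _ _ _ _ (fun s' => s' = setr s 2 0)); [exact: ht_zero| |by lia].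
move=> _ ->.
apply: (@ht_weaken x (S * (F + 3).+1).+1 _ _ _ _ _ _ _ (fun _ H => H)); last by rewrite addn1 -addnS.
pose Prog k s' := (mem s' = mem s /\ forall a, a < k -> mem s a -> ~ sat S x (mem s) (bad a)) \/
  (card_mem (mem s') < card_mem (mem s) /\ ~ stable (mem s)).
apply: (@ht_until x (fun k s' => [/\ sound_mem s', reg s' 3 = reg s 3, reg s' 2 = k & Prog k s'])).
- by split=> //; left.
- move=> k s1 lt_k [Snd E3 E2 HP]; have [J0 J1 J2 J3] := Snd; split; first by rewrite /= E2 J0; lia.
  apply: (@ht_seq x (F + 2) 1 _ _ _ _ _ (fun s' => [/\ sound_mem s', reg s' 3 = reg s 3, reg s' 2 = k & Prog k.+1 s'])); last by lia.
    have Ev : env_ok [:: (2, k)] 4 S s1 by move=> i v [[<- <-]|[]]; split=> //; lia.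
    have SS : 0 < S <= S by lia.
    have HC := comp_ok x (bad_rel 2 k) Ev isT J0 J1 SS.
    apply: (ht_seq HC (B2 := 2)) => [s2 [[K1 Km] K2]|]; last exact: leqnn.
    have K'1 : reg s2 1 = 0 by rewrite K1.
    have K'2 : reg s2 2 = k by rewrite K1.
    have K'3 : reg s2 3 = reg s 3 by rewrite K1.
    have K'0 : reg s2 0 = S by rewrite K1.
    apply: ht_if; rewrite /= K2 K'1 eqb0 ?negbK => /asboolP Ht.
      apply: ht_zero => //; split=> //; rewrite /sound_mem /Prog /= ?Km //.
      case: HP => [[Em H]|]; [left|by right]; split=> // a; rewrite ltnS leq_eqVlt => /orP[/eqP->|]; last exact: H.
      by rewrite -Em.
    apply: ht_setz => //; rewrite /= K'2.
    (* The current array contains every closed family, so a cell that is bad for it belongs to none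
       of them. *)
    have Snd' : sound_mem (setm s2 k false).
      split=> //=; rewrite Km.
        by move=> a; rewrite /upd; case: eqP => // _; apply: J2.
      move=> P cP a Pa; rewrite /upd; case: eqP => [Ea|_]; last exact: J3 Pa.
      by have [_ /(_ (mem s1)) H] := cP; case: (H (J3 _ cP) J2 a Pa); rewrite Ea.
    split=> //=; rewrite /Prog /= Km; case: (boolP (mem s1 k)) => Hk.
      right; have lt_c := card_upd (J2 _ Hk) Hk.
      case: HP => [[Em H]|[lt_c' ns]]; last by split=> //; exact: ltn_trans lt_c lt_c'.
      by rewrite -Em; split=> // /(_ k Hk).
    (* A bad cell that is already clear changes nothing. *)
    have -> : upd (mem s1) k false = mem s1 by rewrite -(negbTE Hk) upd_id.
    case: HP => [[Em H]|]; [left|by right]; split=> // a; rewrite ltnS leq_eqVlt => /orP[/eqP->|]; last exact: H.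
    by rewrite -Em (negbTE Hk).
  move=> s2 [[G1 G2 G3 G4] G5 G6 G7]; apply: ht_inc => //.
  by split=> //=; rewrite /upd /= G6.
- move=> s1 [[J0 J1 J2 J3] E3 E2 HP]; split; first by rewrite /= E2 J0.
  split=> //; case: HP => [[Em H]|]; [left|by right]; split=> // a Za; apply: H => //.
  exact: I2.
Qed.

(* A pass over an unstable array clears at least one of the S cells, so S passes
   reach a stable array. *)
Definition Decide :=
  Seq ComputeS (Seq (Seq (Zero 2) (Until (TEq 2 0) (Seq (SetZ 2 true) (Inc 2))))
    (Seq (Seq (Zero 3) (Until (TEq 3 0) (Seq Pass (Inc 3)))) (comp (FNot acc) 4))).

Definition decide_time M :=
  computeS_time M + (M * 3 + 2) + (M * (M * (fb (bad 2) 4 M + 4) + 4) + 2) + fb (FNot acc) 4 M.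

Lemma decide_ok :
  ht x (decide_time S) Decide (St (fun=> 0) (fun=> false)) (fun s' =>
    reg s' 1 = 0 /\ exists2 Z, greatest_stable Z & reg s' 4 = asbool (~ sat S x Z acc)).
Proof.
have S1 := S_gt1; rewrite /decide_time.
set T1 := computeS_time S; set T2 := _ + 2; set T3 := _ + 2; set T4 := fb _ _ _.
apply: (@ht_seq x T1 (T2 + T3 + T4) _ _ _ _ _ _ computeS_ok); last by lia.
move=> s1 [H1 H2 H3].
apply: (@ht_seq x T2 (T3 + T4) _ _ _ _ _ sound_mem); [| |by lia].
  apply: (@ht_seq x 1 (S * 3).+1 _ _ _ _ _ (fun s' => s' = setr s1 2 0)); [exact: ht_zero| |by rewrite /T2; lia].
  move=> _ ->.
  apply: (@ht_until x (fun k s' => [/\ reg s' 0 = S, reg s' 1 = 0, reg s' 2 = k & mem s' = fun a => a < k])).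
  - by split=> //=; rewrite H3; apply: funext.
  - move=> k s2 lt_k [G1 G2 G3 G4]; split; first by rewrite /= G1 G3; lia.
    apply: (@ht_seq x 1 1 _ _ _ _ _ (fun s' => s' = setm s2 k true)); [by apply: ht_setz; rewrite ?G3| |exact: leqnn].
    move=> _ ->; apply: ht_inc => //; split=> //=; first by rewrite /upd /= G3.
    by rewrite G4; apply: funext => a; rewrite /upd [RHS]ltnS [RHS]leq_eqVlt; case: eqP.
  - move=> s2 [G1 G2 G3 G4]; split; first by rewrite /= G1 G3.
    by split=> //; rewrite G4 // => P [cP _].
move=> s2 Snd2.
apply: (@ht_seq x T3 T4 _ _ _ _ _ (fun s' => sound_mem s' /\ stable (mem s'))); [| |by lia].
  apply: (@ht_seq x 1 (T3.-1) _ _ _ _ _ (fun s' => s' = setr s2 3 0)); [exact: ht_zero| |by rewrite /T3; lia].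
  move=> _ ->; have -> : T3.-1 = (S * (S * (fb (bad 2) 4 S + 4) + 3).+1).+1 by rewrite /T3 !addnS addn0.
  apply: (@ht_until x (fun k s' => [/\ sound_mem s', reg s' 3 = k & stable (mem s') \/ card_mem (mem s') + k <= S])).
  - split=> //; right; rewrite addn0 /card_mem.
    by rewrite -{2}(size_iota 0 S) count_size.
  - move=> k s3 lt_k [Snd3 G3 HP]; split; first by case: Snd3 => /= -> *; rewrite G3; lia.
    apply: (ht_seq (pass_ok Snd3) (B2 := 1)) => [s4 [Snd4 G4 HP4]|]; last by rewrite -addnA.
    apply: ht_inc => //; split=> /=; [by case: Snd4 => *; split|by rewrite /upd /= G4 G3|].
    case: HP4 => [[-> ?]|[lt_c ns]]; first by left.
    by right; case: HP => // le_c; lia.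
  (* After [S] rounds the counting alternative leaves no cell at all, and the empty array is
     stable. *)
  - move=> s3 [Snd3 G3 HP]; have [J0 J1 J2 J3] := Snd3; split; first by rewrite /= G3 J0.
    split=> //; case: HP => // le_c a Za.
    have : has (mem s3) (iota 0 S) by apply/hasP; exists a => //; rewrite mem_iota /= J2.
    by rewrite has_count; rewrite /card_mem in le_c; lia.
move=> s3 [[J0 J1 J2 J3] Stb].
have Ev : env_ok [::] 4 S s3 by [].
have SS : 0 < S <= S by lia.
apply: (ht_weaken (comp_ok x (FRNot acc_rel) Ev isT J0 J1 SS)) => // s4 [[K1 K2] K3].
by split; [rewrite K1 | exists (mem s3)].
Qed.

End Main.

Lemma poly_bounded_decide c0 bad acc : poly_bounded (decide_time c0 bad acc).
Proof.
rewrite /decide_time /computeS_time.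
have := poly_bounded_tb (TMul (tconst c0) (TS (TV 2))).
have := poly_bounded_fb (bad 2) 4; have := poly_bounded_fb (FNot acc) 4.
move: (fb (bad 2) 4) (fb _ 4) (tb _) => f1 f2 f3 H1 H2 H3.
by pbounded.
Qed.

(** With E = c0 (n + 1), time S^K equals 2^(K 2^E), which is at most 2^(2^(E + K)): the degree of
    the polynomial only adds a constant to the upper exponent. *)
Theorem definable_in_2EXPTIME (c0 : nat) (bad : nat -> form) (acc : form) (L : seq bool -> Prop) :
  0 < c0 -> (forall i a, frel [:: (i, a)] (bad i) (bad a)) -> frel [::] acc acc ->
  (forall x Z, greatest_stable c0 bad x Z -> (L x <-> sat (2 ^ (2 ^ (c0 * (size x).+1))) x Z acc)) ->
  in_2EXPTIME L.
Proof.
move=> c0_gt0 bad_rel acc_rel HL.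
(* Register 4 ends with the truth value of the negation of [acc] and register 1 with 0, so their
   equality means acceptance. *)
have [M HM] := TM_of_cmd (Decide c0 bad acc) 4 1.
have := poly_bounded_decide c0 bad acc; set B := decide_time _ _ _ => PB.
have [K HK] : poly_bounded (fun S => (B S).+1 * (2 * B S + 4) + 2) by pbounded.
exists M, (c0 + K), 1 => x.
have [n [s' [R le_n [H1 [Z GZ H2]]]]] := decide_ok c0_gt0 bad_rel acc_rel x.
have [k [le_k HC]] := HM _ _ _ R; exists k; split.
  apply: leq_trans le_k _.
  apply: leq_trans (_ : (2 ^ (2 ^ (c0 * (size x).+1))) ^ K <= _); last first.
    rewrite -expnM leq_exp2l //; apply: leq_trans (_ : 2 ^ (c0 * (size x).+1) * 2 ^ K <= _).
      by rewrite leq_mul // ltnW // ltn_expl.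
    by rewrite -expnD leq_exp2l // expn1; nia.
  apply: leq_trans (HK _ (S_gt1 c0 x)); rewrite leq_add2r.
  by rewrite /= -/B in le_n; apply: leq_mul; lia.
case: HC => Hh Ha; split=> //; rewrite Ha H1 H2 (HL x Z GZ) eqb0.
by rewrite asbool_neg negbK; split=> /asboolP.
Qed.

(** * Average energy *)

Section Limsup.
Local Open Scope ring_scope.
Local Notation R := Rdefinitions.R.
Implicit Types u : nat -> \bar R.

Lemma limn_esup_inf u : limn_esup u = ereal_inf (range (esups u)).
Proof. by rewrite limn_esup_lim; apply/cvg_lim => //; exact: cvg_esups_inf. Qed.

Lemma limn_esup_ub u (l : \bar R) : (forall n, (u n <= l)%E) -> (limn_esup u <= l)%E.
Proof.
move=> H; rewrite limn_esup_inf; apply: (@le_trans _ _ (esups u 0%N)).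
  by apply: ereal_inf_lbound; exists 0%N.
by apply: ge_ereal_sup => _ [n _ <-]; exact: H.
Qed.

Lemma limn_esup_lb u (l : \bar R) :
  (forall n, exists2 m, (n <= m)%N & (l <= u m)%E) -> (l <= limn_esup u)%E.
Proof.
move=> H; rewrite limn_esup_inf; apply: le_ereal_inf_tmp => _ [n _ <-].
have [m le_m le_l] := H n; apply: le_trans le_l _.
by apply: ereal_sup_ubound; exists m.
Qed.

End Limsup.

Section AverageEnergy.
Local Open Scope ring_scope.
Variables (w : nat -> nat -> int) (pi : nat -> nat).

Lemma AE_bounded (C : nat) : (forall n, EL w pi n <= C%:Z) -> AE w C pi.
Proof.
move=> H; apply: limn_esup_ub => n; rewrite lee_fin /avg_EL.
(* The average over no positions is 0, because the inverse of 0 is 0. *)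
case: n => [|n]; first by rewrite invr0 mulr0.
rewrite ler_pdivrMr ?ltr0n // -natrM -[X in _ <= X]/((Posz (C * n.+1))%:~R) ler_int.
have -> : Posz (C * n.+1) = \sum_(i < n.+1) C%:Z by rewrite sumr_const card_ord -mulr_natr natz PoszM.
by apply: ler_sum.
Qed.

(** Otherwise all levels from [N] on are at least t + 1, as they are integers. The first [N] levels
    are nonnegative and lose their weight in the average, which then exceeds t + 1/2 infinitely
    often. *)
Lemma AE_often_low (t : nat) : AE w t pi -> Energy_L w pi ->
  forall N, exists2 n, (N <= n)%N & EL w pi n <= t%:Z.
Proof.
move=> HAE HE N; apply: contrapT => Hno.
have Hhi n : (N <= n)%N -> t.+1%:Z <= EL w pi n.
  by move=> le_n; rewrite leNgt; apply/negP => lt_n; apply: Hno; exists n => //; lia.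
have Hsum n : (t.+1 * n)%:Z <= \sum_(i < N + n) EL w pi i.
  rewrite big_split_ord /= -[X in X <= _]add0r lerD //; first by apply: sumr_ge0 => i _; exact: HE.
  have -> : Posz (t.+1 * n) = \sum_(i < n) t.+1%:Z by rewrite sumr_const card_ord -mulr_natr natz PoszM.
  by apply: ler_sum => i _; apply: Hhi; rewrite leq_addr.
suff : (((t%:R + 1 / 2)%R : Rdefinitions.R)%:E <= limn_esup (fun n => (avg_EL w pi n)%:E))%E.
  by move=> /le_trans /(_ HAE); rewrite lee_fin; lra.
apply: limn_esup_lb => n0.
(* The inequality is the bound t + 1/2 for the average of N + k levels, cleared of denominators; it
   amounts to k being at least (2t + 1) N. *)
have [k lt_k Hk] : exists2 k, (n0 < k)%N & (t.*2.+1 * (N + k) <= 2 * (t.+1 * k))%N.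
  by exists (t.*2.+1 * N + n0.+1)%N; nia.
exists (N + k)%N; first by lia.
rewrite lee_fin /avg_EL ler_pdivlMr ?ltr0n; last by lia.
apply: (@le_trans _ _ ((t.+1 * k)%:Z%:~R)); last by rewrite ler_int.
rewrite -[X in _ <= X]/((t.+1 * k)%:R).
move: Hk; rewrite -(ler_nat Rdefinitions.R) -[t.*2.+1]addn1 -[t.*2]mul2n -[t.+1]addn1.
rewrite !natrM !natrD ?natrM.
move: (t%:R) (k%:R) (N%:R) => T X Y H; lra.
Qed.

End AverageEnergy.

(** * Reduction to bounded safe regions *)

Section Game.
Variable I : instance.

(** Levels are natural numbers, so the lower bound on the energy is built into the moves. *)
Definition moves (e : nat) (z : int) (e' : nat) := (e%:Z + z = e'%:Z)%R.

Definition locally_closed (Z : nat -> nat -> Prop) (v e : nat) : Prop :=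
  if nth false (owner1 I) v
  then forall v' z, (v, v', z) \in edges I -> exists2 e', moves e z e' & Z v' e'
  else exists v' z e', [/\ (v, v', z) \in edges I, moves e z e' & Z v' e'].

Definition safe_region (Z : nat -> nat -> Prop) :=
  Z (init I) 0 /\ forall v e, Z v e -> v < nV I /\ locally_closed Z v e.

(** * Cutting out energy levels *)

Section Cut.
Variable W : nat.
Hypothesis W_gt0 : 0 < W.
Hypothesis W_max : forall u v z, (u, v, z) \in edges I -> `|z|%N <= W.

(** The number of possible contents of a window, that is, of sets of pairs of a vertex and one of 2W
    levels. *)
Definition windows := 2 ^ (nV I * (2 * W)).

(* If two windows of 2W consecutive levels carry the same vertices, the levels
   between them can be removed. *)
Lemma cut_region Z C : safe_region Z -> (forall v e, Z v e -> e <= C) -> windows + 2 * W < C ->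
  exists2 Z', safe_region Z' & forall v e, Z' v e -> e < C.
Proof.
move=> [Z0 HZ] HC lt_C.
pose f (e : 'I_windows.+1) : {ffun 'I_(nV I) * 'I_(2 * W) -> bool} :=
  [ffun p : 'I_(nV I) * 'I_(2 * W) => asbool (Z p.1 (e + p.2))].
(* There is one more starting level than there are contents. *)
have [e1 [e2 [lt_e Ef]]] : exists e1 e2 : 'I_windows.+1, e1 < e2 /\ f e1 = f e2.
  have /injectivePn[a [b ne Eab]] : ~~ injectiveb f.
    apply/negP => /injectiveP /leq_card.
    by rewrite card_ord card_ffun card_prod !card_ord card_bool ltnn.
  by case: (ltngtP a b) => [lt|lt|E]; [exists a, b|exists b, a|rewrite (val_inj E) eqxx in ne].
have Ew v e : e1 <= e -> e < e1 + 2 * W -> Z v e <-> Z v (e + (e2 - e1)).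
  move=> le_e lt_e'; have [lt_v|le_v] := ltnP v (nV I); last first.
    by split=> /HZ[]; lia.
  have lt_i : e - e1 < 2 * W by lia.
  have /ffunP/(_ (Ordinal lt_v, Ordinal lt_i)) := Ef; rewrite !ffunE /=.
  have -> : e1 + (e - e1) = e by lia.
  have -> : e2 + (e - e1) = e + (e2 - e1) by lia.
  by move=> E; split=> /asboolP H; apply/asboolP; congruence.
pose Z' v e := if e < e1 + 2 * W then Z v e else Z v (e + (e2 - e1)).
have Z'lo v e : e < e1 + 2 * W -> Z' v e <-> Z v e by rewrite /Z' => ->.
have Z'hi v e : e1 <= e -> Z' v e <-> Z v (e + (e2 - e1)).
  by move=> le_e; rewrite /Z'; case: ifP => // /(Ew v e le_e).
exists Z'; last first.
  move=> v e; rewrite /Z'; case: ifP => [lt_w _|_ /HC]; last by lia.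
  by have := ltn_ord e1; lia.
split; first by apply/Z'lo => //; lia.
move=> v e Ze.
(* Within distance W of any level the new region is the old one shifted by a constant [k]: no shift
   below the middle of the lower window, the full shift from there on. On the window itself both
   descriptions agree, and no move goes further than W. *)
have [k [Zk kW lc]] : exists k, [/\ Z v (e + k), k = 0 \/ W <= e &
    forall v' e', e <= e' + W -> e' <= e + W -> Z' v' e' <-> Z v' (e' + k)].
  have [lt|le] := ltnP e (e1 + W).
    exists 0; split; [by rewrite addn0; apply/Z'lo => //; lia|by left|].
    by move=> v' e' _ le'; rewrite addn0; apply: Z'lo; lia.
  exists (e2 - e1); split; [by apply/Z'hi => //; lia|by right; lia|].
  by move=> v' e' le' _; apply: Z'hi; lia.
have shift v' z e' : (v, v', z) \in edges I -> moves (e + k) z e' -> Z v' e' ->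
    exists2 e'', moves e z e'' & Z' v' e''.
  move=> /W_max le_z mv Ze'; rewrite /moves in mv.
  (* The subtraction is exact: either [k] is 0, or [e] is at least W and no weight can bring the
     level below [k]. *)
  exists (e' - k); first by rewrite /moves; lia.
  by apply/lc; [lia|lia|rewrite subnK //; lia].
have [lt_v H] := HZ _ _ Zk; split=> //; move: H; rewrite /locally_closed; case: ifP => _.
  by move=> H v' z Ed; have [e' mv Ze'] := H v' z Ed; apply: shift mv Ze'.
move=> [v' [z [e' [Ed mv Ze']]]]; have [e'' mv' Ze''] := shift _ _ _ Ed mv Ze'.
by exists v', z, e''.
Qed.

Lemma short_region Z C : safe_region Z -> (forall v e, Z v e -> e <= C) ->
  exists2 Z', safe_region Z' & forall v e, Z' v e -> e <= windows + 2 * W.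
Proof.
elim/ltn_ind: C Z => C IH Z HZ HC.
have [le_C|lt_C] := leqP C (windows + 2 * W).
  by exists Z => // v e /HC le_e; exact: leq_trans le_C.
have [Z' HZ' HC'] := cut_region HZ HC lt_C.
apply: (IH C.-1 _ Z') => //; first by lia.
by move=> v e /HC'; lia.
Qed.
End Cut.

(** * Winning with a bounded region *)

Hypothesis wfI : wf_instance I.
Local Notation A := (arena_of I).
Local Notation w := (weight_of I).

Lemma uniq_map_inj (T1 T2 : eqType) (f : T1 -> T2) s x y :
  uniq (map f s) -> x \in s -> y \in s -> f x = f y -> x = y.
Proof.
elim: s => //= a s IH /andP[na us]; rewrite !inE => /orP[/eqP->|xs] /orP[/eqP->|ys] //; last exact: IH.
  by move=> E; move: na; rewrite E map_f.
by move=> E; move: na; rewrite -E map_f.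
Qed.

Lemma edge_weight u v z : (u, v, z) \in edges I -> ar_E A u v /\ w u v = z.
Proof.
move=> He; split; first by apply/hasP; exists (u, v, z); rewrite //= !eqxx.
have [_ _ _ Hu _] := wfI; rewrite /weight_of.
case Es: [seq _ <- _ | _] => [|e s].
  have : (u, v, z) \in [seq e <- edges I | (e.1.1 == u) && (e.1.2 == v)].
    by rewrite mem_filter /= !eqxx.
  by rewrite Es.
have : e \in [seq e <- edges I | (e.1.1 == u) && (e.1.2 == v)] by rewrite Es mem_head.
rewrite mem_filter => /andP[/andP[/eqP E1 /eqP E2] He'].
have -> // : e = (u, v, z).
by apply: (uniq_map_inj Hu) => //=; rewrite -E1 -E2; case: (e.1).
Qed.

Lemma weight_edge u v : ar_E A u v -> (u, v, w u v) \in edges I.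
Proof.
move=> /hasP[[[u' v'] z] He /= /andP[/eqP E1 /eqP E2]]; subst u' v'.
by have [_ ->] := edge_weight He.
Qed.

Lemma edge_lt u v : ar_E A u v -> u < nV I /\ v < nV I.
Proof. by move/weight_edge; have [_ _ /allP H _ _] := wfI; move=> /H /andP. Qed.

Lemma out_edge u : u < nV I -> exists v, ar_E A u v.
Proof.
have [_ _ _ _ H] := wfI; move=> /H /hasP[[[u' v] z] He /= /eqP E].
by exists v; apply/hasP; exists (u', v, z) => //=; rewrite E !eqxx.
Qed.

Definition energy (s : seq nat) : int :=
  (\sum_(i < (size s).-1) w (nth 0 s i) (nth 0 s i.+1))%R.

Lemma size_prefix (pi : nat -> nat) n : size (prefix pi n) = n.
Proof. by rewrite size_map size_iota. Qed.

Lemma nth_prefix (pi : nat -> nat) n i : i < n -> nth 0 (prefix pi n) i = pi i.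
Proof. by move=> lt_i; rewrite (nth_map 0) ?size_iota // nth_iota. Qed.

Lemma prefixS (pi : nat -> nat) n : prefix pi n.+1 = rcons (prefix pi n) (pi n).
Proof. by rewrite /prefix -addn1 iotaD map_cat cats1. Qed.

Lemma energy_prefix pi n : energy (prefix pi n.+1) = EL w pi n.
Proof.
rewrite /energy size_prefix; apply: eq_bigr => i _.
by rewrite !nth_prefix // ltnS // ltnW.
Qed.

Lemma ELS pi n : EL w pi n.+1 = (EL w pi n + w (pi n) (pi n.+1))%R.
Proof. by rewrite /EL big_ord_recr. Qed.

Lemma region_wins Z C : safe_region Z -> (forall v e, Z v e -> e <= C) ->
  player0_wins A (AvgEnergy_L w C).
Proof.
move=> [Z0 HZ] HC.
(* The history determines the energy, so the strategy can find its place in the region. Where the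
   configuration lies outside the region the condition is void and any edge will do, which makes the
   choice total. *)
pose good x v v' := ar_E A v v' /\ forall e, energy (rcons x v) = e%:Z%R -> Z v e ->
  exists2 e', moves e (w v v') e' & Z v' e'.
have goodP x v : v < nV I -> nth false (owner1 I) v = false -> exists v', good x v v'.
  move=> lt_v own; have [[e [Ee Ze]]|nZ] := pselect (exists e, energy (rcons x v) = e%:Z%R /\ Z v e).
    have [_] := HZ _ _ Ze; rewrite /locally_closed own => -[v' [z [e' [He mv Ze']]]].
    have [Ev Ew] := edge_weight He; exists v'; split=> // e1; rewrite Ee => -[<-] _.
    by exists e'; rewrite ?Ew.
  have [v' Ev] := out_edge lt_v; exists v'; split=> // e Ee Ze.
  by case: nZ; exists e.
exists (fun x v => xget 0 [set v' | good x v v']%classic); split.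
  by move=> x v _ lt_v own; have [] := xgetPex 0 (goodP x v lt_v own).
move=> pi [pi0 Hpi] Hc.
have inv n : exists2 e, EL w pi n = e%:Z%R & Z (pi n) e.
  elim: n => [|n [e Ee Ze]]; first by exists 0; rewrite ?pi0 // /EL big_ord0.
  have [inV Ev] := Hpi n; have [_ lc] := HZ _ _ Ze.
  suff [e' mv Ze'] : exists2 e', moves e (w (pi n) (pi n.+1)) e' & Z (pi n.+1) e'.
    by exists e' => //; rewrite ELS Ee.
  move: lc; rewrite /locally_closed; case: ifP => own.
    by move=> lc; exact: lc (weight_edge Ev).
  move=> _; have [_] := xgetPex 0 (goodP (prefix pi n) _ inV own).
  by rewrite -(Hc n own) -prefixS energy_prefix => /(_ e Ee Ze).
split; first by move=> n; have [e -> _] := inv n.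
by apply: AE_bounded => n; have [e -> /HC] := inv n.
Qed.

(** * Extracting a bounded region from a winning strategy *)

Section Winning.
Variable t : nat.
Variable (sigma : seq nat -> nat -> nat).
Hypothesis sigma_strat : is_strategy A false sigma.
Hypothesis sigma_win :
  forall pi, is_play A pi -> consistent A false sigma pi -> AvgEnergy_L w t pi.

Definition history (s : seq nat) := [/\ 0 < size s, nth 0 s 0 = init I &
  forall i, i.+1 < size s -> ar_E A (nth 0 s i) (nth 0 s i.+1) /\
    (nth false (owner1 I) (nth 0 s i) = false -> nth 0 s i.+1 = sigma (take i s) (nth 0 s i))].

Lemma history_last s : history s -> last 0 s < nV I.
Proof.
move=> [s0 E0 H]; rewrite -nth_last; case: s s0 E0 H => // a [|b s] _ /= E0 H.
  by rewrite E0; have [_ ->] := wfI.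
by have [/edge_lt[]] := H (size s) (leqnn _).
Qed.

Lemma history_rcons s v : history s -> ar_E A (last 0 s) v ->
  (nth false (owner1 I) (last 0 s) = false -> v = sigma (take (size s).-1 s) (last 0 s)) ->
  history (rcons s v).
Proof.
move=> [s0 E0 H] Ev Es; split; first by rewrite size_rcons.
  by rewrite nth_rcons s0.
move=> i; rewrite size_rcons ltnS => lt_i.
rewrite nth_rcons lt_i [nth 0 (rcons s v) i.+1]nth_rcons -cats1 takel_cat; last exact: ltnW.
have [lt_i1|le_i1] := ltnP i.+1 (size s); first exact: H.
have Ei : i = (size s).-1 by lia.
have -> : (i.+1 == size s) = true by lia.
by rewrite Ei nth_last.
Qed.

Lemma history_step s : history s -> exists v, history (rcons s v).
Proof.
move=> Hs; have lt_v := history_last Hs; case own: (nth false (owner1 I) (last 0 s)).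
  have [v Ev] := out_edge lt_v; exists v; apply: history_rcons => //; by rewrite own.
exists (sigma (take (size s).-1 s) (last 0 s)); apply: history_rcons => //.
apply: sigma_strat => //; apply/(all_nthP 0) => i; rewrite size_take => lt_i.
have lt_i1 : i.+1 < size s by move: lt_i; case: ifP; lia.
have [_ _ /(_ i lt_i1)[/edge_lt[lt_si _] _]] := Hs.
by rewrite nth_take //; lia.
Qed.

Lemma energy_rcons s v : 0 < size s ->
  energy (rcons s v) = (energy s + w (last 0 s) v)%R.
Proof.
case: s => // a s _; rewrite /energy size_rcons /= big_ord_recr /=; congr (_ + _)%R.
  by apply: eq_bigr => i _; rewrite -rcons_cons !nth_rcons /= !ltnS ltn_ord ltnW //.
by rewrite -rcons_cons !nth_rcons /= ltnSn ltnn eqxx -[nth 0 (a :: s) _]/(nth 0 (a :: s) (size (a :: s)).-1) nth_last.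
Qed.

(** Dependent choice by iteration. It is used with the trivial property, to prolong a history to a
    play, and with unboundedness, to build a play that contradicts the average bound. *)
Lemma infinite_play (P : seq nat -> Prop) s0 : history s0 -> P s0 ->
  (forall s, history s -> P s -> exists v, history (rcons s v) /\ P (rcons s v)) ->
  exists pi, [/\ is_play A pi, consistent A false sigma pi, prefix pi (size s0) = s0 &
    forall n, size s0 <= n -> P (prefix pi n)].
Proof.
move=> H0 P0 HP.
pose nxt s := xget 0 [set v | history (rcons s v) /\ P (rcons s v)]%classic.
pose S n := iter n (fun s => rcons s (nxt s)) s0.
have HS n : history (S n) /\ P (S n).
  elim: n => [|n [Hn Pn]] //=; exact: (xgetPex 0 (HP _ Hn Pn)).
have sizeS n : size (S n) = size s0 + n by elim: n => [|n IH] /=; rewrite ?addn0 // size_rcons IH addnS.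
have nthS n m i : i < size (S n) -> nth 0 (S (n + m)) i = nth 0 (S n) i.
  move=> lt_i; elim: m => [|m IH]; first by rewrite addn0.
  by rewrite addnS /= nth_rcons sizeS ifT //; rewrite sizeS in lt_i; lia.
have s_gt0 : 0 < size s0 by case: H0.
pose pi k := nth 0 (S k) k.
have piE n k : k < size (S n) -> pi k = nth 0 (S n) k.
  rewrite /pi => lt_k; case: (leqP n k) => [le_n|/ltnW le_k].
    by rewrite -(subnKC le_n) nthS // subnKC.
  by rewrite -[in RHS](subnKC le_k) nthS // sizeS; lia.
have prefE n : prefix pi (size s0 + n) = S n.
  apply: (@eq_from_nth _ 0); first by rewrite size_prefix sizeS.
  by move=> i; rewrite size_prefix => lt_i; rewrite nth_prefix // (piE n) // sizeS.
have step n : ar_E A (pi n) (pi n.+1) /\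
    (nth false (owner1 I) (pi n) = false -> pi n.+1 = sigma (prefix pi n) (pi n)).
  have [[_ _ H] _] := HS n.+2.
  rewrite !(piE n.+2) ?sizeS; [|by lia|by lia].
  have [|H1 H2] := H n; first by rewrite sizeS; lia.
  split=> // /H2 ->; congr sigma; apply: (@eq_from_nth _ 0).
    by rewrite size_take sizeS size_prefix ifT //; lia.
  move=> i; rewrite size_take sizeS ifT; last by lia.
  by move=> lt_i; rewrite nth_take // nth_prefix // (piE n.+2) // sizeS; lia.
exists pi; split.
- split; first by rewrite /pi /=; case: H0.
  by move=> n; have [Ev _] := step n; split=> //; have [] := edge_lt Ev.
- by move=> n own; have [_ ->] := step n.
- by rewrite -[size s0]addn0 prefE.
- by move=> n /subnKC <-; rewrite prefE; have [] := HS (n - size s0).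
Qed.

Lemma history_play s : history s ->
  exists pi, [/\ is_play A pi, consistent A false sigma pi & prefix pi (size s) = s].
Proof.
move=> Hs; have [|pi [? ? ? _]] := @infinite_play (fun=> True) s Hs Logic.I; last by exists pi.
by move=> s1 /history_step[v ?] _; exists v.
Qed.

Lemma energy_ge0 s : history s -> (0 <= energy s)%R.
Proof.
move=> Hs; have [pi [H1 H2 Es]] := history_play Hs; have [HE _] := sigma_win H1 H2.
have s0 : 0 < size s by case: Hs.
by rewrite -Es -(prednK s0) energy_prefix.
Qed.

Definition low (s : seq nat) := (energy s <= t%:Z)%R.

(** The part of the game tree before the next low visit: the starting history may be low, its proper
    prolongations may not. *)
Inductive high_ext : seq nat -> seq nat -> Prop :=
| high_refl s : high_ext s s
| high_step s v s' : history (rcons s v) -> ~ low (rcons s v) ->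
    high_ext (rcons s v) s' -> high_ext s s'.

Lemma high_ext_history s s' : high_ext s s' -> history s -> history s'.
Proof. by elim=> {s s'} // s v s' Hv _ _ IH _; exact: IH. Qed.

Lemma high_ext_rcons s s' v : high_ext s s' -> history (rcons s' v) -> ~ low (rcons s' v) ->
  high_ext s (rcons s' v).
Proof.
elim=> {s s'} [s Hv nl|s u s' Hu nlu _ IH Hv nl]; first exact: high_step (high_refl _).
exact: high_step (IH Hv nl).
Qed.

Definition unbounded s := forall c : nat, exists2 s', high_ext s s' & (c%:Z < energy s')%R.

(** If each high successor had a bound, then the largest of these finitely many bounds and of the
    energy of [s] itself would bound all high extensions of [s]. *)
Lemma unbounded_step s : history s -> unbounded s ->
  exists v, [/\ history (rcons s v), ~ low (rcons s v) & unbounded (rcons s v)].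
Proof.
move=> Hs Us; apply: contrapT => Hno.
have [c Hc] : {c : nat -> nat & forall v s', history (rcons s v) -> ~ low (rcons s v) ->
    high_ext (rcons s v) s' -> (energy s' <= (c v)%:Z)%R}.
  apply: (@choice _ _ (fun v c => forall s', history (rcons s v) -> ~ low (rcons s v) ->
    high_ext (rcons s v) s' -> (energy s' <= c%:Z)%R)) => v.
  apply: contrapT => Hc; apply: Hno; exists v.
  have [Hv nl Uv] : [/\ history (rcons s v), ~ low (rcons s v) & unbounded (rcons s v)].
    split.
    - by apply: contrapT => H; apply: Hc; exists 0 => s' /H.
    - by move=> H; apply: Hc; exists 0 => s' _ /(_ H).
    - move=> c; apply: contrapT => H; apply: Hc; exists c => s' _ _ Hx.
      by rewrite leNgt; apply/negP => lt_c; apply: H; exists s'.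
  by split.
have [s' Hs' lt_c] := Us (maxn `|energy s|%N (\max_(v < nV I) c v)).
have : (energy s' <= (maxn `|energy s|%N (\max_(v < nV I) c v))%:Z)%R.
  have [Es|[v [Hv nl Hx]]] : s = s' \/ exists v, [/\ history (rcons s v), ~ low (rcons s v) & high_ext (rcons s v) s'].
  - by case: Hs' {lt_c} => {s'} [s1|s1 v s' Hv nl Hx]; [left|right; exists v].
  - by rewrite -Es; lia.
  apply: (le_trans (Hc v s' Hv nl Hx)); rewrite lez_nat leq_max; apply/orP; right.
  have lt_v : v < nV I by have := history_last Hv; rewrite last_rcons.
  exact: (leq_bigmax (Ordinal lt_v)).
by rewrite leNgt lt_c.
Qed.

(* Unboundedness is inherited by some one-step prolongation, so it would produce
   a play whose energy eventually stays above t, against the average bound. *)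
Lemma low_bounded s : history s -> ~ unbounded s.
Proof.
move=> Hs Us.
have [v [Hv nl Uv]] := unbounded_step Hs Us.
pose P s' := ~ low s' /\ unbounded s'.
have [|s' Hs' [nl' Us']|pi [H1 H2 _ HP]] := @infinite_play P (rcons s v) Hv; first by split.
  by have [v' [Hv' ? ?]] := unbounded_step Hs' Us'; exists v'; split=> //; split.
have [HE HA] := sigma_win H1 H2.
have [n le_n lown] := AE_often_low HA HE (size (rcons s v)).
have [nln _] := HP n.+1 (leqW le_n).
by apply: nln; rewrite /low energy_prefix.
Qed.

(* The region collects the configurations met when each low configuration is
   always played from the same representative history. *)
Lemma wins_region : exists2 Z, safe_region Z & exists C, forall v e, Z v e -> e <= C.
Proof.
pose at_conf v e s := [/\ history s, last 0 s = v & energy s = e%:Z%R].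
pose rep v e := xget [::] [set s | at_conf v e s]%classic.
have repP v e s : at_conf v e s -> at_conf v e (rep v e).
  by move=> H; apply: (xgetPex [::] (ex_intro (fun s => at_conf v e s) s H)).
pose Z v e := exists v0 e0 s, [/\ at_conf v0 e0 (rep v0 e0), e0 <= t,
  high_ext (rep v0 e0) s & last 0 s = v /\ energy s = e%:Z%R].
(* At a low configuration the actual past is forgotten and play goes on from the representative; at
   a high one the current representative is simply prolonged. *)
have Zhist s (e : nat) : history s -> energy s = e%:Z%R ->
    (~ low s -> exists v0 e0, [/\ at_conf v0 e0 (rep v0 e0), e0 <= t & high_ext (rep v0 e0) s]) ->
    Z (last 0 s) e.
  move=> Hs Ee Hx; case: (pselect (low s)) => [lo|/Hx[v0 [e0 [? ? ?]]]]; last by exists v0, e0, s.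
  have /repP conf : at_conf (last 0 s) e s by [].
  exists (last 0 s), e, (rep (last 0 s) e); split=> //; last by case: conf.
    by move: lo; rewrite /low Ee.
  exact: high_refl.
exists Z.
  split.
    have H0 : history [:: init I] by split.
    have E0 : energy [:: init I] = 0%:Z%R by rewrite /energy big_ord0.
    by apply: (Zhist _ 0 H0 E0) => nl; case: nl; rewrite /low E0.
  move=> _ e [v0 [e0 [s [conf le_e0 Hx [<- Ee]]]]].
  have [H0 _ _] := conf; have Hs := high_ext_history Hx H0; have lt_v := history_last Hs.
  have s_gt0 : 0 < size s by case: Hs.
  have next v' : history (rcons s v') -> exists2 e', moves e (w (last 0 s) v') e' & Z v' e'.
    move=> Hv'; have := energy_ge0 Hv'; case E': (energy (rcons s v')) => [e'|//] _.
    exists e'; first by rewrite /moves -Ee -E' energy_rcons.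
    have := Zhist _ e' Hv' E'; rewrite last_rcons; apply=> nl.
    by exists v0, e0; split=> //; apply: high_ext_rcons.
  split=> //; rewrite /locally_closed; case: ifP => own.
    move=> v' z He; have [Ev <-] := edge_weight He.
    by apply: next; apply: history_rcons => //; rewrite own.
  have [v' Hv'] := history_step Hs; have [e' mv Ze'] := next _ Hv'.
  exists v', (w (last 0 s) v'), e'; split=> //; apply: weight_edge.
  have [_ _ /(_ (size s).-1)] := Hv'; rewrite size_rcons (prednK s_gt0) => /(_ (leqnn _))[Ev _].
  by move: Ev; rewrite !nth_rcons ltnn eqxx prednK // leqnn nth_last.
(* One bound for each representative; a pair that no history reaches gets 0. *)
have [c Hc] : {c : nat * nat -> nat & forall p s, at_conf p.1 p.2 (rep p.1 p.2) ->
    high_ext (rep p.1 p.2) s -> (energy s <= (c p)%:Z)%R}.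
  apply: (@choice _ _ (fun p c => forall s, at_conf p.1 p.2 (rep p.1 p.2) ->
    high_ext (rep p.1 p.2) s -> (energy s <= c%:Z)%R)) => p.
  apply: contrapT => Hc.
  have conf : at_conf p.1 p.2 (rep p.1 p.2) by apply: contrapT => H; apply: Hc; exists 0 => s /H.
  have [H0 _ _] := conf; apply: (low_bounded H0) => c; apply: contrapT => H; apply: Hc; exists c => s _ Hx.
  by rewrite leNgt; apply/negP => lt_c; apply: H; exists s.
exists (\max_(p : 'I_(nV I) * 'I_t.+1) c (val p.1, val p.2)).
move=> v e [v0 [e0 [s [conf le_e0 Hx [_ Ee]]]]].
have lt_v0 : v0 < nV I by case: conf => H <- _; exact: history_last.
have := Hc (v0, e0) s conf Hx; rewrite Ee lez_nat => /leq_trans; apply.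
by exact: (leq_bigmax (Ordinal lt_v0, Ordinal (le_e0 : e0 < t.+1))).
Qed.
End Winning.
Theorem wins_iff_region W : 0 < W -> (forall u v z, (u, v, z) \in edges I -> `|z|%N <= W) ->
  (exists t, player0_wins A (AvgEnergy_L w t)) <->
  exists2 Z, safe_region Z & forall v e, Z v e -> e <= windows W + 2 * W.
Proof.
move=> W_gt0 W_max; split=> [[t [sigma [Hs Hw]]]|[Z HZ HC]].
  have [Z HZ [C HC]] := wins_region Hs Hw.
  exact: short_region HZ HC.
by exists (windows W + 2 * W); exact: region_wins HZ HC.
Qed.

End Game.

(** * The binary code of an instance *)

Lemma bitnS i m : bitn i.+1 m = bitn i m./2.
Proof. by rewrite /bitn expnS divnMA divn2. Qed.

Lemma bitn_inj a b : (forall i, bitn i a = bitn i b) -> a = b.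
Proof.
elim/ltn_ind: a b => a IH b H.
have E0 : odd a = odd b by have := H 0; rewrite /bitn !divn1.
case: (posnP a) => [Ea|a_gt0].
  have Hb i : bitn i b = false by rewrite -H Ea /bitn div0n.
  case: (posnP b) => [->//|b_gt0].
  have /andP[le1 le2] := @trunc_log_bounds 2 b isT b_gt0.
  have := Hb (trunc_log 2 b); rewrite /bitn.
  by have -> : b %/ 2 ^ trunc_log 2 b = 1; first by
    apply/eqP; rewrite eqn_leq leq_divRL ?expn_gt0 // mul1n le1 andbT -ltnS ltn_divLR ?expn_gt0 // -expnS.
rewrite -(odd_double_half a) -(odd_double_half b) E0 (IH a./2 _ b./2) //; first by lia.
by move=> i; rewrite -!bitnS.
Qed.

Definition blen m := size (nat_bits m).

Lemma nat_bitsE m : nat_bits m = mkseq (bitn^~ m) (blen m).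
Proof.
rewrite /blen /nat_bits; case: eqP => // _.
by rewrite size_map size_iota.
Qed.

Lemma ltn_blen m : m < 2 ^ blen m.
Proof.
rewrite /blen /nat_bits; case: eqP => [->//|/eqP]; rewrite -lt0n => m_gt0.
by rewrite size_map size_iota; have /andP[_] := @trunc_log_bounds 2 m isT m_gt0.
Qed.

Lemma bitn_ge i m k : m < 2 ^ k -> k <= i -> bitn i m = false.
Proof.
move=> lt_m le_k; rewrite /bitn divn_small //; apply: leq_trans lt_m _.
by rewrite leq_exp2l.
Qed.

Lemma bitn_top m : blen m != 0 -> bitn (blen m).-1 m.
Proof.
rewrite /blen /nat_bits; case: (m =P 0) => // /eqP; rewrite -lt0n => m_gt0 _.
rewrite size_map size_iota /=; have /andP[le1 le2] := @trunc_log_bounds 2 m isT m_gt0.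
rewrite /bitn; have -> // : m %/ 2 ^ trunc_log 2 m = 1.
by apply/eqP; rewrite eqn_leq leq_divRL ?expn_gt0 // mul1n le1 andbT -ltnS ltn_divLR ?expn_gt0 // -expnS.
Qed.

(** This describes the length through single bits, which is how a formula can state it. *)
Lemma blen_unique m l : (forall i, l <= i -> bitn i m = false) -> (l != 0 -> bitn l.-1 m) -> l = blen m.
Proof.
move=> H1 H2; case: (ltngtP l (blen m)) => // lt.
  by have := @bitn_top m; rewrite H1; [move=> /(_ ltac:(lia))|lia].
by have := bitn_ge (ltn_blen m) (_ : blen m <= l.-1); rewrite H2; [move=> /(_ ltac:(lia))|lia].
Qed.

(* Lets a quantifier over numbers range over the subsets of {0, ..., k-1}. *)
Lemma bitn_comprehension (P : nat -> bool) k :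
  exists2 m, m < 2 ^ k & forall i, i < k -> bitn i m = P i.
Proof.
elim: k P => [|k IH] P; first by exists 0.
have [m lt_m Hm] := IH (fun i => P i.+1); exists (P 0 + m.*2).
  by rewrite expnS; case: (P 0); lia.
case=> [_|i lt_i]; first by rewrite /bitn divn1 oddD odd_double addbF oddb.
by rewrite bitnS half_bit_double Hm.
Qed.

(** * Occurrences of codes at positions of the input *)

Section Occ.
Variable x : seq bool.

Definition occ p (s : seq bool) := forall i, i < size s -> onth x (p + i) = Some (nth false s i).

Lemma occ_cons p b s : occ p (b :: s) <-> onth x p = Some b /\ occ p.+1 s.
Proof.
split=> [H|[H1 H2] [|i] lt_i]; last first.
- by rewrite addnS -addSn; exact: H2.
- by rewrite addn0.
split; first by have := H 0; rewrite addn0; apply.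
by move=> i lt_i; have := H i.+1; rewrite addnS addSn; apply.
Qed.

Lemma occ_cat p s1 s2 : occ p (s1 ++ s2) <-> occ p s1 /\ occ (p + size s1) s2.
Proof.
elim: s1 p => [|b s1 IH] p /=; first by rewrite addn0; split=> [|[]].
by rewrite !occ_cons IH addnS addSn; tauto.
Qed.

Lemma occ_size p s : occ p s -> 0 < size s -> p + size s <= size x.
Proof.
move=> H s0; have := H (size s).-1; rewrite prednK // => /(_ (leqnn _)) E.
have := onthNE x (p + (size s).-1); rewrite E /= => /esym/negbT; lia.
Qed.

Lemma occ_full : occ 0 x.
Proof. by move=> i lt_i; rewrite add0n onthE (nth_map false). Qed.

Lemma occ_eq s : occ 0 s -> size s = size x -> s = x.
Proof.
move=> H E; apply: (@eq_from_nth _ false) => // i lt_i; apply: Some_inj.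
by rewrite -H // -[RHS]occ_full // -E.
Qed.

Lemma occ_det p s1 s2 : occ p s1 -> occ p s2 -> size s1 = size s2 -> s1 = s2.
Proof.
move=> H1 H2 E; apply: (@eq_from_nth _ false) => // i lt_i; apply: Some_inj.
by rewrite -H1 // -H2 // -E.
Qed.

Lemma occ_dbl p (s : seq bool) : occ p (flatten [seq [:: b; b] | b <- s]) <->
  forall i, i < size s -> onth x (p + 2 * i) = Some (nth false s i) /\ onth x (p + 2 * i).+1 = Some (nth false s i).
Proof.
elim: s p => [|b s IH] p //=; rewrite !occ_cons IH; split=> [[H1 [H2 H3]] [|i] lt_i|H].
- by rewrite muln0 addn0.
- by have := H3 i lt_i; rewrite mulnS !addnS !addSn.
have := H 0 isT; rewrite muln0 addn0 => -[E1 E2]; split=> //; split=> // i lt_i.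
by have := H i.+1 lt_i; rewrite mulnS !addnS !addSn.
Qed.

Lemma size_dbl (s : seq bool) : size (flatten [seq [:: b; b] | b <- s]) = 2 * size s.
Proof. by elim: s => //= b s ->; lia. Qed.

Lemma size_enc_nat m : size (enc_nat m) = 2 * blen m + 2.
Proof. by rewrite size_cat size_dbl. Qed.

Lemma occ_enc_nat p m : occ p (enc_nat m) <->
  [/\ forall i, i < blen m -> onth x (p + 2 * i) = Some (bitn i m) /\ onth x (p + 2 * i).+1 = Some (bitn i m),
      onth x (p + 2 * blen m) = Some false & onth x (p + 2 * blen m).+1 = Some true].
Proof.
rewrite /enc_nat occ_cat occ_dbl size_dbl !occ_cons -/(blen m).
have E i : i < blen m -> nth false (nat_bits m) i = bitn i m.
  by move=> lt_i; rewrite nat_bitsE nth_mkseq.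
split=> [[H [H1 [H2 _]]]|[H H1 H2]]; split=> //; first by move=> i lt_i; rewrite -E //; exact: H.
by move=> i lt_i; rewrite E //; exact: H.
Qed.

(** The two bits of a digit agree while those of the end marker differ, so codes that occur at the
    same position have the same length. *)
Lemma enc_nat_inj p a b : occ p (enc_nat a) -> occ p (enc_nat b) -> a = b.
Proof.
move=> /occ_enc_nat[Ha a0 a1] /occ_enc_nat[Hb b0 b1].
have El : blen a = blen b.
  case: (ltngtP (blen a) (blen b)) => // lt.
    by have [] := Hb _ lt; rewrite a0 a1 => -[<-].
  by have [] := Ha _ lt; rewrite b0 b1 => -[<-].
apply: bitn_inj => i; have [lt_i|le_i] := ltnP i (blen a).
  by have [Ea _] := Ha _ lt_i; rewrite El in lt_i; have [Eb _] := Hb _ lt_i; move: Eb; rewrite Ea => -[].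
by rewrite !(bitn_ge (ltn_blen _)) // -El.
Qed.

Lemma enc_nat_bound p m : occ p (enc_nat m) -> m < 2 ^ size x.
Proof.
move=> H; apply: leq_trans (ltn_blen m) _; rewrite leq_exp2l //.
by have := occ_size H; rewrite size_enc_nat; lia.
Qed.

Lemma enc_int_inj p a b : occ p (enc_int a) -> occ p (enc_int b) -> a = b.
Proof.
by case: a b => [a|a] [b|b]; rewrite /enc_int !occ_cons => -[E1 H1] [E2 H2];
  rewrite ?(enc_nat_inj H1 H2) //; move: E1; rewrite E2.
Qed.

Lemma enc_int_bound p z : occ p (enc_int z) -> `|z|%N <= 2 ^ size x.
Proof.
by case: z => m; rewrite /enc_int occ_cons => -[_ /enc_nat_bound] /=; lia.
Qed.

Lemma occ_enc_edge p u v z : occ p (enc_edge (u, v, z)) <->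
  [/\ occ p (enc_nat u), occ (p + size (enc_nat u)) (enc_nat v) &
      occ (p + size (enc_nat u) + size (enc_nat v)) (enc_int z)].
Proof.
rewrite /enc_edge (occ_cat _ (enc_nat u)) (occ_cat _ (enc_nat v)).
by split=> [[? []]|[]].
Qed.

Lemma enc_edge_inj p e1 e2 : occ p (enc_edge e1) -> occ p (enc_edge e2) -> e1 = e2.
Proof.
case: e1 e2 => [[u v] z] [[u' v'] z']; rewrite !occ_enc_edge => -[H1 H2 H3] [G1 G2 G3].
have E1 := enc_nat_inj H1 G1; subst u'.
have E2 := enc_nat_inj H2 G2; subst v'.
by rewrite (enc_int_inj H3 G3).
Qed.

Lemma enc_edges_inj p s1 s2 : occ p (flatten [seq enc_edge e | e <- s1]) ->
  occ p (flatten [seq enc_edge e | e <- s2]) -> size s1 = size s2 -> s1 = s2.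
Proof.
elim: s1 s2 p => [|e1 s1 IH] [|e2 s2] p //=; rewrite (occ_cat _ (enc_edge e1)) (occ_cat _ (enc_edge e2)).
move=> [H1 H2] [G1 G2] [Es].
have E := enc_edge_inj H1 G1; subst e2.
by rewrite (IH _ _ H2 G2).
Qed.

Lemma size_enc_edge e : 0 < size (enc_edge e).
Proof. by rewrite /enc_edge size_cat size_enc_nat; lia. Qed.

Lemma size_enc_edges s : size s <= size (flatten [seq enc_edge e | e <- s]).
Proof. by elim: s => //= e s IH; rewrite size_cat; have := size_enc_edge e; lia. Qed.

Definition owner_pos I := size (enc_nat (nV I)).
Definition edges_pos I := owner_pos I + nV I + size (enc_nat (size (edges I))).
Definition edge_pos I i := edges_pos I + size (flatten [seq enc_edge e | e <- take i (edges I)]).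
Definition init_pos I := edge_pos I (size (edges I)).

(** Equality of words is split into occurrences at computed positions; the final equation excludes
    trailing input. *)
Lemma encodeP I : size (owner1 I) = nV I -> encode I = x <->
  [/\ occ 0 (enc_nat (nV I)), occ (owner_pos I) (owner1 I),
      occ (owner_pos I + nV I) (enc_nat (size (edges I))),
      occ (edges_pos I) (flatten [seq enc_edge e | e <- edges I]) &
      occ (init_pos I) (enc_nat (init I)) /\ init_pos I + size (enc_nat (init I)) = size x].
Proof.
move=> Eo; have Es : size (encode I) = init_pos I + size (enc_nat (init I)).
  rewrite /init_pos /edge_pos /edges_pos /owner_pos take_size /encode.
  by rewrite (size_cat (enc_nat _)) (size_cat (owner1 I)) (size_cat (enc_nat _)) (size_cat (flatten _)) Eo !addnA.
have Eocc : occ 0 (encode I) <-> [/\ occ 0 (enc_nat (nV I)), occ (owner_pos I) (owner1 I),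
      occ (owner_pos I + nV I) (enc_nat (size (edges I))),
      occ (edges_pos I) (flatten [seq enc_edge e | e <- edges I]) &
      occ (init_pos I) (enc_nat (init I))].
  rewrite /encode (occ_cat _ (enc_nat (nV I))) (occ_cat _ (owner1 I)).
  rewrite (occ_cat _ (enc_nat (size _))) (occ_cat _ (flatten _)) Eo add0n /init_pos /edge_pos take_size -/(owner_pos I) -/(edges_pos I).
  by split=> [[? [? [? [? ?]]]]|[]].
split=> [Ex|[H1 H2 H3 H4 [H5 H6]]].
  have /Eocc[? ? ? ? ?] : occ 0 (encode I) by rewrite Ex; exact: occ_full.
  by split=> //; split=> //; rewrite -Es Ex.
by apply: occ_eq; [apply/Eocc|rewrite Es].
Qed.

End Occ.

(** Each use of a formula parses the input afresh; injectivity identifies the instances found. The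
    owner list has no end marker of its own, so its length must be that given by [nV]. *)
Lemma encode_inj I1 I2 : size (owner1 I1) = nV I1 -> size (owner1 I2) = nV I2 ->
  encode I1 = encode I2 -> I1 = I2.
Proof.
move=> O1 O2 E; have [A1 B1 C1 D1 [F1 _]] := (encodeP _ O1).1 E.
have [A2 B2 C2 D2 [F2 _]] := (encodeP _ O2).1 (erefl (encode I2)).
move: O1 O2 A1 B1 C1 D1 F1 A2 B2 C2 D2 F2 {E}; rewrite /init_pos /edge_pos /edges_pos /owner_pos !take_size.
case: I1 => n1 o1 e1 i1; case: I2 => n2 o2 e2 i2 /=.
move: (encode _) => x O1 O2 A1 B1 C1 D1 F1 A2.
rewrite -(enc_nat_inj A1 A2) in O2 *; move=> B2 C2; rewrite -(enc_nat_inj C1 C2) => D2.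
have E := enc_edges_inj D1 D2 (enc_nat_inj C1 C2); rewrite -E => F2.
by rewrite (enc_nat_inj F1 F2) (occ_det B1 B2) // O1 O2.
Qed.

(** * Formulas describing codes *)

Coercion TV : nat >-> term.

(* Locking keeps [rewrite] from confusing the connectives up to unfolding. *)
Fact form_key : unit. Proof. exact: tt. Qed.

Definition FOr f g := locked_with form_key (FNot (FAnd (FNot f) (FNot g))).
Definition FImp f g := locked_with form_key (FNot (FAnd f (FNot g))).
Definition FAll (g : nat -> form) := locked_with form_key (FNot (FEx (fun a => FNot (g a)))).
Definition FAnds := foldr FAnd (FEq T0 T0).

Definition twice t := TMul (TS (TS T0)) t.

Definition DigitAt p i m :=
  FOr (FAnds [:: FX true (TAdd p (twice i)); FX true (TS (TAdd p (twice i))); FBit i m])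
      (FAnds [:: FX false (TAdd p (twice i)); FX false (TS (TAdd p (twice i))); FNot (FBit i m)]).

(** [p] is the start of the code, [q] the position just after it, and [l] the number of digits; the
    last two clauses force [l] to be the exact bit length of [m]. *)
Definition FNum (p q m : term) := locked_with form_key
  (FEx (fun l => FAnds [:: FEq q (TS (TS (TAdd p (twice l)))); FX false (TAdd p (twice l));
    FX true (TS (TAdd p (twice l)));
    FAll (fun i => FImp (FLt i l) (DigitAt p i m));
    FAll (fun i => FOr (FLt i l) (FNot (FBit i m)));
    FOr (FEq l T0) (FEx (fun k => FAnd (FEq l (TS k)) (FBit k m)))])).

(** Terms denote natural numbers, so a weight is never a term: its sign bit selects an equation
    between the two levels. The successor comes from the coding of negative numbers as -(m + 1). *)
Definition FMove (p q e e' : term) := locked_with form_key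
  (FOr (FAnd (FX true p) (FEx (fun m => FAnd (FNum (TS p) q m) (FEq (TAdd e m) e'))))
      (FAnd (FX false p) (FEx (fun m => FAnd (FNum (TS p) q m) (FEq e (TS (TAdd e' m))))))).

Definition FEnds (p r u v : term) := locked_with form_key
  (FEx (fun p1 => FAnd (FNum p p1 u) (FNum p1 r v))).

Definition FEdge (p q u v e e' : term) := locked_with form_key
  (FEx (fun r => FAnd (FEnds p r u v) (FMove r q e e'))).

(** * Meaning of the formulas *)

Section Meaning.
Variables (S : nat) (x : seq bool) (z : nat -> bool).
Local Notation sat := (sat S x z).

Lemma sat_and f g : sat (FAnd f g) = (sat f /\ sat g). Proof. by []. Qed.
Lemma sat_ands0 : sat (FAnds [::]) = (0 = 0). Proof. by []. Qed.
Lemma sat_ands f fs : sat (FAnds (f :: fs)) = (sat f /\ sat (FAnds fs)). Proof. by []. Qed.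
Lemma sat_ex g : sat (FEx g) = exists2 a, a < S & sat (g a). Proof. by []. Qed.
Lemma sat_not f : sat (FNot f) = ~ sat f. Proof. by []. Qed.
Lemma sat_eq t u : sat (FEq t u) = (tval t = tval u). Proof. by []. Qed.
Lemma sat_lt t u : sat (FLt t u) = (tval t < tval u). Proof. by []. Qed.
Lemma sat_bit t u : sat (FBit t u) = bitn (tval t) (tval u). Proof. by []. Qed.
Lemma sat_x b t : sat (FX b t) = (onth x (tval t) = Some b). Proof. by []. Qed.
Lemma sat_z t : sat (FZ t) = z (tval t). Proof. by []. Qed.

Lemma sat_or f g : sat (FOr f g) = (sat f \/ sat g).
Proof.
rewrite [FOr _ _]unlock; apply/propext; split=> [/= H|/= [?|?] [? ?] //]; apply: contrapT => n; apply: H.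
by split=> ?; apply: n; [left|right].
Qed.

Lemma sat_imp f g : sat (FImp f g) = (sat f -> sat g).
Proof. by rewrite [FImp _ _]unlock; apply/propext; split=> /= [H Hf|H [/H]//]; apply: contrapT => n; apply: H. Qed.

Lemma sat_all g : sat (FAll g) = forall a, a < S -> sat (g a).
Proof.
rewrite [FAll _]unlock; apply/propext; split=> /= [H a lt_a|H [a lt_a]]; last by apply; exact: H.
by apply: contrapT => n; apply: H; exists a.
Qed.

Definition satE := (sat_and, sat_ands, sat_ands0, sat_not, sat_eq, sat_lt, sat_bit, sat_x, sat_z,
  sat_or, sat_imp, sat_all, sat_ex).

#[local] Opaque Submission.sat FAnds onth.

Hypothesis S_x : size x + 2 < S.
Hypothesis S_pow : 2 ^ size x + 1 < S.

Lemma FNumP p q m : tval m < S -> sat (FNum p q m) <->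
  occ x (tval p) (enc_nat (tval m)) /\ tval q = tval p + size (enc_nat (tval m)).
Proof.
move=> lt_m; rewrite size_enc_nat /FNum unlock sat_ex; split.
  move=> [l lt_l]; rewrite !satE /= => -[Eq [E0 [E1 [H1 [H2 [H3 _]]]]]].
  have El : l = blen (tval m).
    apply: blen_unique => [i le_i|l0].
      have [lt_i|ge_i] := ltnP i S.
        by have := H2 i lt_i; rewrite !satE /= => -[|/negP/negbTE//]; lia.
      (* The quantifier stops at [S], but a number below [S] has no bits from position [S] on. *)
      apply: (bitn_ge _ ge_i); apply: leq_trans lt_m _; exact: ltnW (ltn_expl _ _).
    by case: H3 => [E|[k _]]; [rewrite E in l0|rewrite !satE /= => -[-> //]].
  split; last by rewrite Eq El; lia.
  apply/occ_enc_nat; rewrite -El; split=> // i lt_i.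
  have lt_iS : i < S by lia.
  have := H1 i lt_iS; rewrite /DigitAt !satE /= => /(_ lt_i).
  by case=> [[-> [-> [-> _]]]|[-> [-> [/negP/negbTE -> _]]]].
move=> [Ho Eq]; have le_x : 2 * blen (tval m) + 2 <= size x.
  by have := occ_size Ho; rewrite size_enc_nat; lia.
have [H1 H2 H3] := (occ_enc_nat _ _ _).1 Ho.
exists (blen (tval m)); first by lia.
rewrite !satE /=; do !split=> //; first by rewrite Eq; lia.
- move=> i _; rewrite /DigitAt !satE /= => lt_i; have [E1 E2] := H1 i lt_i.
  by move: E1 E2; case Eb: (bitn _ _) => E1 E2; [left|right].
- move=> i _; rewrite !satE /=; have [lt_i|le_i] := ltnP i (blen (tval m)); first by left.
  by right=> /=; rewrite (bitn_ge (ltn_blen _)).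
- case: (posnP (blen (tval m))) => [->|l0]; first by left.
  right; exists (blen (tval m)).-1; first by lia.
  by rewrite !satE /= prednK //; split=> //; apply: bitn_top; lia.
Qed.

Lemma FMoveP p q e e' : sat (FMove p q e e') <->
  exists k, [/\ occ x (tval p) (enc_int k), tval q = tval p + size (enc_int k) &
    moves (tval e) k (tval e')].
Proof.
rewrite /FMove unlock !satE; split.
  case=> [[H1 [m lt_m]]|[H1 [m lt_m]]]; rewrite !satE /= => -[/FNumP[]//= H2 H3 H4].
    exists (Posz m); split; [by apply/occ_cons| by rewrite H3 /= addnS addSn|].
    by rewrite /moves -H4 /= PoszD.
  exists (Negz m); split; [by apply/occ_cons| by rewrite H3 /= addnS addSn|].
  by rewrite /moves H4; lia.
move=> [[m|m] [/occ_cons[H1 H2] H3 H4]]; [left|right]; split=> //;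
  have lt_m := enc_nat_bound H2; have lt_mS : m < S by [lia];
  (exists m; first by []); rewrite !satE FNumP //= H3 /= addnS addSn; split=> //; move: H4;
  rewrite /moves /=; lia.
Qed.

Lemma FEndsP p r u v : tval u < S -> tval v < S -> sat (FEnds p r u v) <->
  [/\ occ x (tval p) (enc_nat (tval u)),
      occ x (tval p + size (enc_nat (tval u))) (enc_nat (tval v)) &
      tval r = tval p + size (enc_nat (tval u)) + size (enc_nat (tval v))].
Proof.
move=> lt_u lt_v; rewrite /FEnds unlock sat_ex; split=> [[p1 _]|[H1 H2 E]].
  by rewrite satE !FNumP // => /= -[[H1 E1] [H2 E2]]; rewrite E1 in H2 E2.
exists (tval p + size (enc_nat (tval u))).
  by have := occ_size H1; rewrite size_enc_nat; lia.
by rewrite satE !FNumP.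
Qed.

Lemma FEdgeP p q u v e e' : tval u < S -> tval v < S -> sat (FEdge p q u v e e') <->
  exists k, [/\ occ x (tval p) (enc_edge (tval u, tval v, k)),
      tval q = tval p + size (enc_edge (tval u, tval v, k)) & moves (tval e) k (tval e')].
Proof.
move=> lt_u lt_v; have Es k : size (enc_edge (tval u, tval v, k)) =
    size (enc_nat (tval u)) + size (enc_nat (tval v)) + size (enc_int k).
  by rewrite /enc_edge (size_cat (enc_nat _)) (size_cat (enc_nat _)) addnA.
rewrite /FEdge unlock sat_ex; split=> [[r _]|[k [/occ_enc_edge[H1 H2 H3] Eq mv]]].
  rewrite satE FEndsP // FMoveP /= => -[[H1 H2 Er] [k [H3 Eq mv]]].
  exists k; rewrite Er in H3 Eq; split=> //; first by apply/occ_enc_edge.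
  by rewrite Es Eq !addnA.
exists (tval p + size (enc_nat (tval u)) + size (enc_nat (tval v))).
  by have := occ_size H2; rewrite !size_enc_nat; lia.
rewrite satE FEndsP // FMoveP /=; split=> //.
by exists k; split=> //=; rewrite Eq Es !addnA.
Qed.

End Meaning.

(** * Parsing an instance by a formula *)

(* [R] is the characteristic number of a set of pairs: bit i * K + p of [R]
   says that the code of the i-th edge starts at position p. *)
Definition FAt (K R i p : term) := FBit (TAdd (TMul i K) p) R.

(** [po], [pe] and [pz] are the positions of the owners, the edges and the initial vertex. [K] is
    one more than the input length, recognized as the position where neither bit can be read. The
    clauses on [R] lead from the start of each edge code to the start of the next; the levels [e]
    and [e'] there only witness that a weight is coded. The last three clauses, with the bounds on
    [u] and [v], express well-formedness. *)
Definition FParse (N po pe m K R pz ini : term) := locked_with form_key (FAnds [::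
  FNum T0 po N;
  FNum (TAdd po N) pe m;
  FEx (fun q => FAnds [:: FNum pz q ini; FEq K (TS q); FNot (FX true q); FNot (FX false q)]);
  FAt K R T0 pe;
  FAt K R m pz;
  FAll (fun i => FAll (fun p => FAll (fun p' =>
    FImp (FAnds [:: FLt i (TS m); FLt p K; FLt p' K; FAt K R i p; FAt K R i p']) (FEq p p'))));
  FAll (fun i => FAll (fun p => FImp (FAnds [:: FLt i m; FLt p K; FAt K R i p])
    (FEx (fun q => FEx (fun u => FEx (fun v => FEx (fun e => FEx (fun e' =>
      FAnds [:: FEdge p q u v e e'; FLt q K; FAt K R (TS i) q; FLt u N; FLt v N]))))))));
  FLt ini N;
  FAll (fun i => FAll (fun j => FAll (fun p => FAll (fun p' =>
    FAll (fun u => FAll (fun v => FAll (fun r => FAll (fun r' =>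
      FImp (FAnds [:: FLt i m; FLt j m; FLt p K; FLt p' K; FAt K R i p; FAt K R j p';
                      FEnds p r u v; FEnds p' r' u v]) (FEq i j)))))))));
  FAll (fun u => FImp (FLt u N) (FEx (fun i => FEx (fun p => FEx (fun v => FEx (fun r =>
    FAnds [:: FLt i m; FLt p K; FAt K R i p; FEnds p r u v]))))))]).

Definition FGood (N po m K R idx : term) := locked_with form_key (FEx (fun u => FEx (fun e =>
  FAnds [:: FEq idx (TAdd (TMul e N) u); FLt u N;
    FOr (FAnd (FX true (TAdd po u)) (FAll (fun i => FAll (fun p => FAll (fun v => FAll (fun r =>
           FImp (FAnds [:: FLt i m; FLt p K; FAt K R i p; FEnds p r u v])
             (FEx (fun q => FEx (fun e' =>
                FAnds [:: FEdge p q u v e e'; FZ (TAdd (TMul e' N) v)])))))))))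
        (FAnd (FX false (TAdd po u)) (FEx (fun i => FEx (fun p => FEx (fun v => FEx (fun q =>
           FEx (fun e' => FAnds [:: FLt i m; FLt p K; FAt K R i p; FEdge p q u v e e';
             FZ (TAdd (TMul e' N) v)])))))))]))).

Definition edge0 : nat * nat * int := (0, 0, 0%R).

Lemma occ_nth_edge x p es i : occ x p (flatten [seq enc_edge e | e <- es]) -> i < size es ->
  occ x (p + size (flatten [seq enc_edge e | e <- take i es])) (enc_edge (nth edge0 es i)).
Proof.
move=> + lt_i; rewrite -{1}(cat_take_drop i es) map_cat flatten_cat => /occ_cat[_].
by rewrite (drop_nth edge0 lt_i) /= => /(occ_cat _ _ (enc_edge _) _)[].
Qed.

Lemma edge_pos_le I i : edge_pos I i <= init_pos I.
Proof.
rewrite /edge_pos /init_pos /edge_pos take_size leq_add2l.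
by rewrite -{2}(cat_take_drop i (edges I)) map_cat flatten_cat size_cat leq_addr.
Qed.

Lemma edge_posS I i : i < size (edges I) ->
  edge_pos I i.+1 = edge_pos I i + size (enc_edge (nth edge0 (edges I) i)).
Proof.
move=> lt_i; rewrite /edge_pos (take_nth edge0 lt_i) map_rcons flatten_rcons.
by rewrite (size_cat (flatten _)) addnA.
Qed.

(** * Parsed instances *)

Section Parses.
Variable x : seq bool.
Local Notation n := (size x).

Record parses (I : instance) (N po pe m K R pz ini : nat) : Prop := Parses {
  parses_wf : wf_instance I;
  parses_enc : encode I = x;
  parses_N : N = nV I;
  parses_po : po = owner_pos I;
  parses_pe : pe = edges_pos I;
  parses_m : m = size (edges I);
  parses_K : K = n.+1;
  parses_R : forall i p, i <= m -> p < K -> bitn (i * K + p) R <-> p = edge_pos I i;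
  parses_pz : pz = init_pos I;
  parses_ini : ini = init I }.

Lemma parses_edge I N po pe m K R pz ini i : parses I N po pe m K R pz ini -> i < m ->
  occ x (edge_pos I i) (enc_edge (nth edge0 (edges I) i)).
Proof.
move=> P lt_i; have [Eow _ _ _ _] := parses_wf P.
have [_ _ _ O _] := (encodeP x Eow).1 (parses_enc P).
by apply: occ_nth_edge => //; rewrite -(parses_m P).
Qed.

Lemma init_pos_lt I N po pe m K R pz ini : parses I N po pe m K R pz ini -> init_pos I + 2 <= n.
Proof.
move=> P; have [Eow _ _ _ _] := parses_wf P.
have [_ _ _ _ [_ E]] := (encodeP x Eow).1 (parses_enc P).
by rewrite size_enc_nat in E; lia.
Qed.

End Parses.

Section Parsing.
Variables (S : nat) (x : seq bool) (z : nat -> bool).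
Local Notation sat := (sat S x z).
Local Notation n := (size x).

Hypothesis S_x : n + 2 < S.
Hypothesis S_pow : 2 ^ n + 1 < S.
Hypothesis S_sq : 2 ^ (n.+1 * n.+1) < S.

#[local] Opaque Submission.sat FAnds onth.

Lemma FParse_sound (N po pe m K R pz ini : nat) :
  N < S -> m < S -> ini < S -> sat (FParse N po pe m K R pz ini) ->
  exists I, parses x I N po pe m K R pz ini.
Proof.
move=> lt_N lt_m lt_ini; rewrite /FParse unlock /FAt !satE /= !mul0n !add0n.
rewrite !FNumP //= !add0n.
case=> [[O1 Epo] [[O2 Epe] [[q lt_q Hq] [B0 [Bz [Huniq [Hstep [lt_ini' [Hinj [Hout _]]]]]]]]]].
move: Hq; rewrite !satE FNumP //= => -[[O3 Eq] [EK [Nt [Nf _]]]].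
have le_q : q <= n by have := occ_size O3; rewrite Eq size_enc_nat; lia.
(* Beyond the occurrence found before [q] nothing can be read, so the code ends exactly with the
   input. *)
have Eqn : q = n.
  have := onthNE x q; case E: (onth x q) => [[]|] //=; lia.
have le_pe : pe <= n by have := occ_size O2; rewrite Epe size_enc_nat; lia.
have {}Huniq i p p' : i <= m -> p < K -> p' < K -> bitn (i * K + p) R -> bitn (i * K + p') R -> p = p'.
  move=> le_i lt_p lt_p' H1 H2; have := Huniq i _; rewrite satE => /(_ ltac:(lia) p).
  rewrite satE => /(_ ltac:(lia) p'); rewrite !satE /=; apply; first by lia.
  by rewrite ltnS.
pose flat es := flatten [seq enc_edge e | e <- es].
(* The list of edges is rebuilt by induction along the positions recorded in [R]. *)
have Hes k : k <= m -> exists es : seq (nat * nat * int), [/\ size es = k, occ x pe (flat es),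
    all (fun e => (e.1.1 < N) && (e.1.2 < N)) es &
    forall i, i <= k -> pe + size (flat (take i es)) < K /\
       bitn (i * K + (pe + size (flat (take i es)))) R].
  elim: k => [_|k IH lt_k].
    by exists [::]; split=> // i; rewrite leqn0 => /eqP->; rewrite addn0; split; [lia|].
  have [es [Es Oes Bes Hb]] := IH (ltnW lt_k).
  have [lt_p Bp] := Hb k (leqnn _); rewrite -Es take_size Es in lt_p Bp.
  have := Hstep k _; rewrite satE => /(_ ltac:(lia) (pe + size (flat es))).
  rewrite !satE /= => /(_ ltac:(lia))[//|q1 lt_q1]; rewrite satE => -[u lt_u].
  rewrite satE => -[v lt_v]; rewrite satE => -[e lt_e]; rewrite satE => -[e' lt_e'].
  rewrite !satE FEdgeP //= => -[[y [Oy Ey _]] [lt_q1K [Bq1 [lt_uN [lt_vN _]]]]].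
  exists (rcons es (u, v, y)); rewrite size_rcons Es.
  have Ef : flat (rcons es (u, v, y)) = flat es ++ enc_edge (u, v, y).
    by rewrite /flat map_rcons flatten_rcons.
  split=> //; first by rewrite Ef; apply/(occ_cat _ _ (flat es)).
    by rewrite all_rcons /= lt_uN lt_vN.
  move=> i; rewrite leq_eqVlt => /orP[/eqP->|]; last first.
    by rewrite ltnS => le_i; rewrite -cats1 takel_cat ?Es //; apply: Hb.
  rewrite take_oversize ?size_rcons ?Es // Ef (size_cat (flat es)) addnA -Ey.
  by move: Bq1; rewrite mulSn.
have [es [Es Oes Bes Hb]] := Hes m (leqnn _).
pose I := Instance N (mkseq (fun i => nth false x (po + i)) N) es ini.
have EposI i : edge_pos I i = pe + size (flat (take i es)).
  by rewrite /edge_pos /edges_pos /owner_pos /= -Epo Es -Epe.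
have HR i p : i <= m -> p < K -> bitn (i * K + p) R <-> p = edge_pos I i.
  move=> le_i lt_p; rewrite EposI; have [lt_e Be] := Hb i le_i; split=> [Bp|->] //.
  exact: Huniq Bp Be.
have Epz : pz = init_pos I.
  rewrite /init_pos /= Es; apply/HR => //; by rewrite EK; lia.
have Eow : size (owner1 I) = nV I by rewrite size_mkseq.
have Oedge i : i < m -> occ x (edge_pos I i) (enc_edge (nth edge0 es i)).
  by rewrite EposI -Es; apply: occ_nth_edge.
have lt_ends i : i < m -> (nth edge0 es i).1.1 < N /\ (nth edge0 es i).1.2 < N.
  by rewrite -Es => lt_i; have /andP := allP Bes _ (mem_nth edge0 lt_i).
have ends i r : i < m -> r = edge_pos I i + size (enc_nat (nth edge0 es i).1.1) + size (enc_nat (nth edge0 es i).1.2) ->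
    r < S /\ sat (FEnds (edge_pos I i) r (nth edge0 es i).1.1 (nth edge0 es i).1.2).
  move=> lt_i Er; have := Oedge i lt_i; have [lt1 lt2] := lt_ends i lt_i.
  case: (nth edge0 es i) Er lt1 lt2 => [[u v] y] /= Er lt1 lt2 /occ_enc_edge[H1 H2 H3].
  split; first by have := occ_size H2; rewrite Er !size_enc_nat; lia.
  by apply/FEndsP => //=; lia.
have posK i : i <= m -> edge_pos I i < K by move=> le_i; rewrite EposI; have [] := Hb i le_i.
exists I; split=> //.
- split=> //.
  + apply/(uniqP (0, 0)) => i j; rewrite !inE size_map Es => lt_i lt_j.
    rewrite !(nth_map edge0) ?Es // => Eij.
    have [lt_r Hi] := ends i _ lt_i erefl; have [lt_r' Hj] := ends j _ lt_j erefl.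
    have [lt1 lt2] := lt_ends i lt_i.
    set r := (X in X < S) in lt_r Hi; set r' := (X in X < S) in lt_r' Hj.
    have Pi := posK i (ltnW lt_i); have Pj := posK j (ltnW lt_j).
    have Bi := (HR i _ (ltnW lt_i) Pi).2 erefl; have Bj := (HR j _ (ltnW lt_j) Pj).2 erefl.
    have := Hinj i (ltn_trans lt_i lt_m); rewrite satE => /(_ j (ltn_trans lt_j lt_m)).
    rewrite satE => /(_ (edge_pos I i) ltac:(lia)); rewrite satE => /(_ (edge_pos I j) ltac:(lia)).
    rewrite satE => /(_ (nth edge0 es i).1.1 ltac:(lia)); rewrite satE => /(_ (nth edge0 es i).1.2 ltac:(lia)).
    rewrite satE => /(_ r lt_r); rewrite satE => /(_ r' lt_r').
    rewrite !satE /=; apply; do !split=> //.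
    by rewrite Eij.
  + move=> u lt_u; have := Hout u (ltn_trans lt_u lt_N).
    rewrite !satE /= => /(_ lt_u)[i _]; rewrite satE => -[p _]; rewrite satE => -[v lt_v].
    rewrite satE => -[r _]; rewrite !satE FEndsP /= ?(ltn_trans lt_u) // => -[lt_i [lt_p [Bi [[H1 _ _] _]]]].
    have Ep := (HR i p (ltnW lt_i) lt_p).1 Bi.
    apply/hasP; exists (nth edge0 es i); first by rewrite mem_nth ?Es.
    have := Oedge i lt_i; rewrite -Ep; case: (nth _ _ _) => [[u' v'] y] /occ_enc_edge[H1' _ _] /=.
    by rewrite (enc_nat_inj H1 H1').
- apply/encodeP => //=; rewrite /owner_pos /= -Epo; split=> //.
  + move=> i; rewrite size_mkseq => lt_i; rewrite nth_mkseq // onthE (nth_map false) //.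
    by have := occ_size O2; rewrite size_enc_nat; lia.
  + by rewrite Es.
  + by rewrite /edges_pos /owner_pos /= -Epo Es -Epe.
  + by rewrite -Epz; split=> //; rewrite -Eq.
- by rewrite /edges_pos /owner_pos /= -Epo Es Epe.
- by rewrite EK Eqn.
Qed.

Lemma parses_ends I N po pe m K R pz ini i (p u v r : nat) : parses x I N po pe m K R pz ini ->
  i < m -> p < K -> u < S -> v < S -> bitn (i * K + p) R -> sat (FEnds p r u v) ->
  exists k, nth edge0 (edges I) i = (u, v, k).
Proof.
move=> P lt_i lt_p lt_u lt_v B; rewrite FEndsP //= => -[H1 H2 _].
have Ep := (parses_R P (ltnW lt_i) lt_p).1 B; have := parses_edge P lt_i; rewrite -Ep.
case: (nth _ _ _) => [[u' v'] k] /occ_enc_edge[H1' H2' _].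
have Eu := enc_nat_inj H1 H1'; rewrite -Eu in H2' *.
by rewrite (enc_nat_inj H2 H2'); exists k.
Qed.

Lemma parses_edgeP I N po pe m K R pz ini i (p q u v e e' : nat) : parses x I N po pe m K R pz ini ->
  i < m -> p < K -> u < S -> v < S -> bitn (i * K + p) R -> sat (FEdge p q u v e e') ->
  exists2 k, nth edge0 (edges I) i = (u, v, k) & moves e k e'.
Proof.
move=> P lt_i lt_p lt_u lt_v B; rewrite FEdgeP //= => -[k [H1 _ mv]]; exists k => //.
have Ep := (parses_R P (ltnW lt_i) lt_p).1 B; have := parses_edge P lt_i; rewrite -Ep => H2.
exact: enc_edge_inj H2 H1.
Qed.

Lemma parses_nth I N po pe m K R pz ini i u v k : parses x I N po pe m K R pz ini ->
  i < m -> nth edge0 (edges I) i = (u, v, k) -> exists q r : nat, let p := edge_pos I i in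
    [/\ p < K, bitn (i * K + p) R, [/\ r < S, q < S, u < S & v < S] &
     sat (FEnds p r u v) /\ forall e e' : nat, moves e k e' -> sat (FEdge p q u v e e')].
Proof.
move=> P lt_i Ei.
have [_ _ /allP Hb _ _] := parses_wf P.
have [/= lt_u lt_v] : u < nV I /\ v < nV I.
  by apply/andP/(Hb (u, v, k)); rewrite -Ei mem_nth -?(parses_m P).
have le_pz := init_pos_lt P.
have le_N : nV I <= init_pos I by rewrite /init_pos /edge_pos /edges_pos; lia.
have lt_p : edge_pos I i < K.
  by apply: leq_ltn_trans (edge_pos_le I i) _; rewrite (parses_K P); lia.
have O := parses_edge P lt_i; rewrite Ei in O.
have [H1 H2 H3] := (occ_enc_edge _ _ _ _ _).1 O.
have lt_q := edge_pos_le I i.+1; have Eq := edge_posS (_ : i < size (edges I)).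
rewrite -(parses_m P) in Eq; have {}Eq := Eq lt_i; rewrite Ei in Eq.
have := occ_size H2; rewrite !size_enc_nat => le_r.
exists (edge_pos I i.+1), (edge_pos I i + size (enc_nat u) + size (enc_nat v)).
have lt_uS : u < S by lia.
have lt_vS : v < S by lia.
split=> //.
- by apply/(parses_R P) => //; rewrite ltnW.
- by split=> //; rewrite ?size_enc_nat; lia.
- split; first by apply/FEndsP.
  by move=> e e' mv; apply/FEdgeP => //; exists k.
Qed.

Lemma FParse_complete I : wf_instance I -> encode I = x ->
  exists po pe m K R pz : nat, [/\ po < S /\ pe < S, m < S /\ K < S, R < S /\ pz < S,
    parses x I (nV I) po pe m K R pz (init I) & sat (FParse (nV I) po pe m K R pz (init I))].
Proof.
move=> wfI Ex; have [Eow lt_ini Hb Hu Hout] := wfI.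
have [O1 O2 O3 O4 [O5 E6]] := (encodeP x Eow).1 Ex.
set m := size (edges I); pose K := n.+1.
have le_pos i : edge_pos I i < K by apply: leq_ltn_trans (edge_pos_le I i) _; rewrite ltnS; lia.
have le_m : m < K.
  rewrite ltnS; apply: leq_trans (size_enc_edges _) _.
  by rewrite -E6 /init_pos /edge_pos take_size; lia.
(* Bit k stands for the pair of k div K and k mod K. Since m < K = n + 1, at most (n + 1)^2 bits are
   needed, which is where [S_sq] comes from. *)
have [R lt_R HR] := bitn_comprehension (fun k => k %% K == edge_pos I (k %/ K)) (m.+1 * K).
have lt_RS : R < S.
  apply: leq_ltn_trans S_sq; apply: leq_trans (ltnW lt_R) _.
  by rewrite leq_exp2l // leq_mul.
have R_spec i p : i <= m -> p < K -> bitn (i * K + p) R <-> p = edge_pos I i.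
  move=> le_i lt_p; rewrite HR; last by rewrite mulSn; nia.
  by rewrite modnMDl modn_small // divnMDl // divn_small // addn0; split=> /eqP.
exists (owner_pos I), (edges_pos I), m, K, R, (init_pos I).
have P : parses x I (nV I) (owner_pos I) (edges_pos I) m K R (init_pos I) (init I) by [].
have le_pz := init_pos_lt P.
have le_N : nV I <= init_pos I by rewrite /init_pos /edge_pos /edges_pos; lia.
have le_pe : edges_pos I <= init_pos I by rewrite /init_pos /edge_pos; lia.
have le_po : owner_pos I <= edges_pos I by rewrite /edges_pos; lia.
have lt_mS : m < S by rewrite /K in le_m; lia.
split; [by lia|by rewrite /K in le_m *; lia|by lia|exact: P|].
rewrite /FParse unlock /FAt !satE /= !mul0n !add0n.
rewrite !FNumP //=; last by lia.
do !split=> //.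
- exists n; first by lia.
  rewrite !satE FNumP //=; last by have := enc_nat_bound O5; lia.
  have xn : onth x n = None by have := onthNE x n; rewrite leqnn; case: (onth x n).
  by rewrite xn; do !split.
- have := R_spec 0 (edges_pos I) isT; rewrite mul0n add0n => ->; last by rewrite /K ltnS; lia.
  by rewrite /edge_pos take0 addn0.
- by apply/R_spec => //; exact: le_pos.
- move=> i _; rewrite satE => p _; rewrite satE => p' _; rewrite !satE /= ltnS.
  by case=> [le_i [lt_p [lt_p' [/R_spec-> // [/R_spec-> //]]]]].
- move=> i _; rewrite satE => p _; rewrite !satE /= => -[lt_i [lt_p [/R_spec Ep _]]].
  have {}Ep := Ep (ltnW lt_i) lt_p.
  case Ei: (nth edge0 (edges I) i) => [[u v] k].
  have Hin : (u, v, k) \in edges I by rewrite -Ei mem_nth.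
  have [/= lt_u lt_v] : u < nV I /\ v < nV I by apply/andP/(allP Hb _ Hin).
  have O := parses_edge P lt_i; rewrite Ei -Ep in O.
  have le_k : `|k| <= 2 ^ n.
    by case/occ_enc_edge: O => _ _; exact: enc_int_bound.
  (* A weight is witnessed by climbing from level 0 or by descending to it. *)
  have [e [e' [lt_e lt_e' mv]]] : exists e e' : nat, [/\ e < S, e' < S & moves e k e'].
    by case: k {Ei Hin O} le_k => k /= le_k; [exists 0, k|exists k.+1, 0]; rewrite /moves; split; lia.
  have Eq := edge_posS lt_i; rewrite Ei -Ep in Eq.
  have lt_q := le_pos i.+1; have lt_qS : edge_pos I i.+1 < S by rewrite /K in lt_q; lia.
  exists (edge_pos I i.+1) => //; rewrite satE; exists u; first by lia.
  rewrite satE; exists v; first by lia.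
  rewrite satE; exists e => //; rewrite satE; exists e' => //.
  rewrite !satE FEdgeP //=; [|by lia|by lia]; do !split=> //; first by exists k.
  by apply/R_spec.
- move=> i _; rewrite satE => j _; rewrite satE => p _; rewrite satE => p' _.
  rewrite satE => u lt_u; rewrite satE => v lt_v; rewrite satE => r _; rewrite satE => r' _.
  rewrite !satE /= => -[lt_i [lt_j [lt_p [lt_p' [Bi [Bj [Hi [Hj _]]]]]]]].
  have [k Ei] := parses_ends P lt_i lt_p lt_u lt_v Bi Hi.
  have [k' Ej] := parses_ends P lt_j lt_p' lt_u lt_v Bj Hj.
  have := Hu => /(uniqP (0, 0)) inj; apply: inj; rewrite ?inE ?size_map //.
  by rewrite !(nth_map edge0) // Ei Ej.
- move=> u _; rewrite !satE /= => lt_u.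
  have /hasP[[[u' v] k] Hin /= /eqP E] := Hout u lt_u; subst u'.
  have /(nthP edge0)[i lt_i Ei] := Hin.
  have [q [r [lt_p B [lt_r lt_q lt_uS lt_v] [HE _]]]] := parses_nth P lt_i Ei.
  have lt_iS : i < S := ltn_trans lt_i lt_mS.
  exists i => //; rewrite satE; exists (edge_pos I i); first by rewrite /K in lt_p; lia.
  rewrite satE; exists v => //; rewrite satE; exists r => //.
Qed.

Lemma FGoodP I N po pe m K R pz ini (idx : nat) : parses x I N po pe m K R pz ini ->
  (forall a, z a -> a < S) -> idx < S ->
  sat (FGood N po m K R idx) <-> exists u e, [/\ idx = e * N + u, u < N &
    locally_closed I (fun v e => z (e * N + v)) u e].
Proof.
move=> P Hz lt_idx; have wfI := parses_wf P; have [Eow _ /allP Hb _ _] := wfI.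
have [_ O2 _ _ _] := (encodeP x Eow).1 (parses_enc P).
have le_pz := init_pos_lt P.
have le_N : N <= init_pos I by rewrite (parses_N P) /init_pos /edge_pos /edges_pos; lia.
have le_m : m <= n.
  rewrite (parses_m P); apply: leq_trans (size_enc_edges _) _.
  by move: le_pz; rewrite /init_pos /edge_pos take_size; lia.
have EK := parses_K P.
have Hown u : u < N -> onth x (po + u) = Some (nth false (owner1 I) u).
  by move=> lt_u; rewrite (parses_po P); apply: O2; rewrite Eow -(parses_N P).
rewrite /FGood unlock /FAt satE; split.
  case=> u lt_uS; rewrite satE => -[e lt_e]; rewrite !satE /= => -[E [lt_u [H _]]].
  exists u, e; split=> //; rewrite /locally_closed; move: H; rewrite Hown //.
  case=> [[[->] H]|[[->] H]].
    move=> v k Hin; have /(nthP edge0)[i lt_i Ei] := Hin; rewrite -(parses_m P) in lt_i.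
    have [q [r [lt_p B [lt_r lt_q _ lt_v] [HE _]]]] := parses_nth P lt_i Ei.
    have := H i _; rewrite satE => /(_ ltac:(lia) (edge_pos I i)); rewrite satE => /(_ ltac:(lia) v lt_v).
    rewrite satE => /(_ r lt_r); rewrite !satE /=; case; first by do !split.
    move=> q' _; rewrite satE => -[e' _]; rewrite !satE /= => -[HEd [Zv _]].
    have [k' Ei' mv] := parses_edgeP P lt_i lt_p lt_uS lt_v B HEd.
    by exists e' => //; move: Ei'; rewrite Ei => -[->].
  case: H => i _; rewrite satE => -[p _]; rewrite satE => -[v lt_v]; rewrite satE => -[q _].
  rewrite satE => -[e' _]; rewrite !satE /= => -[lt_i [lt_p [B [HEd [Zv _]]]]].
  have [k Ei mv] := parses_edgeP P lt_i lt_p lt_uS lt_v B HEd.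
  by exists v, k, e'; split=> //; rewrite -Ei mem_nth // -(parses_m P).
case=> u [e [E lt_u]].
have N_gt0 : 0 < N by lia.
have lt_uS : u < S by lia.
(* Quantified levels must stay below [S]; as [N] is positive, a level is at most the number of its
   cell. *)
have zS e' v : z (e' * N + v) -> e' < S.
  by move=> /Hz; apply: leq_ltn_trans; nia.
rewrite /locally_closed => lc.
exists u => //; rewrite satE; exists e; first by nia.
rewrite !satE /= Hown //; do !split=> //.
case: ifP lc => own lc; [left|right]; split=> //.
  move=> i _; rewrite satE => p _; rewrite satE => v lt_v; rewrite satE => r _.
  rewrite !satE /= => -[lt_i [lt_p [B [HE _]]]].
  have [k Ei] := parses_ends P lt_i lt_p lt_uS lt_v B HE.
  have Hin : (u, v, k) \in edges I by rewrite -Ei mem_nth // -(parses_m P).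
  have [e' mv Zv] := lc v k Hin.
  have [q [_ [_ _ [_ lt_q _ _] [_ HEd]]]] := parses_nth P lt_i Ei.
  exists q => //; rewrite satE; exists e'; first exact: zS Zv.
  rewrite !satE /=; do !split=> //.
  by rewrite ((parses_R P (ltnW lt_i) lt_p).1 B); exact: HEd.
have [v [k [e' [Hin mv Zv]]]] := lc.
have /(nthP edge0)[i lt_i Ei] := Hin; rewrite -(parses_m P) in lt_i.
have [q [r [lt_p B [lt_r lt_q _ lt_v] [_ HEd]]]] := parses_nth P lt_i Ei.
exists i; first by lia.
rewrite satE; exists (edge_pos I i); first by lia.
rewrite satE; exists v => //; rewrite satE; exists q => //.
rewrite satE; exists e'; first exact: zS Zv.
by rewrite !satE; do !split=> //; exact: HEd.
Qed.

End Parsing.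

(** * Correctness of the decision procedure *)

Definition with_parse (body : nat -> nat -> nat -> nat -> nat -> nat -> form) : form :=
  FEx (fun N => FEx (fun po => FEx (fun pe => FEx (fun m => FEx (fun K => FEx (fun R =>
  FEx (fun pz => FEx (fun ini =>
    FAnd (FParse N po pe m K R pz ini) (body N po m K R ini))))))))).

(* Position (v, e) of the game with v < N is cell e * N + v of the array. *)
Definition bad_cell (idx : nat) : form :=
  FNot (with_parse (fun N po m K R _ => FGood N po m K R idx)).

Definition accepting : form := with_parse (fun _ _ _ _ _ ini => FZ ini).

Ltac member := first [left; reflexivity | right; member].
(** Destructing the key unlocks the connectives; the syntax of the formula then dictates the
    constructors. *)
Ltac relate :=
  cbv [bad_cell accepting with_parse FParse FGood FAt FEdge FEnds FMove FNum DigitAt twice FAnds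
       FOr FImp FAll foldr locked_with];
  case: form_key;
  repeat match goal with
  | |- forall _, _ => intro
  | |- frel _ (FEx _) _ => apply: FREx
  | |- frel _ (FNot _) _ => apply: FRNot
  | |- frel _ (FAnd _ _) _ => apply: FRAnd
  | |- frel _ (FEq _ _) _ => apply: FREq
  | |- frel _ (FLt _ _) _ => apply: FRLt
  | |- frel _ (FBit _ _) _ => apply: FRBit
  | |- frel _ (FX _ _) _ => apply: FRX
  | |- frel _ (FZ _) _ => apply: FRZ
  | |- trel _ T0 _ => apply: TR0
  | |- trel _ (TS _) _ => apply: TRS
  | |- trel _ (TAdd _ _) _ => apply: TRAdd
  | |- trel _ (TMul _ _) _ => apply: TRMul
  | |- trel _ (TV _) _ => apply: TRV; member
  end.

Lemma bad_cell_rel i a : frel [:: (i, a)] (bad_cell i) (bad_cell a).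
Proof. by relate. Qed.

Lemma accepting_rel : frel [::] accepting accepting.
Proof. by relate. Qed.

(** * Sufficiency of the bound S *)

Section Bounds.
Variable n : nat.
Local Notation S := (2 ^ (2 ^ (4 * n.+1))).

Lemma exp2_gt k : k < 2 ^ k. Proof. exact: ltn_expl. Qed.

Lemma exp2_pos k : 0 < 2 ^ k. Proof. by rewrite expn_gt0. Qed.

Lemma bound_x : n + 2 < S.
Proof.
have := exp2_gt (2 ^ (4 * n.+1)); have := exp2_gt (4 * n.+1); lia.
Qed.

Lemma bound_pow : 2 ^ n + 1 < S.
Proof.
apply: (@leq_trans (2 ^ n.+1 + 1)); first by rewrite expnS; move: (2 ^ n) (exp2_pos n) => p; lia.
apply: (@leq_trans (2 ^ n.+2)); first by rewrite [2 ^ n.+2]expnS; move: (2 ^ n.+1) (exp2_pos n.+1) => p; lia.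
by rewrite leq_exp2l //; have := exp2_gt (4 * n.+1); lia.
Qed.

Lemma bound_sq : 2 ^ (n.+1 * n.+1) < S.
Proof.
rewrite ltn_exp2l //; apply: (@leq_trans (2 ^ n.+1 * 2 ^ n.+1).+1).
  by rewrite ltnS leq_mul // ltnW // exp2_gt.
by rewrite -expnD ltn_exp2l //; lia.
Qed.

(** The left side counts the configurations when W = 2^n. With a = 2^(2n + 1), which bounds the
    exponent N * 2W, it is at most 2^(a + 2 + n), hence at most 2^(2a) = 2^(2^(2n + 2)). *)
Lemma bound_region N : N <= n -> (2 ^ (N * (2 * 2 ^ n)) + 2 * 2 ^ n).+1 * N <= S.
Proof.
move=> le_N; have lt_n := exp2_gt n.
pose a := 2 ^ (2 * n + 1).
have le_a : N * (2 * 2 ^ n) <= a.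
  have -> : a = 2 ^ n * (2 * 2 ^ n) by rewrite /a addn1 expnS (mul2n n) -addnn expnD mulnCA.
  by rewrite leq_mul // ltnW // (leq_ltn_trans le_N).
have lt_a : 2 * n + 1 < a := exp2_gt _.
have le1 : 2 * 2 ^ n <= 2 ^ a by rewrite -expnS leq_exp2l //; lia.
have le2 : 2 ^ (N * (2 * 2 ^ n)) <= 2 ^ a by rewrite leq_exp2l.
apply: (@leq_trans (2 ^ a.+2 * 2 ^ n)).
  apply: leq_mul; last by rewrite ltnW // (leq_ltn_trans le_N).
  by move: le1 le2 (exp2_pos a); rewrite !expnS; move: (2 ^ a) (2 ^ n) (2 ^ _) => p q r; lia.
rewrite -expnD leq_exp2l //; apply: (@leq_trans (2 * a)); first by lia.
by rewrite /a -expnS leq_exp2l //; lia.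
Qed.
End Bounds.

Section Correctness.
Variable x : seq bool.
Local Notation n := (size x).
Local Notation S := (2 ^ (2 ^ (4 * n.+1))).
Local Notation Sx := (bound_x n).
Local Notation Sp := (bound_pow n).
Local Notation Sq := (bound_sq n).

Lemma parses_wf_bound I N po pe m K R pz ini : parses x I N po pe m K R pz ini ->
  [/\ 0 < N, N <= n, ini < N & N = nV I].
Proof.
move=> P; have le_pz := init_pos_lt P; have [_ lt_ini _ _ _] := parses_wf P.
rewrite (parses_N P) (parses_ini P); split=> //; first exact: leq_ltn_trans lt_ini.
by move: le_pz; rewrite /init_pos /edge_pos /edges_pos; lia.
Qed.

Lemma with_parse_intro z body I : wf_instance I -> encode I = x ->
  (forall po pe m K R pz, parses x I (nV I) po pe m K R pz (init I) ->
     sat S x z (body (nV I) po m K R (init I))) ->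
  sat S x z (with_parse body).
Proof.
move=> wfI Ex H; have [po [pe [m [K [R [pz [[? ?] [? ?] [? ?] P sP]]]]]]] :=
  FParse_complete z Sx Sp Sq wfI Ex.
have [_ le_N lt_ini _] := parses_wf_bound P; have := Sx => lt_n.
exists (nV I); first by lia.
exists po => //; exists pe => //; exists m => //; exists K => //; exists R => //; exists pz => //.
exists (init I); first by lia.
by split=> //; exact: H P.
Qed.

Lemma with_parse_elim z body : sat S x z (with_parse body) ->
  exists I N po pe m K R pz ini, parses x I N po pe m K R pz ini /\ sat S x z (body N po m K R ini).
Proof.
case=> N lt_N [po _ [pe _ [m lt_m [K _ [R _ [pz _ [ini lt_ini [sP sb]]]]]]]].
have [I P] := FParse_sound Sx Sp Sq lt_N lt_m lt_ini sP.
by exists I, N, po, pe, m, K, R, pz, ini.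
Qed.

Lemma parses_inj I1 I2 N1 N2 po1 po2 pe1 pe2 m1 m2 K1 K2 R1 R2 pz1 pz2 ini1 ini2 :
  parses x I1 N1 po1 pe1 m1 K1 R1 pz1 ini1 -> parses x I2 N2 po2 pe2 m2 K2 R2 pz2 ini2 -> I1 = I2.
Proof.
move=> P1 P2; have [O1 _ _ _ _] := parses_wf P1; have [O2 _ _ _ _] := parses_wf P2.
by apply: encode_inj => //; rewrite (parses_enc P1) (parses_enc P2).
Qed.

Lemma parses_weight I N po pe m K R pz ini u v k : parses x I N po pe m K R pz ini ->
  (u, v, k) \in edges I -> `|k|%N <= 2 ^ n.
Proof.
move=> P /(nthP edge0)[i lt_i Ei]; rewrite -(parses_m P) in lt_i.
have := parses_edge P lt_i; rewrite Ei => /occ_enc_edge[_ _].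
exact: enc_int_bound.
Qed.

(** An input that codes no well-formed instance has no parse, so [accepting] fails on it. *)
Lemma accepting_correct (Z : nat -> bool) : greatest_stable 4 bad_cell x Z ->
  AvgEnergy_threshold_problem x <-> sat S x Z accepting.
Proof.
move=> [Zlt Zst Zmax]; split.
  case=> I [Ex [wfI Hwin]].
  have [po [pe [m [K [R [pz [_ _ _ P _]]]]]]] := FParse_complete Z Sx Sp Sq wfI Ex.
  have [N_gt0 le_N lt_ini _] := parses_wf_bound P.
  have Wmax u v k (H : (u, v, k) \in edges I) := parses_weight P H.
  have [Z' [Z'0 Z'safe] Z'B] := (wins_iff_region wfI (exp2_pos n) Wmax).1 Hwin.
  apply: (with_parse_intro wfI Ex) => {}po {}pe {}m {}K {}R {}pz {}P.
  pose Pr a := asbool (Z' (a %% nV I) (a %/ nV I)).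
  have PrE v e : v < nV I -> Pr (e * nV I + v) = asbool (Z' v e).
    by move=> lt_v; rewrite /Pr modnMDl modn_small // divnMDl // divn_small // addn0.
  have Pr_lt a : Pr a -> a < S.
    move=> /asboolP /Z'B le_a; apply: leq_trans (bound_region le_N).
    rewrite {1}(divn_eq a (nV I)); apply: (@leq_trans ((a %/ nV I).+1 * nV I)).
      by rewrite mulSn addnC ltn_add2r ltn_mod.
    by rewrite leq_mul.
  (* The cells of a bounded safe region form a closed family, so the computed array contains them,
     in particular the initial one. *)
  suff clP : closed_family 4 bad_cell x Pr.
    apply: (Zmax Pr clP); have := PrE (init I) 0 lt_ini; rewrite mul0n add0n => ->.
    exact/asboolP.
  split=> // Zc PZc Zc_lt a Pa; apply.
  apply: (with_parse_intro wfI Ex) => {}po {}pe {}m {}K {}R {}pz {}P.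
  apply/(FGoodP Sx Sp Sq P Zc_lt (Pr_lt a Pa)).
  exists (a %% nV I), (a %/ nV I); split; [exact: divn_eq|by rewrite ltn_mod|].
  have [_ lc] := Z'safe _ _ (asboolP _ Pa).
  have mono v e : Z' v e -> Zc (e * nV I + v).
    by move=> Zve; apply: PZc; rewrite PrE; [exact/asboolP|case: (Z'safe _ _ Zve)].
  move: lc; rewrite /locally_closed; case: ifP => _.
    by move=> lc v k Hin; have [e' mv Zv] := lc v k Hin; exists e' => //; exact: mono.
  by move=> [v [k [e' [Hin mv Zv]]]]; exists v, k, e'; split=> //; exact: mono.
move=> /with_parse_elim[I [N [po [pe [m [K [R [pz [ini [P Zini]]]]]]]]]].
have wfI := parses_wf P; have [N_gt0 le_N lt_ini EN] := parses_wf_bound P.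
have [_ _ /allP Hb _ _] := wfI.
exists I; split; first exact: parses_enc P.
(* Any bound on the levels serves as threshold; levels are at most cell numbers, hence below [S]. *)
split=> //; exists S; apply: (@region_wins I wfI (fun v e => v < N /\ Z (e * N + v))).
  split; first by rewrite mul0n add0n -(parses_ini P).
  move=> v e [lt_v Ze]; split; first by rewrite -EN.
  (* A cell that survives carries its own parse, which by injectivity is of the same instance. *)
  have [I' [N' [po' [pe' [m' [K' [R' [pz' [ini' [P' sG]]]]]]]]]] : 
      exists I1 N1 po1 pe1 m1 K1 R1 pz1 ini1, parses x I1 N1 po1 pe1 m1 K1 R1 pz1 ini1 /\
        sat S x Z (FGood N1 po1 m1 K1 R1 (e * N + v)).
    by apply: with_parse_elim; apply: contrapT => H; have := Zst _ Ze; rewrite /bad_cell sat_not; apply.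
  have EI := parses_inj P P'; subst I'.
  have EN' : N' = N by rewrite EN (parses_N P').
  rewrite EN' in P' sG.
  have [u [e' [E lt_u lc]]] := (FGoodP Sx Sp Sq P' Zlt (Zlt _ Ze)).1 sG.
  have Ev : v = u by have := congr1 (modn^~ N) E; rewrite !modnMDl !modn_small.
  have Ee : e = e' by have := congr1 (divn^~ N) E; rewrite !divnMDl // !divn_small // !addn0.
  subst u e'; move: lc; rewrite /locally_closed; case: ifP => _.
    move=> lc v' k Hin; have [e' mv Zv] := lc v' k Hin; exists e' => //; split=> //.
    by rewrite EN; have /andP[] := Hb _ Hin.
  move=> [v' [k [e' [Hin mv Zv]]]]; exists v', k, e'; split=> //; split=> //.
  by rewrite EN; have /andP[] := Hb _ Hin.
by move=> v e [_ /Zlt]; nia.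
Qed.

End Correctness.

Theorem theorem1 : in_2EXPTIME AvgEnergy_threshold_problem.
Proof.
apply: (@definable_in_2EXPTIME 4 bad_cell accepting) => //.
- exact: bad_cell_rel.
- exact: accepting_rel.
- exact: accepting_correct.
Qed.
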